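(* Let $a\in\mathbb{R}\setminus\{0\}$ and let $f_a\colon V_0\to\mathbb{R}$, $f_a(x,z)=-a\sqrt{|z|}\,\operatorname{sign}(z)$, where $\operatorname{sign}(z)=1,0,-1$ according to whether $z$ is positive, zero or negative. Let $\Gamma=\Gamma_{f_a}$. Then $\Gamma$ minimizes energy on any bounded open set $W\subset\mathbb{H}$.
   Context: Heisenberg group: $\mathbb{H}=\mathbb{R}^3$ with $(x,y,z)\cdot(x',y',z')=(x+x',y+y',z+z'+\frac{xy'-yx'}{2})$; $Y^t=(0,t,0)$; $d$ is the Carnot–Carathéodory metric for the left-invariant orthonormal horizontal fields $X=(1,0,-\frac y2)$, $Y=(0,1,\frac x2)$, with balls $B(p,r)$. $V_0=\{y=0\}$ with Lebesgue measure $\mu$, points written $(x,z)$; $\Pi(x,y,z)=(x,0,z-\frac{xy}2)$. For $f\colon V_0\to\mathbb{R}$, $\Gamma_f=\{v\cdot Y^{f(v)}:v\in V_0\}$; it is an entire intrinsic Lipschitz graph if for some $\lambda\in(0,1)$, $|y(q)-y(p)|\le\lambda d(p,q)$ for all $p,q\in\Gamma_f$. Then $\nabla_ff\in L_\infty$ is defined by $\int_{V_0}\nabla_ff\,\psi\,d\mu=\int_{V_0}-f\partial_x\psi+\frac{f^2}2\partial_z\psi\,d\mu$, $\psi\in C_c^1(V_0)$. For bounded measurable $U\subset V_0$, $E_U(f)=\frac12\int_U(\nabla_ff)^2d\mu$; for bounded open $W\subset\mathbb{H}$, $E_W(\Gamma_f)=E_{\Pi(W\cap\Gamma_f)}(f)$.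 Epigraph: $\Gamma^+=\{pY^t:p\in\Gamma,t\ge0\}$. An entire intrinsic Lipschitz graph $\Gamma$ minimizes energy on an open set $W$ if $E_{W\cap B(p,r)}(\Gamma)\le E_{W\cap B(p,r)}(\Lambda)$ for every $p\in\mathbb{H}$, $r>0$ and every entire intrinsic Lipschitz graph $\Lambda$ with $\Gamma^+\triangle\Lambda^+$ compactly contained in $W\cap B(p,r)$. *)

(* Defs.v *)
From mathcomp Require Import all_boot all_order all_algebra.
From mathcomp Require Import all_classical all_reals all_analysis.

Set Implicit Arguments.
Unset Strict Implicit.
Unset Printing Implicit Defensive.

Import Order.TTheory GRing.Theory Num.Theory.
Import numFieldNormedType.Exports.

Local Open Scope classical_set_scope.
Local Open Scope ring_scope.

(** ** The Heisenberg group and its Carnot-Caratheodory metric *)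

(* R^3 with its usual topology; (x, y, z) is ((x, y), z). *)
Notation heis R := (R * R * R)%type.

(* V_0 = {y = 0}, the pair (x, z) standing for the point (x, 0, z). *)
Notation V0 R := (R * R)%type.

Section Heisenberg.
Context {R : realType}.
Implicit Types (p q : heis R) (t r : R).

Definition xc p : R := p.1.1.
Definition yc p : R := p.1.2.
Definition zc p : R := p.2.

Definition heis_mul p q : heis R :=
  (xc p + xc q, yc p + yc q, zc p + zc q + (xc p * yc q - yc p * xc q) / 2).

Definition Ypow t : heis R := (0, t, 0).

Definition fieldX p : heis R := (1, 0, - (yc p / 2)).
Definition fieldY p : heis R := (0, 1, xc p / 2).

(* [g] is an absolutely continuous curve on [0, 1] with
   g' = u X(g) + v Y(g) almost everywhere, written in integrated form:
   a function is absolutely continuous with a.e. derivative h if and only if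
   it is a primitive of the integrable function h. *)
Definition horizontal_curve (g : R -> heis R) (u v : R -> R) : Prop :=
  let g' := fun s => u s *: fieldX (g s) + v s *: fieldY (g s) in
  [/\ lebesgue_measure.-integrable `[0, 1] (EFin \o u),
      lebesgue_measure.-integrable `[0, 1] (EFin \o v) &
      forall t, t \in `[0, 1] ->
        [/\ xc (g t) = xc (g 0) + \int[lebesgue_measure]_(s in `[0, t]) xc (g' s),
            yc (g t) = yc (g 0) + \int[lebesgue_measure]_(s in `[0, t]) yc (g' s) &
            zc (g t) = zc (g 0) + \int[lebesgue_measure]_(s in `[0, t]) zc (g' s)]].

(* Length of such a curve: X and Y are orthonormal. *)
Definition horizontal_length (u v : R -> R) : R :=
  \int[lebesgue_measure]_(s in `[0, 1]) Num.sqrt (u s ^+ 2 + v s ^+ 2).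

Definition cc_dist p q : R :=
  inf [set L | exists (g : R -> heis R) (u v : R -> R),
    [/\ horizontal_curve g u v, g 0 = p, g 1 = q & L = horizontal_length u v]].

Definition cc_ball p r : set (heis R) := [set q | cc_dist p q < r].

(** ** Intrinsic graphs over V_0 *)

Definition V0_in_heis (w : V0 R) : heis R := (w.1, 0, w.2).

Definition heis_proj p : V0 R := (xc p, zc p - xc p * yc p / 2).

Implicit Types f : V0 R -> R.

Definition intrinsic_graph f : set (heis R) :=
  [set heis_mul (V0_in_heis w) (Ypow (f w)) | w in [set: V0 R]].

Definition epigraph (G : set (heis R)) : set (heis R) :=
  [set p | exists q t, [/\ G q, 0 <= t & p = heis_mul q (Ypow t)]].

Definition entire_intrinsic_lipschitz f : Prop :=
  exists lambda : R, 0 < lambda < 1 /\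
    forall p q, intrinsic_graph f p -> intrinsic_graph f q ->
      `|yc q - yc p| <= lambda * cc_dist p q.

(** ** Intrinsic gradient and energy *)

Definition mu0 : {measure set (measurableTypeR R * measurableTypeR R) -> \bar R} :=
  (lebesgue_measure \x lebesgue_measure)%E.

Definition dx (psi : V0 R -> R) : V0 R -> R := 'D_((1, 0) : V0 R) psi.
Definition dz (psi : V0 R -> R) : V0 R -> R := 'D_((0, 1) : V0 R) psi.

Definition C1c (psi : V0 R -> R) : Prop :=
  [/\ compact (closure [set w | psi w != 0]),
      forall w, derivable psi w ((1, 0) : V0 R),
      forall w, derivable psi w ((0, 1) : V0 R),
      continuous (dx psi) & continuous (dz psi)].

(* [h] is (a representative of) the class of nabla_f f in L_infty. *)
Definition is_intrinsic_gradient f (h : V0 R -> R) : Prop :=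
  (h : measurableTypeR R * measurableTypeR R -> R) \in Lfun mu0 +oo%E /\
  forall psi, C1c psi ->
    \int[mu0]_w (h w * psi w) =
    \int[mu0]_w (- f w * dx psi w + f w ^+ 2 / 2 * dz psi w).

(* nabla_f f is unique up to null sets, so the infimum is taken over a set
   with at most one element: it is the common value of
   1/2 * \int_U h ^ 2 for all representatives h, and +oo if
   f has no intrinsic gradient in L_infty. *)
Definition energy (U : set (V0 R)) f : \bar R :=
  ereal_inf [set ((2^-1)%:E * \int[mu0]_(w in U) (h w ^+ 2)%:E)%E
            | h in is_intrinsic_gradient f].

(* E_W(Gamma_f) *)
Definition graph_energy (W : set (heis R)) f : \bar R :=
  energy (heis_proj @` (W `&` intrinsic_graph f)) f.

Definition compactly_contained (A U : set (heis R)) : Prop :=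
  compact (closure A) /\ closure A `<=` U.

(* Graphs are given by their functions; Gamma = intrinsic_graph f determines
   f. *)
Definition graph_minimizes_energy (W : set (heis R)) f : Prop :=
  entire_intrinsic_lipschitz f /\
  forall p r (g : V0 R -> R), 0 < r -> entire_intrinsic_lipschitz g ->
    compactly_contained
      (epigraph (intrinsic_graph f) `+` epigraph (intrinsic_graph g))
      (W `&` cc_ball p r) ->
    (graph_energy (W `&` cc_ball p r) f <= graph_energy (W `&` cc_ball p r) g)%E.

Definition f_a (a : R) (w : V0 R) : R := - a * Num.sqrt `|w.2| * Num.sg w.2.

End Heisenberg.

(* Main.v *)
(** Put [c = a ^ 2 / 2]. The intrinsic gradient of [f = f_a a] is [-c sign z], so its
square is constant and it is a constant multiple of [sign f]. Let [g] be a competitor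
with gradient [h], and let [T] be the closure of [{f <> g}].

Every entire intrinsic Lipschitz function is locally 1/2-Hoelder for the Euclidean
structure of the plane, because [cc_dist] is bounded above by means of explicit
horizontal curves. This is enough to mollify [g] and to get, for smooth [s] and
compactly supported [chi], the chain rule
<<
  int h s(g) chi = int (P(g) - g s(g)) chi_x + (g^2/2 s(g) - Q(g)) chi_z,
  P' = t s',  Q' = t^2/2 s',
>>
whose right-hand side does not see [T] if [chi = 1] near [T]. Hence
[int_T h s(g) = int_T (-c sign z) s(f)], and [s(t) = atan (n t)], [n -> oo], gives
[c |T| <= int_T |h|]: this is the calibration. Since [h ^ 2 >= 2 c |h| - c ^ 2], it
follows that [int_T h ^ 2 >= c ^ 2 |T|], and the right-hand side is the integral over [T]
of the squared gradient of [f]. Off [T] the two gradients agree almost everywhere, and [T]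
lies in the common projection of the two graphs. *)

Require Import Defs.
From mathcomp Require Import all_boot all_order all_algebra.
From mathcomp Require Import all_classical all_reals all_analysis.
From mathcomp Require Import measurable_realfun ess_sup_inf.
From mathcomp Require Import ring lra.

Set Implicit Arguments.
Unset Strict Implicit.
Unset Printing Implicit Defensive.

Import Order.TTheory GRing.Theory Num.Theory.
Import numFieldNormedType.Exports.

Local Open Scope classical_set_scope.
Local Open Scope ring_scope.

(** In the weak sense the intrinsic gradient is the Burgers operator [f_x - f f_z]. A product
    [h s(g)] is therefore formally a divergence of a field that depends on [g] pointwise, a null
    Lagrangian. It calibrates [f_a] because the gradient of [f_a] is, off the null line [z = 0], a
    function of the value of [f_a] alone, namely a constant times its sign. The obstacle is
    regularity: for merely continuous solutions of Burgers-type equations the chain rule is not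
    automatic. Mollifying at scale [dlt] an [alpha]-Hoelder function leaves a cubic error of order
    [dlt ^ (3 alpha - 1)], which tends to 0 exactly when [alpha > 1/3]; the exponent 1/2 provided by
    the metric is enough. The metric is used in both directions: an upper bound of [cc_dist] gives
    the regularity of competitors, and a lower bound shows that [f_a] is itself intrinsic Lipschitz.
    A competitor without intrinsic gradient has energy [+oo], so the comparison is made for one
    given representative [h] at a time. *)

(** * One-variable integration of continuous functions *)

Section Calculus.
Context {R : realType}.
Notation mu := (@lebesgue_measure R).

Lemma continuous_itv_integrable (f : R -> R) (a b : R) :
  continuous f -> mu.-integrable `[a, b] (EFin \o f).
Proof.
move=> cf; apply: continuous_compact_integrable; first exact: segment_compact.
exact: continuous_subspaceT.
Qed.

Lemma is_derive_continuous (F f : R -> R) :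
  (forall x, is_derive x (1 : R) F (f x)) -> continuous F.
Proof.
move=> dF x; apply: differentiable_continuous.
by apply/derivable1_diffP; case: (dF x).
Qed.

Lemma Rintegral_FTC (F f : R -> R) (a b : R) : a <= b ->
  (forall x, is_derive x (1 : R) F (f x)) -> continuous f ->
  \int[mu]_(x in `[a, b]) f x = F b - F a.
Proof.
rewrite le_eqVlt => /predU1P[->|ab] dF cf.
  by rewrite set_itv1 Rintegral_set1 subrr.
have cF := is_derive_continuous dF.
rewrite /Rintegral (@continuous_FTC2 _ f F)//.
- exact: continuous_subspaceT.
- split.
  + by move=> x _; case: (dF x).
  + by apply: cvg_at_right_filter; exact: cF.
  + by apply: cvg_at_left_filter; exact: cF.
- by move=> x _; rewrite derive1E; have dFx := dF x; rewrite derive_val.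
Qed.

Lemma le_Rintegral_itv01 (f : R -> R) (M : R) : continuous f ->
  (forall t, t \in `[0, 1] -> f t <= M) -> \int[mu]_(x in `[0, 1]) f x <= M.
Proof.
move=> cf fM.
have -> : M = \int[mu]_(x in `[0%R, 1%R]) M.
  by rewrite Rintegral_cst//= lebesgue_measure_itv/= lte_fin ltr01 oppr0 adde0/= mulr1.
apply: le_Rintegral => //; [exact: continuous_itv_integrable|].
by apply: continuous_itv_integrable; exact: cst_continuous.
Qed.

End Calculus.

(** * Horizontal curves and the Carnot-Caratheodory distance *)

Section ConnectingCurve.
Context {R : realType}.
Notation mu := (@lebesgue_measure R).
Implicit Types p q : heis R.

Lemma velocityE (a b : R) p :
  (xc (a *: fieldX p + b *: fieldY p) = a) *
  (yc (a *: fieldX p + b *: fieldY p) = b) *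
  (zc (a *: fieldX p + b *: fieldY p) = (xc p * b - yc p * a) / 2).
Proof.
have -> : zc (a *: fieldX p + b *: fieldY p) = a * - (yc p / 2) + b * (xc p / 2).
  by [].
rewrite /xc /yc /zc /= !scaler0 addr0 add0r ![_%:A]mulr1; split; first by split.
by ring.
Qed.

Lemma sqrtr_le_sqr (x y : R) : 0 <= y -> x <= y ^+ 2 -> Num.sqrt x <= y.
Proof. by move=> y0 xy; rewrite -[leRHS]ger0_norm// -sqrtr_sqr ler_wsqrtr. Qed.

(* The height of [p^-1 q]. *)
Definition area_defect p q : R :=
  zc q - zc p - (xc p * yc q - yc p * xc q) / 2.

(* The connecting curve has horizontal projection the segment from [p] to [q] plus
   multiples of [phi] in x and [theta] in y. Both vanish at 0 and 1, and they are chosen so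
   that [int phi = int theta = 0] and [int phi theta' = - 1/70]: the loop is orthogonal to
   the segment and contributes area in proportion to the product of the multiples. [psi1],
   [psi2], [psi3] are primitives of [2 theta], [2 phi], [2 phi theta']. *)
Let phi : {poly R} := 'X - 3 *: 'X^2 + 2 *: 'X^3.
Let theta : {poly R} := 'X - 6 *: 'X^2 + 10 *: 'X^3 - 5 *: 'X^4.

Let psi1 : {poly R} := 'X^2 - 4 *: 'X^3 + 5 *: 'X^4 - 2 *: 'X^5.
Let psi2 : {poly R} := 'X^2 - 2 *: 'X^3 + 'X^4.
Let psi3 : {poly R} := 'X^2 - 10 *: 'X^3 + 34 *: 'X^4 - (2 * 134 / 5) *: 'X^5
  + 40 *: 'X^6 - (80 / 7) *: 'X^7.

Ltac eval_deriv := rewrite !(derivD, derivN, derivZ, derivXn, derivX);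
  rewrite !(hornerD, hornerN, hornerZ, hornerX, hornerXn, hornerMn, hornerC)/=.

Let phiE t : (phi.[t] = t - 3 * t ^+ 2 + 2 * t ^+ 3) *
  ((deriv phi).[t] = 1 - 6 * t + 6 * t ^+ 2).
Proof. by rewrite /phi; eval_deriv; split; ring. Qed.

Let thetaE t : (theta.[t] = t - 6 * t ^+ 2 + 10 * t ^+ 3 - 5 * t ^+ 4) *
  ((deriv theta).[t] = 1 - 12 * t + 30 * t ^+ 2 - 20 * t ^+ 3).
Proof. by rewrite /theta; eval_deriv; split; ring. Qed.

Let psiE t : ((deriv psi1).[t] = 2 * t - 12 * t ^+ 2 + 20 * t ^+ 3 - 10 * t ^+ 4) *
  ((deriv psi2).[t] = 2 * t - 6 * t ^+ 2 + 4 * t ^+ 3) *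
  ((deriv psi3).[t] = 2 * (t - 15 * t ^+ 2 + 68 * t ^+ 3 - 134 * t ^+ 4
    + 120 * t ^+ 5 - 40 * t ^+ 6)).
Proof.
split; first split.
- by rewrite /psi1; eval_deriv; ring.
- by rewrite /psi2; eval_deriv; ring.
- by rewrite /psi3 !(derivD, derivN, derivZ, derivXn, derivX)
     !(hornerD, hornerN, hornerZ, hornerXn, hornerMn)/=; field.
Qed.

Let psi_valE : (psi1.[0] = 0) * (psi2.[0] = 0) * (psi3.[0] = 0) *
  (psi1.[1] = 0) * (psi2.[1] = 0) * (psi3.[1] = - (1 / 35)).
Proof.
rewrite /psi1 /psi2 /psi3.
by do !split; rewrite !(hornerD, hornerN, hornerZ, hornerXn)/= ?expr0n ?expr1n/=;
  field.
Qed.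

Lemma connecting_curve p q : exists g u v,
  [/\ horizontal_curve g u v, g 0 = p, g 1 = q &
      horizontal_length u v <=
        `|xc q - xc p| + `|yc q - yc p| + 700 * Num.sqrt `|area_defect p q|].
Proof.
move: (phiE) (thetaE) (psiE) (psi_valE); clear phiE thetaE psiE psi_valE.
clearbody phi theta psi1 psi2 psi3 => phiE thetaE psiE psi_valE.
case: p => [[x0 y0] z0]; case: q => [[x1 y1] z1].
rewrite /area_defect /xc /yc /zc /=.
set dlt := z1 - z0 - (x0 * y1 - y0 * x1) / 2.
(* The loop adds the area [al * be * int phi theta' = - al * be / 70], so the product [al * be] has
   to be [- 70 * dlt]. Both factors get the modulus [sqrt (70 * |dlt|)], the sign going to [be], and
   [9 ^ 2 = 81] dominates 70. *)
pose k : R := 9 * Num.sqrt `|dlt|.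
have k0 : 0 <= k by rewrite mulr_ge0// sqrtr_ge0.
have [al [be [albe alk bek]]] :
    exists al be : R, [/\ al * be = - (70 * dlt), `|al| <= k & `|be| <= k].
  have kE : Num.sqrt (70 * `|dlt|) <= k.
    by rewrite sqrtrM// ler_wpM2r// ?sqrtr_ge0// sqrtr_le_sqr//; lra.
  exists (Num.sqrt (70 * `|dlt|)), (- Num.sg dlt * Num.sqrt (70 * `|dlt|)); split.
  - by rewrite mulrCA -expr2 sqr_sqrtr ?mulr_ge0// mulNr mulrCA -numEsg.
  - by rewrite ger0_norm// sqrtr_ge0.
  - rewrite normrM normrN (ger0_norm (sqrtr_ge0 _)) (le_trans _ kE)//.
    rewrite ler_piMl// ?sqrtr_ge0//.
    by case: sgrP => _; rewrite ?normr0 ?normr1 ?normrN1.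
pose x : {poly R} := x0%:P + (x1 - x0) *: 'X + al *: phi.
pose y : {poly R} := y0%:P + (y1 - y0) *: 'X + be *: theta.
pose u t := (deriv x).[t]; pose v t := (deriv y).[t].
pose w t := (x.[t] * v t - y.[t] * u t) / 2.
pose g t : heis R := (x.[t], y.[t], z0 + \int[mu]_(s in `[0, t]) w s).
have cu : continuous u by exact: continuous_horner.
have cv : continuous v by exact: continuous_horner.
exists g, u, v; split.
- split; [exact: continuous_itv_integrable..|] => t /itvP t01; split.
  + under eq_Rintegral do rewrite velocityE.
    by rewrite (@Rintegral_FTC _ (horner x)) ?t01// subrKC.
  + under eq_Rintegral do rewrite velocityE.
    by rewrite (@Rintegral_FTC _ (horner y)) ?t01// subrKC.
  + under [in RHS]eq_Rintegral do rewrite velocityE.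
    by rewrite /zc/= set_itv1 Rintegral_set1 addr0.
- rewrite /g set_itv1 Rintegral_set1 addr0; congr (_, _, _).
  + by rewrite /x !(hornerD, hornerZ, hornerX, hornerC) phiE; ring.
  + by rewrite /y !(hornerD, hornerZ, hornerX, hornerC) thetaE; ring.
- rewrite /g; congr (_, _, _).
  + by rewrite /x !(hornerD, hornerZ, hornerX, hornerC) phiE; ring.
  + by rewrite /y !(hornerD, hornerZ, hornerX, hornerC) thetaE; ring.
  (* An explicit primitive of [(x y' - y x') / 2]. Integration by parts explains its blocks:
     ['X * theta - psi1] has derivative [t theta' - theta], and [psi3 - phi * theta] has derivative
     [phi theta' - theta phi']. *)
  pose P : {poly R} := 2^-1 *: ((x0 * (y1 - y0) - y0 * (x1 - x0)) *: 'X
    + (x0 * be) *: theta - (y0 * al) *: phi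
    + ((x1 - x0) * be) *: ('X * theta - psi1)
    - (al * (y1 - y0)) *: ('X * phi - psi2)
    + (al * be) *: (psi3 - phi * theta)).
  have PE t : (deriv P).[t] = w t.
    rewrite /w /u /v /P /x /y !(derivZ, derivD, derivN, derivM, derivX, derivC).
    rewrite !(hornerD, hornerN, hornerZ, hornerM, hornerX, hornerC) !phiE !thetaE !psiE.
    by field.
  have cw : continuous w.
    by rewrite (_ : w = horner (deriv P)); [exact: continuous_horner|apply/funext => t; rewrite PE].
  have dP t : is_derive t (1 : R) (horner P) (w t).
    by rewrite -PE; exact: is_derive_poly.
  rewrite (Rintegral_FTC ler01 dP cw).
  rewrite /P !(hornerD, hornerN, hornerZ, hornerM, hornerX) !phiE !thetaE !psi_valE albe.
  by rewrite /dlt; field.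
- rewrite /horizontal_length; apply: le_Rintegral_itv01.
    move=> t.
    apply: (@continuous_comp _ _ _ (fun s => u s ^+ 2 + v s ^+ 2) Num.sqrt).
      apply: (@cvgD _ _ _ _ _ (fun s => u s ^+ 2) (fun s => v s ^+ 2)).
        by apply: (@cvgM _ _ _ _ u u); exact: cu.
      by apply: (@cvgM _ _ _ _ v v); exact: cv.
    exact: sqrt_continuous.
  move=> t; rewrite in_itv/= => /andP[t0 t1].
  (* On [[0, 1]] the sums of the absolute values of the coefficients, 13 and 63, bound [phi'] and
     [theta']. Then [9 * (13 + 63) = 684] lies below the constant 700 of the statement. *)
  have ut : `|u t| <= `|x1 - x0| + k * 13.
    rewrite /u /x !(derivD, derivZ, derivX, derivC, hornerD, hornerZ, hornerC) phiE add0r mulr1 (le_trans (ler_normD _ _))//.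
    rewrite lerD// normrM ler_pM// ler_norml.
    by apply/andP; split; nra.
  have vt : `|v t| <= `|y1 - y0| + k * 63.
    rewrite /v /y !(derivD, derivZ, derivX, derivC, hornerD, hornerZ, hornerC) thetaE add0r mulr1 (le_trans (ler_normD _ _))//.
    rewrite lerD// normrM ler_pM// ler_norml.
    by apply/andP; split; nra.
  move: (u t) (v t) ut vt => U V ut vt.
  have U0 := normr_ge0 U; have V0 := normr_ge0 V.
  apply: (@le_trans _ _ (`|U| + `|V|)); last by move: ut vt k0; rewrite /k; lra.
  apply: sqrtr_le_sqr; first exact: addr_ge0.
  rewrite -(real_normK (num_real U)) -(real_normK (num_real V)).
  by rewrite sqrrD -addrA lerD2l lerDr mulrn_wge0// mulr_ge0.
Qed.

End ConnectingCurve.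

(** * Integrability of real-valued functions *)

Section RealIntegrable.
Context d (T : measurableType d) (R : realType) (mu : {measure set T -> \bar R}).
Variables (D : set T) (mD : measurable D).
Implicit Types f g h : T -> R.
Local Notation intg f := (mu.-integrable D (EFin \o f)).

Lemma integrableRD f g : intg f -> intg g -> intg (fun x => f x + g x).
Proof.
move=> fi gi; rewrite (_ : _ \o _ = (EFin \o f) \+ (EFin \o g))%E//.
exact: integrableD.
Qed.

Lemma integrableRZ (k : R) f : intg f -> intg (fun x => k * f x).
Proof.
move=> fi; rewrite (_ : _ \o _ = fun x => k%:E * (EFin \o f) x)%E//.
exact: integrableZl.
Qed.

Lemma integrableRN f : intg f -> intg (fun x => - f x).
Proof.
by move=> /(integrableRZ (-1)); under [X in _ \o X]eq_fun do rewrite mulN1r.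
Qed.

Lemma integrableRB f g : intg f -> intg g -> intg (fun x => f x - g x).
Proof. by move=> fi gi; apply: integrableRD => //; exact: integrableRN. Qed.

Lemma integrableR_norm f : intg f -> intg (fun x => `|f x|).
Proof. exact: integrable_norm. Qed.

Lemma integrable_norm_le f g : measurable_fun D f ->
  (forall x, D x -> `|f x| <= g x) -> intg g -> intg f.
Proof.
move=> mf fg; apply: le_integrable => //; first exact/measurable_EFinP.
by move=> x Dx; rewrite /= lee_fin (le_trans (fg _ Dx))// ler_norm.
Qed.

Lemma integrable_bddM (M : R) h f : measurable_fun D h ->
  (forall x, D x -> `|h x| <= M) -> intg f -> intg (fun x => h x * f x).
Proof.
move=> mh hM fi.
have mf : measurable_fun D f by apply/measurable_EFinP; exact: (measurable_int mu).
apply: (@integrable_norm_le _ (fun x => M * `|f x|)).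
- exact: measurable_funM.
- by move=> x Dx; rewrite normrM ler_wpM2r// hM.
- exact/integrableRZ/integrable_norm.
Qed.

End RealIntegrable.

(** * Upper and lower bounds for the distance *)

Section HorizontalCurve.
Context {R : realType}.
Notation mu := (@lebesgue_measure R).
Implicit Types p q : heis R.

(* [A] and [B] are the integrals of [`|u|] and [`|v|]. The last clause is Cauchy-Schwarz
   in dual form, which avoids dividing by [A ^+ 2 + B ^+ 2]. *)
Lemma horizontal_curve_bounds (g : R -> heis R) (u v : R -> R) :
  horizontal_curve g u v ->
  exists A B : R, [/\ `|xc (g 1) - xc (g 0)| <= A, `|yc (g 1) - yc (g 0)| <= B,
    `|area_defect (g 0) (g 1)| <= A * B &
    forall c s, 0 <= c -> 0 <= s -> c ^+ 2 + s ^+ 2 <= 1 ->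
      c * A + s * B <= horizontal_length u v].
Proof.
case=> iu iv H.
have mI : measurable (`[0, 1]%classic : set (measurableTypeR R)) by exact: measurable_itv.
have Hx t : t \in `[0, 1] -> xc (g t) = xc (g 0) + \int[mu]_(s in `[0, t]) u s.
  by move=> /H [+ _ _]; under eq_Rintegral do rewrite velocityE.
have Hy t : t \in `[0, 1] -> yc (g t) = yc (g 0) + \int[mu]_(s in `[0, t]) v s.
  by move=> /H [_ + _]; under eq_Rintegral do rewrite velocityE.
have I1 : (1 : R) \in `[0, 1] by rewrite in_itv/= ler01 lexx.
have Hz : zc (g 1) = zc (g 0) +
    \int[mu]_(s in `[0, 1]) ((xc (g s) * v s - yc (g s) * u s) / 2).
  by have [_ _ +] := H _ I1; under eq_Rintegral do rewrite velocityE.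
pose A := \int[mu]_(s in `[0, 1]) `|u s|.
pose B := \int[mu]_(s in `[0, 1]) `|v s|.
have bnd (f : R -> R) t : mu.-integrable `[0, 1] (EFin \o f) -> t \in `[0, 1] ->
    `|\int[mu]_(s in `[0, t]) f s| <= \int[mu]_(s in `[0, 1]) `|f s|.
  move=> fi; rewrite in_itv/= => /andP[t0 t1].
  have st : (`[0, t] `<=` `[0, 1])%classic.
    by apply: subset_itvl; rewrite bnd_simp.
  have fit : mu.-integrable `[0, t] (EFin \o f) by exact: integrableS fi.
  apply: le_trans (le_normr_Rintegral _ _) _ => //.
  rewrite Rintegral_mkcond [leRHS]Rintegral_mkcond.
  apply: le_Rintegral => //.
  - by rewrite -restrict_EFin; apply: (iffLR (integrable_mkcond _ _)) => //; exact: integrableR_norm.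
  - by rewrite -restrict_EFin; apply: (iffLR (integrable_mkcond _ _)) => //; exact: integrableR_norm.
  - move=> s _; rewrite !patchE; case: ifPn => [sA|_]; last by case: ifPn => _; [exact: normr_ge0|exact: lexx].
    by rewrite ifT//; move: sA; rewrite !inE; exact: st.
have xA t : t \in `[0, 1] -> `|xc (g t) - xc (g 0)| <= A.
  by move=> t01; rewrite (Hx t)// addrAC subrr add0r bnd.
have yB t : t \in `[0, 1] -> `|yc (g t) - yc (g 0)| <= B.
  by move=> t01; rewrite (Hy t)// addrAC subrr add0r bnd.
(* No regularity of [g] is given beforehand: its coordinates are measurable because on [[0, 1]] they
   differ by constants from primitives, which are continuous. *)
have mprim (f : R -> R) : mu.-integrable `[0, 1] (EFin \o f) ->
    measurable_fun `[(0 : R), 1] (fun t => \int[mu]_(s in `[0, t]) f s).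
  move=> fi; apply: subspace_continuous_measurable_fun => //.
  exact: parameterized_integral_continuous.
have mx : measurable_fun `[(0 : R), 1] (fun t => xc (g t) - xc (g 0)).
  apply: eq_measurable_fun (mprim _ iu).
  by move=> t /set_mem t01; rewrite (Hx t)// addrAC subrr add0r.
have my : measurable_fun `[(0 : R), 1] (fun t => yc (g t) - yc (g 0)).
  apply: eq_measurable_fun (mprim _ iv).
  by move=> t /set_mem t01; rewrite (Hy t)// addrAC subrr add0r.
have ixv : mu.-integrable `[0, 1] (EFin \o (fun t => (xc (g t) - xc (g 0)) * v t)).
  exact: (@integrable_bddM _ _ _ _ _ _ A).
have iyu : mu.-integrable `[0, 1] (EFin \o (fun t => (yc (g t) - yc (g 0)) * u t)).
  exact: (@integrable_bddM _ _ _ _ _ _ B).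
have inu : mu.-integrable `[0, 1] (EFin \o (fun t => `|u t|)) by exact: integrableR_norm.
have inv : mu.-integrable `[0, 1] (EFin \o (fun t => `|v t|)) by exact: integrableR_norm.
exists A, B; split; [exact: xA|exact: yB| |].
(* Left translation of the starting point to the origin: the defect is the area swept by the centred
   curve. The centred coordinates are at most [A] and [B], whence the bound
   [(A * B + B * A) / 2]. *)
- have -> : area_defect (g 0) (g 1) = \int[mu]_(t in `[0, 1])
      (2^-1 * ((xc (g t) - xc (g 0)) * v t - (yc (g t) - yc (g 0)) * u t)).
    rewrite /area_defect Hz (Hx 1)// (Hy 1)//.
    transitivity (\int[mu]_(t in `[0, 1]) ((xc (g t) * v t - yc (g t) * u t) / 2)
      - 2^-1 * (xc (g 0) * \int[mu]_(t in `[0, 1]) v t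
      - yc (g 0) * \int[mu]_(t in `[0, 1]) u t)); first by field.
    have i0v := integrableRZ mI (xc (g 0)) iv; have i0u := integrableRZ mI (yc (g 0)) iu.
    rewrite -!RintegralZl// -RintegralB// -RintegralZl//; last exact: integrableRB.
    rewrite -RintegralB//.
    + by apply: eq_Rintegral => t _; field.
    + have := integrableRZ mI (2^-1) (integrableRB mI (integrableRD mI ixv i0v)
        (integrableRD mI iyu i0u)).
      apply: eq_integrable => // t _ /=; congr EFin; by field.
    + by apply: integrableRZ => //; exact: integrableRB.
  apply: le_trans (le_normr_Rintegral _ _) _ => //.
    by apply: integrableRZ => //; exact: integrableRB.
  apply: (@le_trans _ _ (\int[mu]_(t in `[0, 1]) (2^-1 * (A * `|v t| + B * `|u t|)))).
    apply: le_Rintegral => //.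
    + by apply: integrable_norm; apply: integrableRZ => //; exact: integrableRB.
    + by apply: integrableRZ => //; apply: integrableRD => //; exact: integrableRZ.
    + move=> t t01; rewrite normrM gtr0_norm ?invr_gt0// ler_wpM2l ?invr_ge0//.
      rewrite (le_trans (ler_normB _ _))// !normrM.
      by rewrite lerD// ler_wpM2r// ?xA// yB.
  rewrite RintegralZl//; last by apply: integrableRD => //; exact: integrableRZ.
  rewrite RintegralD//; [|exact: integrableRZ..].
  rewrite !RintegralZl// -/A -/B [leLHS](_ : _ = A * B)//.
  by field.
- move=> c s c0 s0 cs; rewrite /A /B -!RintegralZl// -RintegralD//; [|exact: integrableRZ..].
  have mu_ : measurable_fun `[(0 : R), 1] u by apply/measurable_EFinP; exact: (measurable_int mu).
  have mv_ : measurable_fun `[(0 : R), 1] v by apply/measurable_EFinP; exact: (measurable_int mu).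
  apply: le_Rintegral => //.
  + by apply: integrableRD => //; exact: integrableRZ.
  + apply: (integrable_norm_le mI _ _ (integrableRD mI inu inv)).
    * apply: measurableT_comp; first exact: continuous_measurable_fun (@sqrt_continuous R).
      by apply: measurable_funD; exact: measurable_funX.
    * move=> t t01; rewrite ger0_norm ?sqrtr_ge0// sqrtr_le_sqr ?addr_ge0//.
      rewrite -(real_normK (num_real (u t))) -(real_normK (num_real (v t))).
      by rewrite sqrrD -addrA lerD2l lerDr mulrn_wge0// mulr_ge0.
  + move=> t t01; rewrite -[leLHS]ger0_norm ?addr_ge0 ?mulr_ge0// -sqrtr_sqr.
    rewrite ler_wsqrtr//.
    rewrite -(real_normK (num_real (u t))) -(real_normK (num_real (v t))).
    move: `|u t| `|v t| => U V.
    (* Lagrange's identity: [(c U + s V)^2 + (s U - c V)^2 = (c^2 + s^2) (U^2 + V^2)]. *)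
    have := sqr_ge0 (s * U - c * V).
    have : (c ^+ 2 + s ^+ 2) * (U ^+ 2 + V ^+ 2) <= U ^+ 2 + V ^+ 2.
      by rewrite ler_piMl// addr_ge0// sqr_ge0.
    nra.
Qed.

Lemma horizontal_length_ge0 (u v : R -> R) : 0 <= horizontal_length u v.
Proof. by apply: Rintegral_ge0 => t _; exact: sqrtr_ge0. Qed.

Lemma cc_dist_le p q : cc_dist p q <=
  `|xc q - xc p| + `|yc q - yc p| + 700 * Num.sqrt `|area_defect p q|.
Proof.
have [g [u [v [gh g0 g1 +]]]] := connecting_curve p q; apply: le_trans.
apply: ge_inf; last by exists g, u, v.
by exists 0 => _ [? [? [? [_ _ _ ->]]]]; exact: horizontal_length_ge0.
Qed.

(** For lower bounds a curve is replaced by three numbers: the total variations [A] and [B] of its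
    two horizontal coordinates, tied to the endpoints by the displacement and area constraints, and
    its length [L], at least the Euclidean norm of [(A, B)]. *)
Lemma cc_dist_ge p q (K : R) :
  (forall A B L, `|xc q - xc p| <= A -> `|yc q - yc p| <= B ->
    `|area_defect p q| <= A * B ->
    (forall c s, 0 <= c -> 0 <= s -> c ^+ 2 + s ^+ 2 <= 1 -> c * A + s * B <= L) ->
    K <= L) ->
  K <= cc_dist p q.
Proof.
move=> H; apply: lb_le_inf.
  (* A lower bound passes to [inf] only on a nonempty set, so the existence of a connecting curve is
     needed here too. *)
  have [g [u [v [gh g0 g1 _]]]] := connecting_curve p q.
  by exists (horizontal_length u v), g, u, v.
move=> _ [g [u [v [gh gp gq ->]]]]; subst p q.
by have [A [B [? ? ? ?]]] := horizontal_curve_bounds gh; exact: (H A B).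
Qed.

End HorizontalCurve.

(** * Intrinsic Lipschitz functions *)

Section IntrinsicGraph.
Context {R : realType}.
Implicit Types (w : V0 R) (f g : V0 R -> R).

Definition graph_point f w : heis R := heis_mul (V0_in_heis w) (Ypow (f w)).

Lemma graph_pointE f w : graph_point f w = (w.1, f w, w.2 + w.1 * f w / 2).
Proof.
rewrite /graph_point /heis_mul /V0_in_heis /Ypow /xc /yc /zc /=.
by rewrite !addr0 add0r mulr0 subr0.
Qed.

Lemma area_defect_graph f w w' :
  area_defect (graph_point f w) (graph_point f w') =
  w'.2 - w.2 + (w'.1 - w.1) * (f w + f w') / 2.
Proof. by rewrite !graph_pointE /area_defect /xc /yc /zc /=; field. Qed.

(** The signed square [t |t|] straightens [f_a]: composed with it, [f_a] becomes linear in [z]. The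
    two bounds compare it with differences of [t]. For arguments of the same sign its increment is
    exactly [|q - p| |p + q|]; for opposite signs it is [q^2 + p^2]. *)
Lemma sqr_signed_dist (p q : R) :
  (q - p) ^+ 2 <= 2 * `|q * `|q| - p * `|p| | /\
  `|q - p| * `|p + q| <= 2 * `|q * `|q| - p * `|p| |.
Proof.
have same : `|q - p| <= `|p + q| -> `|q * `|q| - p * `|p| | = `|q - p| * `|p + q| ->
    (q - p) ^+ 2 <= 2 * `|q * `|q| - p * `|p| | /\
    `|q - p| * `|p + q| <= 2 * `|q * `|q| - p * `|p| |.
  move=> le ->; rewrite -(real_normK (num_real (q - p))) expr2.
  have u0 := normr_ge0 (q - p); have v0 := normr_ge0 (p + q).
  by split; nra.
have opp : `|q * `|q| - p * `|p| | = q ^+ 2 + p ^+ 2 ->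
    (q - p) ^+ 2 <= 2 * `|q * `|q| - p * `|p| | /\
    `|q - p| * `|p + q| <= 2 * `|q * `|q| - p * `|p| |.
  have s1 := sqr_ge0 (q + p); have s2 := sqr_ge0 q; have s3 := sqr_ge0 p.
  move=> ->; rewrite -normrM; split; last rewrite ler_norml; first by nra.
  by apply/andP; split; nra.
have [q0|q0] := lerP 0 q; have [p0|p0] := lerP 0 p.
- apply: same; last rewrite -normrM (ger0_norm q0) (ger0_norm p0).
    by rewrite [leRHS]ger0_norm ?addr_ge0// ler_norml; apply/andP; split; lra.
  by congr `|_|; ring.
- apply: opp; rewrite (ger0_norm q0) (ltr0_norm p0) ger0_norm; first by ring.
  by nra.
- apply: opp; rewrite (ger0_norm p0) (ltr0_norm q0) ler0_norm; first by ring.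
  by nra.
- apply: same; last rewrite -normrM (ltr0_norm q0) (ltr0_norm p0).
    by rewrite [leRHS]ltr0_norm ?ltrNl; [rewrite ler_norml; apply/andP; split; lra|lra].
  by rewrite -normrN; congr `|_|; ring.
Qed.

Lemma f_aE (a : R) w : f_a a w * `|f_a a w| = - (a * `|a|) * w.2.
Proof.
rewrite /f_a !normrM normrN (ger0_norm (sqrtr_ge0 _)) normr_sg.
transitivity (- (a * `|a|) * (Num.sqrt `|w.2| ^+ 2 * (Num.sg w.2 * (w.2 != 0)%:R))).
  by ring.
rewrite sqr_sqrtr//; congr (_ * _).
have [->|w0] := eqVneq w.2 0; first by rewrite normr0 mul0r.
by rewrite mulr1 mulrC -numEsg.
Qed.

(** A curve between two graph points either moves by a fixed proportion in [x], or has to travel at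
    least twice their difference in [y]. Let [D], [X], [Z] be the coordinate differences and [S] the
    modulus of the sum of the two values. If [A >= m D], the length is at least
    [D * sqrt (1 + m^2) = N D]. Otherwise [X <= A < m D], and [D S <= 2 b Z] with [8 m b <= 1] shows
    that at least half of [Z] must be swept as area: [Z / 2 <= A B]. Then
    [D^2 <= 2 b Z <= 4 b A B <= 4 b m D B] yields [2 D <= B], and [N <= 2]. *)
Lemma f_a_intrinsic_lipschitz (a : R) : a != 0 -> entire_intrinsic_lipschitz (f_a a).
Proof.
move=> a0; pose b := a ^+ 2; have b0 : 0 < b by rewrite exprn_even_gt0.
pose m := (8 * b + 1)^-1; have m0 : 0 < m by rewrite invr_gt0 addr_gt0// mulr_gt0.
have mE : m * (8 * b + 1) = 1 by rewrite mulVf// gt_eqF// addr_gt0// mulr_gt0.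
pose N := Num.sqrt (1 + m ^+ 2).
have N2 : N ^+ 2 = 1 + m ^+ 2 by rewrite sqr_sqrtr// addr_ge0// sqr_ge0.
have N1 : 1 < N.
  by rewrite -[ltLHS]sqrtr1 ltr_sqrt ?ltrDl ?exprn_gt0// addr_gt0// exprn_gt0.
have N0 : 0 < N by exact: lt_trans N1.
exists N^-1; split; first by rewrite invr_gt0 N0 invf_lt1.
move=> _ _ [w _ <-] [w' _ <-]; rewrite -/(graph_point _ w) -/(graph_point _ w').
rewrite ler_pdivlMl// mulrC.
set D := `|_|; have D0 : 0 <= D by exact: normr_ge0.
apply: cc_dist_ge => A B L; rewrite area_defect_graph.
rewrite -/D => XA DB HAB HL.
have {}XA : `|w'.1 - w.1| <= A by move: XA; rewrite !graph_pointE.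
have [z1 z2] := sqr_signed_dist (f_a a w) (f_a a w').
have zE : `|f_a a w' * `|f_a a w'| - f_a a w * `|f_a a w| | = b * `|w'.2 - w.2|.
  by rewrite !f_aE -mulrBr normrM normrN normrM normr_id -expr2 real_normK// num_real.
have DE : D = `|f_a a w' - f_a a w| by rewrite /D !graph_pointE.
have {}z1 : D ^+ 2 <= 2 * (b * `|w'.2 - w.2|).
  by rewrite -zE (le_trans _ z1)// DE real_normK// num_real.
have {}z2 : D * `|f_a a w + f_a a w'| <= 2 * (b * `|w'.2 - w.2|) by rewrite -zE DE.
clearbody D; clear zE DE; clearbody b m N.
pose S : R := `|f_a a w + f_a a w'|; pose Z : R := `|w'.2 - w.2|; pose X : R := `|w'.1 - w.1|.
rewrite -/S -/Z -/X in z1 z2 XA.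
have X0 : 0 <= X by exact: normr_ge0.
have Z0 : 0 <= Z by exact: normr_ge0.
have S0 : 0 <= S by exact: normr_ge0.
have {HAB} HAB : Z - X * S / 2 <= A * B.
  apply: le_trans HAB; rewrite lerBlDr /Z.
  rewrite -[X in X <= _](_ : `|(w'.2 - w.2 + (w'.1 - w.1) * (f_a a w + f_a a w') / 2)
    - (w'.1 - w.1) * (f_a a w + f_a a w') / 2| = _); last by congr `|_|; ring.
  rewrite (le_trans (ler_normB _ _))// lerD2l.
  by rewrite !normrM [`|2^-1|]gtr0_norm ?invr_gt0.
have A0 := le_trans X0 XA; have B0 := le_trans D0 DB.
(* The length is tested against the unit vector [(m, 1) / N] in the first case and against [(0, 1)]
   in the second. *)
have [mDA|AmD] := lerP (m * D) A.
  have := HL (m / N) (N^-1); rewrite !divr_ge0 ?invr_ge0 ?(ltW m0) ?(ltW N0)//.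
  have -> : (m / N) ^+ 2 + N^-1 ^+ 2 <= 1.
    by rewrite exprMn exprVn N2 -[X in _ + X]mul1r -mulrDl addrC divff// gt_eqF// -N2 exprn_gt0.
  move=> /(_ isT isT isT); apply: le_trans.
  have -> : m / N * A + N^-1 * B = (m * A + B) / N by ring.
  rewrite ler_pdivlMr// -mulrA -expr2 N2.
  have := ler_wpM2l (ltW m0) mDA; nra.
have := HL 0 1; rewrite lexx ler01 expr0n expr1n/= add0r lexx => /(_ isT isT isT).
rewrite mul0r mul1r add0r; apply: le_trans.
have m1 : m <= 1 by nra.
have mm := ler_wpM2l (ltW m0) m1.
have N22 : N <= 2 by rewrite -ler_sqr ?nnegrE ?(ltW N0)// N2; nra.
have D1 : 0 < D by rewrite lt_neqAle D0 andbT eq_sym; apply/eqP => D00; nra.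
suff : 2 * D <= B by move=> /(le_trans _); apply; rewrite mulrC ler_wpM2r.
have ASm : X * S / 2 <= m * (b * Z) by nra.
have mb : 8 * (m * b) <= 1 by nra.
have h1 : Z / 2 <= A * B by nra.
have h2 : D * D <= 4 * b * (A * B) by have := ler_wpM2l (ltW b0) h1; nra.
have h3 : D * D <= 4 * b * (m * D * B).
  have := ler_wpM2r B0 (ltW AmD); move=> /(ler_wpM2l (ltW b0)); nra.
have h4 : D <= 4 * b * (m * B) by rewrite -(ler_pM2l D1); nra.
by have := ler_wpM2r B0 mb; nra.
Qed.

Lemma sqrtrD_le (x y : R) : 0 <= x -> 0 <= y ->
  Num.sqrt (x + y) <= Num.sqrt x + Num.sqrt y.
Proof.
move=> x0 y0; apply: sqrtr_le_sqr; first by rewrite addr_ge0 ?sqrtr_ge0.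
by rewrite sqrrD !sqr_sqrtr// -addrA lerD2l lerDr mulrn_wge0.
Qed.

(** The upper bound of the distance contains the unknown [D = |g w' - g w|] itself, once linearly
    and once inside the area defect. The square root of the latter is split into a small multiple
    [e D] and a multiple of [X]; since [lam < 1], all terms in [D] can be absorbed on the left. The
    factor [|g w|] that remains makes the modulus local. *)
Lemma intrinsic_lipschitz_modulus g : entire_intrinsic_lipschitz g ->
  exists2 C, 0 <= C & forall w w',
    `|g w' - g w| <= C * (`|w'.1 - w.1| + Num.sqrt (`|w'.2 - w.2| + `|w'.1 - w.1| * `|g w|)).
Proof.
move=> [lam [/andP[lam0 lam1] H]].
have [c c0 cle] : exists2 c : R, 0 < c & forall p q : heis R, cc_dist p q <=
    `|xc q - xc p| + `|yc q - yc p| + c * Num.sqrt `|area_defect p q|.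
  by exists 700 => // p q; exact: cc_dist_le.
pose e := (1 - lam) / 2; have e0 : 0 < e by rewrite divr_gt0 ?subr_gt0.
(* [4 e K = c^2] turns [(e D - K X)^2 >= 0] into [c^2 X D <= (e D + K X)^2]. As [2 e = 1 - lam], a
   multiple [e] of [D] survives the absorption. *)
pose K := c ^+ 2 / (4 * e); have K0 : 0 < K by apply: divr_gt0; [exact: exprn_gt0|apply: mulr_gt0].
have eK : 4 * (e * K) = c ^+ 2 by rewrite /K; field; rewrite gt_eqF.
have elam : 2 * e = 1 - lam by rewrite /e; field.
exists ((1 + K + c) / e) => [|w w'].
  by apply/ltW/divr_gt0 => //; rewrite !addr_gt0.
have := H _ _ (ex_intro2 _ _ w I erefl) (ex_intro2 _ _ w' I erefl).
rewrite -/(graph_point _ w) -/(graph_point _ w').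
have := cle (graph_point g w) (graph_point g w').
rewrite area_defect_graph.
rewrite !graph_pointE /xc /yc /=.
set d := cc_dist _ _.
pose D : R := `|g w' - g w|; pose X : R := `|w'.1 - w.1|; rewrite -/D -/X.
pose E : R := `|w'.2 - w.2| + X * `|g w|; rewrite -/E => dle Dd.
have D0 : 0 <= D by exact: normr_ge0.
have X0 : 0 <= X by exact: normr_ge0.
have E0 : 0 <= E by rewrite addr_ge0// mulr_ge0.
have defect : `|w'.2 - w.2 + (w'.1 - w.1) * (g w + g w') / 2| <= E + X * D / 2.
  have -> : w'.2 - w.2 + (w'.1 - w.1) * (g w + g w') / 2 =
    w'.2 - w.2 + (w'.1 - w.1) * g w + (w'.1 - w.1) * (g w' - g w) / 2 by field.
  rewrite (le_trans (ler_normD _ _))// lerD//.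
    by rewrite (le_trans (ler_normD _ _))// lerD2l normrM.
  by rewrite !normrM [`|2^-1|]gtr0_norm ?invr_gt0.
have s1 : Num.sqrt (X * D / 2) * c <= e * D + K * X.
  have -> : c = Num.sqrt (c ^+ 2) by rewrite sqrtr_sqr gtr0_norm.
  rewrite -sqrtrM; last by rewrite divr_ge0 ?mulr_ge0.
  apply: sqrtr_le_sqr; first by apply: addr_ge0; apply: mulr_ge0 => //; exact: ltW.
  by rewrite -eK; have := sqr_ge0 (e * D - K * X); nra.
have s2 := le_trans (ler_wsqrtr defect) (sqrtrD_le E0 (divr_ge0 (mulr_ge0 X0 D0) (ltW (ltr0Sn _ 1)))).
move: (Num.sqrt `|_|) s2 dle => s s2 dle.
have sE0 := sqrtr_ge0 E; set sE := Num.sqrt E in s2 sE0 *.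
have {}dle : d <= X + D + c * sE + e * D + K * X.
  by have := ler_wpM2l (ltW c0) s2; lra.
have {Dd} : D <= lam * (X + D + c * sE + e * D + K * X).
  by rewrite (le_trans Dd)// ler_pM2l.
move=> DD.
rewrite mulrAC ler_pdivlMr//.
have KE := mulr_ge0 (ltW K0) sE0; have KX := mulr_ge0 (ltW K0) X0.
have cE := mulr_ge0 (ltW c0) sE0; have cX := mulr_ge0 (ltW c0) X0.
have eD0 := mulr_ge0 (ltW e0) D0.
have P0 : 0 <= X + c * sE + e * D + K * X by lra.
have := ler_wpM2r P0 (ltW lam1).
have eD : 2 * (e * D) = D - lam * D by rewrite mulrA elam; ring.
lra.
Qed.

Definition box (M : R) : set (V0 R) := [set w | `|w.1| <= M /\ `|w.2| <= M].

Definition half_hoelder g (M K : R) :=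
  (forall w, box M w -> `|g w| <= K) /\
  (forall w w' d, box M w -> box M w' -> `|w'.1 - w.1| <= d -> `|w'.2 - w.2| <= d ->
    `|g w' - g w| <= K * Num.sqrt d).

(** Comparison with the origin bounds [g] on the box, after which the modulus is uniform there. Its
    linear term is of order [sqrt d] because coordinate differences in the box are at most [2 M]. *)
Lemma intrinsic_lipschitz_hoelder g : entire_intrinsic_lipschitz g ->
  forall M, exists2 K, 0 <= K & half_hoelder g M K.
Proof.
move=> /intrinsic_lipschitz_modulus[C C0 H] M.
have [M0|M0] := ltrP M 0.
  exists 0 => //; split => [w|w w' d] [w1 _]; last first.
    by have := le_lt_trans w1 M0; rewrite normr_lt0.
  by have := le_lt_trans w1 M0; rewrite normr_lt0.
pose G : R := `|g (0, 0)|.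
pose K0 := G + C * (M + Num.sqrt (M + M * G)).
have G0 : 0 <= G by exact: normr_ge0.
have K00 : 0 <= K0.
  by apply: addr_ge0 => //; apply: mulr_ge0 => //; apply: addr_ge0 => //; exact: sqrtr_ge0.
have gK0 w : box M w -> `|g w| <= K0.
  move=> [w1 w2].
  rewrite -[g w](subrK (g (0, 0))) addrC (le_trans (ler_normD _ _))// lerD2l.
  rewrite (le_trans (H _ _))//= !subr0 ler_wpM2l// lerD//.
  by rewrite ler_wsqrtr// lerD// ler_wpM2r.
pose K1 := C * (Num.sqrt (2 * M) + Num.sqrt (1 + K0)).
have K10 : 0 <= K1.
  by apply: mulr_ge0 => //; apply: addr_ge0; exact: sqrtr_ge0.
exists (K0 + K1); first exact: addr_ge0.
split=> [w bw|w w' d [w1 w2] [w1' w2'] d1 d2].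
  by rewrite (le_trans (gK0 _ bw))// lerDl.
have d0 : 0 <= d by exact: le_trans d1.
(* [d] is only an upper bound for the coordinate differences. When it exceeds the side [2 M] of the
   box, the bound for [2 M] is used instead. *)
have [dM|Md] := lerP d (2 * M).
- rewrite (@le_trans _ _ (K1 * Num.sqrt d))//; last by rewrite ler_wpM2r ?sqrtr_ge0 ?lerDr.
  rewrite (le_trans (H _ _))// /K1 -mulrA ler_wpM2l// mulrDl lerD//.
    rewrite (le_trans d1)// -{1}[d]sqr_sqrtr// expr2 ler_wpM2r ?sqrtr_ge0//.
    by rewrite ler_wsqrtr.
  rewrite -sqrtrM; last exact: addr_ge0.
  apply: ler_wsqrtr; rewrite mulrDl mul1r lerD// mulrC.
  by rewrite ler_pM// gK0.
- rewrite (@le_trans _ _ (K1 * Num.sqrt (2 * M)))//; last first.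
    rewrite (@le_trans _ _ (K1 * Num.sqrt d))//.
      by rewrite ler_wpM2l// ler_wsqrtr// ltW.
    by rewrite ler_wpM2r ?sqrtr_ge0 ?lerDr.
  rewrite (le_trans (H _ _))// /K1 -mulrA ler_wpM2l// mulrDl.
  have M2 : 0 <= 2 * M by rewrite mulr_ge0.
  have e1 : `|w'.1 - w.1| <= 2 * M by rewrite (le_trans (ler_normB _ _))// mulr2n mulrDl !mul1r lerD.
  have e2 : `|w'.2 - w.2| <= 2 * M by rewrite (le_trans (ler_normB _ _))// mulr2n mulrDl !mul1r lerD.
  rewrite lerD//.
    by rewrite -expr2 sqr_sqrtr.
  rewrite -sqrtrM; last exact: addr_ge0.
  apply: ler_wsqrtr; rewrite mulrDl mul1r lerD// mulrC.
  by rewrite ler_pM// gK0.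
Qed.

Lemma intrinsic_lipschitz_continuous g : entire_intrinsic_lipschitz g -> continuous g.
Proof.
move=> /intrinsic_lipschitz_hoelder H w.
have [K K0 [_ gK]] := H (`|w.1| + `|w.2| + 1).
apply/cvgrPdist_le => e e0.
pose d := Num.min 1 ((e / (K + 1)) ^+ 2).
have K1 : 0 < K + 1 by rewrite ltr_wpDl.
have d0 : 0 < d by rewrite lt_min ltr01/= exprn_gt0// divr_gt0.
near=> w'.
have w'1 : `|w.1 - w'.1| <= d.
  near: w'; have : (fun v : V0 R => v.1) v @[v --> w] --> w.1 by exact: cvg_fst.
  by move=> /cvgrPdist_le; apply.
have w'2 : `|w.2 - w'.2| <= d.
  near: w'; have : (fun v : V0 R => v.2) v @[v --> w] --> w.2 by exact: cvg_snd.
  by move=> /cvgrPdist_le; apply.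
have d1 : d <= 1 by rewrite ge_min lexx.
have n1 := normr_ge0 w.1; have n2 := normr_ge0 w.2.
apply: (@le_trans _ _ (K * Num.sqrt d)).
  apply: gK => //; split => //.
  - rewrite -[w'.1](subrK w.1) (le_trans (ler_normD _ _))// distrC; lra.
  - rewrite -[w'.2](subrK w.2) (le_trans (ler_normD _ _))// distrC; lra.
  - lra.
  - lra.
have -> : e = (K + 1) * (e / (K + 1)) by rewrite mulrC divfK// gt_eqF.
apply: ler_pM => //; first by rewrite lerDl.
apply: sqrtr_le_sqr; first by apply/ltW; exact: divr_gt0.
by rewrite ge_min lexx orbT.
Unshelve. all: by end_near. Qed.

End IntrinsicGraph.

(** * Calculus and integration on the plane *)

Section PlaneMeasure.
Context {R : realType}.
Notation mu := (@lebesgue_measure R).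
Notation P := (measurableTypeR R * measurableTypeR R)%type.
Notation mu0 := (@mu0 R).
Implicit Types F G : V0 R -> R.

(** Used twice: to make open sets measurable for the product sigma-algebra, and to reduce an almost
    everywhere statement on an open set to countably many rectangles. Codes of rectangles not
    contained in [O] are sent to [(0, 0, 0, 0)], whose open rectangle is empty. *)
Lemma open_rational_cover (O : set (V0 R)) : open O ->
  exists a b c d : nat -> R,
    O = \bigcup_n [set w | (w.1 \in `]a n, b n[) /\ (w.2 \in `]c n, d n[) ].
Proof.
move=> oO.
pose rect (q : rat * rat * rat * rat) : set (V0 R) :=
  [set w | (w.1 \in `]ratr q.1.1.1, ratr q.1.1.2[) /\ (w.2 \in `]ratr q.1.2, ratr q.2[) ].
pose e n : rat * rat * rat * rat :=
  if unpickle n is Some q then if `[< rect q `<=` O >] then q else (0, 0, 0, 0)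
  else (0, 0, 0, 0).
exists (fun n => ratr (e n).1.1.1), (fun n => ratr (e n).1.1.2),
  (fun n => ratr (e n).1.2), (fun n => ratr (e n).2).
have empty w : ~ rect (0, 0, 0, 0) w.
  by move=> [/=]; rewrite in_itv/= => /andP[/lt_trans h /h]; rewrite ltxx.
apply/seteqP; split => [w Ow|w [n _]]; last first.
  rewrite -/(rect (e n) w) /e; case: unpickle => [q|]; last by move/empty.
  by case: asboolP => [qO /qO|_ /empty].
have [e0 /= e00 wO] : exists2 r : R, 0 < r & forall w' : V0 R,
    `|w.1 - w'.1| < r -> `|w.2 - w'.2| < r -> O w'.
  have /nbhs_ballP[r /= r0 rO] : nbhs w O by exact: open_nbhs_nbhs.
  by exists r => // w' h1 h2; apply: rO; split.
have rat_in (x : R) : exists q1 q2 : rat,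
    [/\ ratr q1 < x, x < ratr q2, x - e0 < ratr q1 & ratr q2 < x + e0].
  have /rat_in_itvoo[q1 /itvP q1x] : x - e0 < x by rewrite ltrBlDr ltrDl.
  have /rat_in_itvoo[q2 /itvP q2x] : x < x + e0 by rewrite ltrDl.
  by exists q1, q2; rewrite !q1x !q2x.
have [q1 [q2 [h1 h2 h3 h4]]] := rat_in w.1.
have [q3 [q4 [h5 h6 h7 h8]]] := rat_in w.2.
exists (pickle (q1, q2, q3, q4)) => //; rewrite -/(rect (e _) w) /e pickleK.
rewrite asboolT; first by split; rewrite in_itv/= ?h1 ?h2 ?h5 ?h6.
move=> w' [] /=; rewrite !in_itv/= => /andP[k1 k2] /andP[k3 k4].
by apply: wO; rewrite ltr_norml; apply/andP; split; lra.
Qed.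

Lemma measurable_rect (a b c d : R) :
  measurable ([set w | (w.1 \in `]a, b[) /\ (w.2 \in `]c, d[) ] : set P).
Proof.
rewrite (_ : [set w | _ ] = `]a, b[%classic `*` `]c, d[%classic)//.
by apply: measurableX; exact: measurable_itv.
Qed.

Lemma open_measurable2 (O : set (V0 R)) : open O -> measurable (O : set P).
Proof.
move=> /open_rational_cover[a [b [c [d ->]]]].
by apply: bigcupT_measurable => n; exact: measurable_rect.
Qed.

Lemma closed_measurable2 (C : set (V0 R)) : closed C -> measurable (C : set P).
Proof.
move=> cC; rewrite -[C]setCK; apply: measurableC.
by apply: open_measurable2; exact: closed_openC.
Qed.

Lemma continuous_measurable_fun2 F : continuous F -> measurable_fun [set: P] F.
Proof.
move=> /continuousP cF; apply: (measurability _ (RGenOpens.measurableE R)).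
move=> _ [_ [a [b ->] <-]]; rewrite setTI; apply: open_measurable2.
exact/cF/interval_open.
Qed.

Lemma boxE (M : R) : box M = `[- M, M]%classic `*` `[- M, M]%classic.
Proof.
apply/seteqP; split => w; rewrite /box /setX/= !in_itv/= -!ler_norml => -[? ?]; exact.
Qed.

Lemma measurable_box (M : R) : measurable (box M : set P).
Proof. by rewrite boxE; apply: measurableX; exact: measurable_itv. Qed.

Lemma compact_box (M : R) : compact (box M).
Proof. by rewrite boxE; apply: compact_setX; exact: segment_compact. Qed.

Lemma mu0_box (M : R) : 0 <= M -> mu0 (box M) = ((2 * M) ^+ 2)%:E.
Proof.
move=> M0; rewrite boxE.
have mI : measurable (`[(- M : R), M]%classic : set (measurableTypeR R)).
  exact: measurable_itv.
rewrite [LHS](product_measure1E mu mu mI mI).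
rewrite /= lebesgue_measure_itv/= lte_fin -subr_gt0 opprK.
have [M1|] := ltrP 0 (M + M); first by rewrite -EFinD -EFinM ?opprK; congr EFin; ring.
rewrite mule0 -mulr2n pmulrn_lle0// => M1.
have -> : M = 0 by apply/eqP; rewrite eq_le M0 M1.
by rewrite mulr0 expr0n.
Qed.

(** The class from which the integrands on the plane are taken: it is stable under sums, products
    and continuous functions, and compact support then gives integrability. *)
Definition loc_bounded F := measurable_fun [set: P] F /\
  forall M, exists K, forall w, box M w -> `|F w| <= K.

Definition supported_in F (M : R) := forall w, ~ box M w -> F w = 0.

Definition cpt_supported F := exists M, supported_in F M.

Lemma box_le (M N : R) : M <= N -> box M `<=` box N.
Proof. by move=> MN w [h1 h2]; split; exact: le_trans MN. Qed.

Lemma supported_in_le F (M N : R) : M <= N -> supported_in F M -> supported_in F N.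
Proof. by move=> MN FM w wN; apply: FM => /(box_le MN). Qed.

Lemma continuous_loc_bounded F : continuous F -> loc_bounded F.
Proof.
move=> cF; split=> [|M]; first exact: continuous_measurable_fun2.
have /compact_bounded[K [_ FK]] : compact (F @` box M).
  apply: continuous_compact (@compact_box M); exact: continuous_subspaceT.
exists (`|K| + 1) => w wM; apply: FK; last by exists w.
by rewrite ltr_pwDr// ler_norm.
Qed.

Lemma loc_boundedD F G : loc_bounded F -> loc_bounded G -> loc_bounded (fun w => F w + G w).
Proof.
move=> [mF bF] [mG bG]; split=> [|M]; first exact: measurable_funD.
have [K FK] := bF M; have [K' GK] := bG M; exists (K + K') => w wM.
by rewrite (le_trans (ler_normD _ _))// lerD ?FK ?GK.
Qed.

Lemma loc_boundedM F G : loc_bounded F -> loc_bounded G -> loc_bounded (fun w => F w * G w).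
Proof.
move=> [mF bF] [mG bG]; split=> [|M]; first exact: measurable_funM.
have [K FK] := bF M; have [K' GK] := bG M; exists (K * K') => w wM.
by rewrite normrM ler_pM ?FK ?GK.
Qed.

Lemma loc_bounded_cst (k : R) : loc_bounded (fun=> k).
Proof. by split => [|M]; [exact: measurable_cst|exists `|k|]. Qed.

Lemma loc_boundedN F : loc_bounded F -> loc_bounded (fun w => - F w).
Proof.
by move=> /(loc_boundedM (loc_bounded_cst (-1))); under [X in _ X]eq_fun do rewrite mulN1r.
Qed.

Lemma loc_bounded_comp (s : R -> R) F : continuous s -> loc_bounded F ->
  loc_bounded (fun w => s (F w)).
Proof.
move=> cs [mF bF]; split=> [|M].
  by apply: measurableT_comp mF; exact: continuous_measurable_fun.
have [K FK] := bF M.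
have /compact_bounded[L [_ sL]] : compact (s @` `[- K, K]).
  by apply: continuous_compact (@segment_compact _ _ _); exact: continuous_subspaceT.
exists (`|L| + 1) => w wM; apply: sL; first by rewrite ltr_pwDr// ler_norm.
by exists (F w) => //=; rewrite in_itv/= -ler_norml FK.
Qed.

Lemma loc_bounded_integrable_box F (M : R) : loc_bounded F ->
  mu0.-integrable (box M) (EFin \o F).
Proof.
move=> [mF bF].
apply: measurable_bounded_integrable; first exact: measurable_box.
- rewrite (@le_lt_trans _ _ (mu0 (box `|M|)))//.
    by rewrite le_measure ?inE//; [exact: measurable_box..|apply: box_le; exact: ler_norm].
  by rewrite mu0_box// ltry.
- exact: measurable_funTS.
- have [K FK] := bF M; exists K; split; first exact: num_real.
  by move=> L KL w /= /FK /le_trans; apply; exact: ltW.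
Qed.

Lemma loc_bounded_integrable F : loc_bounded F -> cpt_supported F ->
  mu0.-integrable setT (EFin \o F).
Proof.
move=> bF [M FM]; rewrite (_ : EFin \o F = (EFin \o F) \_ (box M)).
  apply: (iffLR (integrable_mkcond _ _)); first exact: measurable_box.
  exact: loc_bounded_integrable_box.
apply/funext => w; rewrite patchE; case: ifPn => // /negP wM /=.
by rewrite FM// => /mem_set.
Qed.

Lemma Rintegral_supported F (M : R) : supported_in F M ->
  \int[mu0]_w F w = \int[mu0]_(w in box M) F w.
Proof.
move=> FM; rewrite [RHS]Rintegral_mkcond; congr Rintegral; apply/funext => w.
by rewrite patchE; case: ifPn => // /negP wM; rewrite FM// => /mem_set.
Qed.

Lemma norm_Rintegral_box_le F (M K : R) : loc_bounded F -> supported_in F M -> 0 <= M ->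
  (forall w, box M w -> `|F w| <= K) -> `|\int[mu0]_w F w| <= K * (2 * M) ^+ 2.
Proof.
move=> bF FM M0 FK; rewrite (Rintegral_supported FM).
apply: le_trans (le_normr_Rintegral _ _) _.
- exact: measurable_box.
- exact: loc_bounded_integrable_box.
have -> : K * (2 * M) ^+ 2 = \int[mu0]_(w in box M) K.
  by rewrite Rintegral_cst; [rewrite mu0_box|exact: measurable_box].
apply: le_Rintegral => //.
- exact: measurable_box.
- apply: integrableR_norm; exact: loc_bounded_integrable_box.
- exact: (loc_bounded_integrable_box _ (loc_bounded_cst K)).
Qed.

End PlaneMeasure.

(** * Partial derivatives and test functions *)

Section PlaneDerivatives.
Context {R : realType}.
Implicit Types (F G : V0 R -> R) (w : V0 R).

Lemma is_derive_uniq (F G : R -> R) (x a b : R) :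
  (\near x, F x = G x) -> is_derive x (1 : R) F a -> is_derive x (1 : R) G b -> a = b.
Proof.
move=> FG dF dG; have dF' := near_eq_is_derive FG dF.
by rewrite -(@derive_val _ _ _ _ _ _ _ dF') (@derive_val _ _ _ _ _ _ _ dG).
Qed.

Lemma is_derive_slice1 F w (d : R) :
  is_derive w ((1, 0) : V0 R) F d <-> is_derive w.1 (1 : R) (fun t => F (t, w.2)) d.
Proof.
have E : (fun h : R => h^-1 *: ((F \o shift w) (h *: ((1, 0) : V0 R)) - F w)) =
    (fun h : R => h^-1 *: (((fun t => F (t, w.2)) \o shift w.1) (h *: (1 : R)) - F (w.1, w.2))).
  apply/funext => h; case: w => x z /=; congr (_ *: (F _ - _)).
  by congr (_, _) => /=; rewrite scaler0 add0r.
by split=> -[h1 h2]; split; [move: h1|move: h2|move: h1|move: h2];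
  rewrite /derivable /derive E.
Qed.

Lemma is_derive_slice2 F w (d : R) :
  is_derive w ((0, 1) : V0 R) F d <-> is_derive w.2 (1 : R) (fun t => F (w.1, t)) d.
Proof.
have E : (fun h : R => h^-1 *: ((F \o shift w) (h *: ((0, 1) : V0 R)) - F w)) =
    (fun h : R => h^-1 *: (((fun t => F (w.1, t)) \o shift w.2) (h *: (1 : R)) - F (w.1, w.2))).
  apply/funext => h; case: w => x z /=; congr (_ *: (F _ - _)).
  by congr (_, _) => /=; rewrite scaler0 add0r.
by split=> -[h1 h2]; split; [move: h1|move: h2|move: h1|move: h2];
  rewrite /derivable /derive E.
Qed.

(** The partial derivatives are explicit data, given along slices, so that those of products and
    compositions come out as formulas; [C1_C1c] and [C1c_C1] translate to and from the test
    functions [C1c]. *)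
Record C1 (F Fx Fz : V0 R -> R) : Prop := {
  C1_cont : continuous F;
  C1_contx : continuous Fx;
  C1_contz : continuous Fz;
  C1_dx : forall w, is_derive w.1 (1 : R) (fun t => F (t, w.2)) (Fx w);
  C1_dz : forall w, is_derive w.2 (1 : R) (fun t => F (w.1, t)) (Fz w) }.

Lemma C1M F Fx Fz G Gx Gz : C1 F Fx Fz -> C1 G Gx Gz ->
  C1 (fun w => F w * G w) (fun w => Fx w * G w + F w * Gx w)
     (fun w => Fz w * G w + F w * Gz w).
Proof.
move=> [cF cFx cFz dFx dFz] [cG cGx cGz dGx dGz]; split => w.
- by apply: cvgM; [exact: cF|exact: cG].
- by apply: cvgD; apply: cvgM; (exact: cF || exact: cG || exact: cFx || exact: cGx).
- by apply: cvgD; apply: cvgM; (exact: cF || exact: cG || exact: cFz || exact: cGz).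
- apply: (is_derive_eq (is_deriveM (dFx w) (dGx w))).
  by case: w => x z /=; rewrite -![_ *: _]/(_ * _) addrC mulrC.
- apply: (is_derive_eq (is_deriveM (dFz w) (dGz w))).
  by case: w => x z /=; rewrite -![_ *: _]/(_ * _) addrC mulrC.
Qed.

Lemma C1_comp (s s' : R -> R) F Fx Fz : (forall t, is_derive t (1 : R) s (s' t)) ->
  continuous s' -> C1 F Fx Fz ->
  C1 (fun w => s (F w)) (fun w => s' (F w) * Fx w) (fun w => s' (F w) * Fz w).
Proof.
move=> ds cs' [cF cFx cFz dFx dFz]; have cs := is_derive_continuous ds; split => w.
- by apply: continuous_comp; [exact: cF|exact: cs].
- by apply: cvgM; [apply: continuous_comp; [exact: cF|exact: cs']|exact: cFx].
- by apply: cvgM; [apply: continuous_comp; [exact: cF|exact: cs']|exact: cFz].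
- have dsw := ds (F (w.1, w.2)).
  by apply: (is_derive_eq (@is_derive1_comp _ s (fun t => F (t, w.2)) w.1 _ _ dsw (dFx w))); case: w {dsw}.
- have dsw := ds (F (w.1, w.2)).
  by apply: (is_derive_eq (@is_derive1_comp _ s (fun t => F (w.1, t)) w.2 _ _ dsw (dFz w))); case: w {dsw}.
Qed.

Lemma C1_prod (f f' k k' : R -> R) :
  (forall t, is_derive t (1 : R) f (f' t)) -> continuous f' ->
  (forall t, is_derive t (1 : R) k (k' t)) -> continuous k' ->
  C1 (fun w => f w.1 * k w.2) (fun w => f' w.1 * k w.2) (fun w => f w.1 * k' w.2).
Proof.
move=> df cf' dk ck'.
have cf := is_derive_continuous df; have ck := is_derive_continuous dk.
have c1 (h : R -> R) : continuous h -> continuous (fun w : V0 R => h w.1).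
  by move=> ch w; apply: continuous_comp; [exact: cvg_fst|exact: ch].
have c2 (h : R -> R) : continuous h -> continuous (fun w : V0 R => h w.2).
  by move=> ch w; apply: continuous_comp; [exact: cvg_snd|exact: ch].
split => w; [by apply: cvgM; (exact: c1 || exact: c2)..| |].
- by apply: (is_derive_eq (is_deriveM (df w.1) (is_derive_cst (k w.2) w.1 1))) => /=; rewrite scaler0 add0r -[_ *: _]/(_ * _) mulrC.
- by apply: (is_derive_eq (is_deriveM (is_derive_cst (f w.1) w.2 1) (dk w.2))) => /=; rewrite scaler0 addr0.
Qed.

Lemma notin_box (M : R) w : ~ box M w -> M < `|w.1| \/ M < `|w.2|.
Proof.
by move=> /not_andP[] /negP; rewrite -ltNge; [left|right].
Qed.

Lemma near_norm_gt (M x : R) : M < `|x| -> \forall t \near x, M < `|t|.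
Proof.
move=> Mx; have nx : `|t| @[t --> x] --> `|x| by apply: cvg_norm; exact: cvg_id.
exact: (cvgr_gt _ nx).
Qed.

Lemma C1_supported F Fx Fz (M : R) : C1 F Fx Fz -> supported_in F M ->
  supported_in Fx M /\ supported_in Fz M.
Proof.
move=> [_ _ _ dFx dFz] FM.
have c0 (x : R) : is_derive x (1 : R) (cst 0 : R -> R) 0 by exact: is_derive_cst.
split=> w /notin_box wM.
- apply: (is_derive_uniq _ (dFx w) (c0 w.1)).
  case: wM => wM; last first.
    apply: (@filterE _ (nbhs (w.1 : R)) _) => t; apply: FM => -[/= _].
    by rewrite leNgt wM.
  apply: (@filterS _ (nbhs _) _ _ _ _ (near_norm_gt wM)) => t tM.
  by apply: FM => -[/=]; rewrite leNgt tM.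
- apply: (is_derive_uniq _ (dFz w) (c0 w.2)).
  case: wM => wM.
    apply: (@filterE _ (nbhs (w.2 : R)) _) => t; apply: FM => -[/=].
    by rewrite leNgt wM.
  apply: (@filterS _ (nbhs _) _ _ _ _ (near_norm_gt wM)) => t tM.
  by apply: FM => -[/= _]; rewrite leNgt tM.
Qed.

Lemma C1_C1c F Fx Fz : C1 F Fx Fz -> cpt_supported F ->
  [/\ C1c F, dx F = Fx & dz F = Fz].
Proof.
move=> [cF cFx cFz dFx dFz] [M FM].
have dxE : dx F = Fx.
  by apply/funext => w; have /is_derive_slice1[_] := dFx w.
have dzE : dz F = Fz.
  by apply/funext => w; have /is_derive_slice2[_] := dFz w.
split => //; split; rewrite ?dxE ?dzE//.
- apply: (subclosed_compact _ (@compact_box _ M)); first exact: closed_closure.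
  have -> : box M = closure (box M).
    apply/closure_id; apply: compact_closed; last exact: compact_box.
    exact: (@norm_hausdorff R (R * R)%type).
  by apply: closure_subset => w /= /eqP Fw; apply: contrapT => /FM.
- by move=> w; have /is_derive_slice1[] := dFx w.
- by move=> w; have /is_derive_slice2[] := dFz w.
Qed.

(** What has to be supplied is the continuity of [F], which [C1c] does not state. The move from [w]
    to [v] is made first in [z] at the abscissa [w.1], where differentiability suffices, then in [x]
    by the mean value theorem with a local bound on [dx F]. *)
Lemma C1c_C1 F : C1c F -> C1 F (dx F) (dz F) /\ cpt_supported F.
Proof.
move=> [cpt Fx Fz cx cz].
have dFx w : is_derive w.1 (1 : R) (fun t => F (t, w.2)) (dx F w).
  exact/is_derive_slice1/derivableP/Fx.
have dFz w : is_derive w.2 (1 : R) (fun t => F (w.1, t)) (dz F w).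
  exact/is_derive_slice2/derivableP/Fz.
split; last first.
  have [K [_ FK]] := compact_bounded cpt; exists (`|K| + 1) => w wK.
  apply: contrapT => /eqP Fw; apply: wK.
  have /FK /= wle : K < `|K| + 1 by rewrite ltr_pwDr// ler_norm.
  have {wle} : `|w| <= `|K| + 1 by apply: wle; apply: subset_closure.
  by rewrite prod_normE ge_max => /andP.
split => // w.
have [K FK] := (continuous_loc_bounded cx).2 (`|w.1| + `|w.2| + 1).
apply/cvgrPdist_le => e e0.
have K1 : 0 < `|K| + 1 by rewrite ltr_wpDl.
have cz' : (fun t => F (w.1, t)) t @[t --> w.2] --> F w.
  rewrite [F w](_ : _ = F (w.1, w.2)); last by case: (w).
  apply: (@differentiable_continuous _ _ _ _ (fun t => F (w.1, t))).
  by apply/derivable1_diffP; case: (dFz w).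
near=> v.
have v1 : `|w.1 - v.1| <= Num.min 1 (e / 2 / (`|K| + 1)).
  near: v; have : (fun v : V0 R => v.1) v @[v --> w] --> w.1 by exact: cvg_fst.
  by move=> /cvgrPdist_le; apply; rewrite lt_min ltr01 !divr_gt0.
have v2 : `|w.2 - v.2| <= 1.
  near: v; have : (fun v : V0 R => v.2) v @[v --> w] --> w.2 by exact: cvg_snd.
  by move=> /cvgrPdist_le; apply.
have v3 : `|F w - F (w.1, v.2)| <= e / 2.
  near: v; have : F (w.1, v.2) @[v --> w] --> F w.
    by apply: (@cvg_comp _ _ _ (fun v : V0 R => v.2) (fun t => F (w.1, t)) _ _ _ _ cz');
      exact: cvg_snd.
  by move=> /cvgrPdist_le; apply; rewrite divr_gt0.
move: v1; rewrite le_min => /andP[v1 v1'].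
rewrite -[F w](subrK (F (w.1, v.2))) -addrA (le_trans (ler_normD _ _))//.
rewrite [leRHS]splitr lerD// => {v3}.
have MVTle (x y : R) : x <= y -> `|x| <= `|w.1| + 1 -> `|y| <= `|w.1| + 1 ->
    `|y - x| <= e / 2 / (`|K| + 1) -> `|F (y, v.2) - F (x, v.2)| <= e / 2.
  move=> xy; rewrite ler_norml => /andP[x1 x2].
  rewrite ler_norml => /andP[y1 y2] yx.
  have dF t : is_derive t (1 : R) (fun t => F (t, v.2)) (dx F (t, v.2)) := dFx (t, v.2).
  have [c cxy ->] := MVT_segment xy (fun t _ => dF t)
    (continuous_subspaceT (is_derive_continuous dF)).
  move: cxy; rewrite in_itv/= => /andP[c1 c2].
  have n1 := normr_ge0 w.1; have n2 := normr_ge0 w.2.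
  rewrite normrM -[leRHS](divfK (lt0r_neq0 K1)) mulrC ler_pM//.
  rewrite (@le_trans _ _ K)//; last by rewrite (le_trans (ler_norm _))// lerDl.
  apply: FK; split => /=; first by rewrite ler_norml; apply/andP; split; lra.
  rewrite -[v.2](subrK w.2) (le_trans (ler_normD _ _))// distrC; lra.
have b1 : `|w.1| <= `|w.1| + 1 by rewrite lerDl.
have b2 : `|v.1| <= `|w.1| + 1.
  by rewrite -[v.1](subrK w.1) (le_trans (ler_normD _ _))// distrC addrC lerD2l.
have -> : F v = F (v.1, v.2) by congr F; case: (v).
have [wv|vw] := lerP w.1 v.1; first by rewrite distrC MVTle// distrC.
by rewrite MVTle// ltW.
Unshelve. all: by end_near. Qed.

End PlaneDerivatives.

(** * Slices, Fubini and integration by parts *)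

Section PlaneFubini.
Context {R : realType}.
Notation mu := (@lebesgue_measure R).
Notation mu0 := (@mu0 R).
Implicit Types (F G : V0 R -> R) (w : V0 R).

Lemma Rintegral_itv_supported (f : R -> R) (M : R) :
  (forall t, M < `|t| -> f t = 0) -> \int[mu]_t f t = \int[mu]_(t in `[- M, M]) f t.
Proof.
move=> fM; rewrite [RHS]Rintegral_mkcond; congr Rintegral; apply/funext => t.
rewrite patchE; case: ifPn => // /negP tM; rewrite fM// ltNge.
by apply/negP => tM'; apply: tM; rewrite inE/= in_itv/= -ler_norml.
Qed.

Lemma slice_integral (f : R -> R) (M K : R) : measurable_fun [set: measurableTypeR R] f ->
  (forall t, M < `|t| -> f t = 0) -> (forall t, `|t| <= M -> `|f t| <= K) ->
  (\int[mu]_t (f t)%:E)%E = (\int[mu]_(t in `[- M, M]) f t)%:E.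
Proof.
move=> mf fM fK; rewrite -(Rintegral_itv_supported fM) /Rintegral fineK//.
apply: integrable_fin_num => //.
rewrite -[X in mu.-integrable _ X](_ : (EFin \o f) \_ `[- M, M] = _); last first.
  apply/funext => t; rewrite patchE; case: ifPn => // /negP tM /=; rewrite fM// ltNge.
  by apply/negP => tM'; apply: tM; rewrite inE/= in_itv/= -ler_norml.
apply: (iffLR (integrable_mkcond _ _)); first exact: measurable_itv.
apply: measurable_bounded_integrable; first exact: measurable_itv.
- by rewrite /= lebesgue_measure_itv/=; case: ifP => _; rewrite ?ltry// -EFinD ltry.
- exact: measurable_funTS.
- exists K; split; first exact: num_real.
  move=> L KL t /=; rewrite in_itv/= -ler_norml => /fK /le_trans; apply; exact: ltW.
Qed.

Lemma slice1_integral F (M : R) : loc_bounded F -> supported_in F M -> forall z,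
  (\int[mu]_x (F (x, z))%:E)%E = (\int[mu]_(x in `[- M, M]) F (x, z))%:E.
Proof.
move=> [mF bF] FM z; have [K FK] := bF (Num.max M `|z|).
apply: (@slice_integral _ _ K) => [|t Mt|t tM].
- exact: (measurableT_comp mF (pair2_measurable _)).
- by apply: FM => -[/=]; rewrite leNgt Mt.
- by apply: FK; split => /=; rewrite le_max ?tM ?lexx ?orbT.
Qed.

Lemma slice2_integral F (M : R) : loc_bounded F -> supported_in F M -> forall x,
  (\int[mu]_z (F (x, z))%:E)%E = (\int[mu]_(z in `[- M, M]) F (x, z))%:E.
Proof.
move=> [mF bF] FM x; have [K FK] := bF (Num.max M `|x|).
apply: (@slice_integral _ _ K) => [|t Mt|t tM].
- exact: (measurableT_comp mF (pair1_measurable _)).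
- by apply: FM => -[/= _]; rewrite leNgt Mt.
- by apply: FK; split => /=; rewrite le_max ?tM ?lexx ?orbT.
Qed.

Lemma Rintegral_slices1_eq0 F (M : R) : loc_bounded F -> supported_in F M ->
  (forall z, \int[mu]_(x in `[- M, M]) F (x, z) = 0) -> \int[mu0]_w F w = 0.
Proof.
move=> bF FM F0.
have iF : (mu \x mu)%E.-integrable setT (EFin \o F).
  by apply: loc_bounded_integrable => //; exists M.
rewrite /Rintegral -[X in fine X](integral21_prod_meas1 iF) /fubini_G /=.
under eq_integral do rewrite (slice1_integral bF FM) F0.
by rewrite integral0.
Qed.

Lemma Rintegral_slices2_eq0 F (M : R) : loc_bounded F -> supported_in F M ->
  (forall x, \int[mu]_(z in `[- M, M]) F (x, z) = 0) -> \int[mu0]_w F w = 0.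
Proof.
move=> bF FM F0.
have iF : (mu \x mu)%E.-integrable setT (EFin \o F).
  by apply: loc_bounded_integrable => //; exists M.
rewrite /Rintegral -[X in fine X](integral12_prod_meas1 iF) /fubini_F /=.
under eq_integral do rewrite (slice2_integral bF FM) F0.
by rewrite integral0.
Qed.

Lemma Rintegral_prod_fun (f k : R -> R) (M : R) : continuous f -> continuous k ->
  (forall t, M < `|t| -> f t = 0) -> (forall t, M < `|t| -> k t = 0) ->
  \int[mu0]_w (f w.1 * k w.2) =
  (\int[mu]_(t in `[- M, M]) f t) * (\int[mu]_(t in `[- M, M]) k t).
Proof.
move=> cf ck fM kM.
have bF : loc_bounded (fun w : V0 R => f w.1 * k w.2).
  apply: continuous_loc_bounded => w; apply: cvgM.
    by apply: continuous_comp; [exact: cvg_fst|exact: cf].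
  by apply: continuous_comp; [exact: cvg_snd|exact: ck].
have FM : supported_in (fun w : V0 R => f w.1 * k w.2) M.
  by move=> w /notin_box[/fM ->|/kM ->]; rewrite ?mul0r ?mulr0.
have iF : (mu \x mu)%E.-integrable setT (EFin \o (fun w : V0 R => f w.1 * k w.2)).
  by apply: loc_bounded_integrable => //; exists M.
have E x : (\int[mu]_z (f x * k z)%:E)%E = (f x * \int[mu]_(z in `[- M, M]) k z)%:E.
  rewrite (slice2_integral bF FM x) /= RintegralZl//; exact: continuous_itv_integrable.
rewrite /Rintegral -[X in fine X = _](integral12_prod_meas1 iF) /fubini_F /=.
under eq_integral do rewrite E.
rewrite -/(Rintegral mu setT _) (@Rintegral_itv_supported _ M).
  by rewrite RintegralZr//; exact: continuous_itv_integrable.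
by move=> t /fM ->; rewrite mul0r.
Qed.

Lemma continuous_slice1 F (z : R) : continuous F -> continuous (fun t => F (t, z)).
Proof.
move=> cF x; have := cF (x, z); apply: (@cvg_comp _ _ _ (fun t => (t, z)) F).
by apply: (@cvg_pair _ _ _ _ (nbhs x) (nbhs z) _ _ _ id (cst z));
  [exact: cvg_id|exact: cvg_cst].
Qed.

Lemma continuous_slice2 F (x : R) : continuous F -> continuous (fun t => F (x, t)).
Proof.
move=> cF z; have := cF (x, z); apply: (@cvg_comp _ _ _ (fun t => (x, t)) F).
by apply: (@cvg_pair _ _ _ _ (nbhs x) (nbhs z) _ _ _ (cst x) id);
  [exact: cvg_cst|exact: cvg_id].
Qed.

Lemma C1_loc_bounded F Fx Fz : C1 F Fx Fz ->
  [/\ loc_bounded F, loc_bounded Fx & loc_bounded Fz].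
Proof. by move=> [*]; split; exact: continuous_loc_bounded. Qed.

Lemma Rintegral_C1_dx F Fx Fz : C1 F Fx Fz -> cpt_supported F -> \int[mu0]_w Fx w = 0.
Proof.
move=> cF [M FM]; have [_ bFx _] := C1_loc_bounded cF.
have [FxM _] := C1_supported cF FM.
(* Enlarged so that the endpoints of the slices lie strictly outside the support, where [F]
   vanishes. *)
pose N := `|M| + 1.
have MN : M < N by rewrite ltr_pwDr// ler_norm.
have N0 : 0 <= N by rewrite addr_ge0.
apply: (Rintegral_slices1_eq0 bFx (supported_in_le (ltW MN) FxM)) => z.
have dF x : is_derive x (1 : R) (fun x => F (x, z)) (Fx (x, z)) := C1_dx cF (x, z).
have cs := continuous_slice1 (z := z) (C1_contx cF).
have NN : - N <= N by lra.
rewrite (Rintegral_FTC NN dF cs).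
by rewrite !FM ?subrr// => -[/= + _]; rewrite ?normrN ger0_norm// leNgt MN.
Qed.

Lemma Rintegral_C1_dz F Fx Fz : C1 F Fx Fz -> cpt_supported F -> \int[mu0]_w Fz w = 0.
Proof.
move=> cF [M FM]; have [_ _ bFz] := C1_loc_bounded cF.
have [_ FzM] := C1_supported cF FM.
pose N := `|M| + 1.
have MN : M < N by rewrite ltr_pwDr// ler_norm.
have N0 : 0 <= N by rewrite addr_ge0.
apply: (Rintegral_slices2_eq0 bFz (supported_in_le (ltW MN) FzM)) => x.
have dF z : is_derive z (1 : R) (fun z => F (x, z)) (Fz (x, z)) := C1_dz cF (x, z).
have cs := continuous_slice2 (x := x) (C1_contz cF).
have NN : - N <= N by lra.
rewrite (Rintegral_FTC NN dF cs).
by rewrite !FM ?subrr// => -[/= _]; rewrite ?normrN ger0_norm// leNgt MN.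
Qed.

End PlaneFubini.

(** * Mollification and the chain rule *)

Section Kernel.
Context {R : realType}.

(** A quadratic remainder survives integration in a parameter. Kernels are therefore given such
    bounds, and convolutions inherit their derivatives without a theorem on differentiation under
    the integral. *)
Lemma is_derive_quadratic (f : R -> R) (x d C : R) :
  (forall h, `|h| <= 1 -> `|f (x + h) - f x - h * d| <= C * h ^+ 2) ->
  is_derive x (1 : R) f d.
Proof.
move=> H.
suff : (fun h : R => h^-1 *: ((f \o shift x) (h *: (1 : R)) - f x)) h @[h --> 0^'] --> d.
  by move=> fd; split; [apply: cvgP fd|exact: cvg_lim fd].
apply/cvgrPdist_le => e e0.
have C1 : 0 < `|C| + 1 by rewrite ltr_wpDl.
near=> h.
have h0 : h != 0 by near: h; exact: nbhs_dnbhs_neq.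
have hd : `|h| <= Num.min 1 (e / (`|C| + 1)).
  near: h; apply: dnbhs0_le; by rewrite lt_min ltr01 divr_gt0.
move: hd; rewrite le_min => /andP[h1 hd].
have -> : d - h^-1 *: ((f \o shift x) (h *: (1 : R)) - f x) =
    - h^-1 * (f (x + h) - f x - h * d).
  by rewrite /= -[h *: 1]/(h * 1) mulr1 -[_ *: _]/(_ * _) (addrC h); field.
rewrite normrM normrN normfV ler_pdivrMl ?normr_gt0//.
rewrite (le_trans (H _ h1))// -(real_normK (num_real h)) expr2 mulrA mulrC.
rewrite ler_wpM2l// (@le_trans _ _ ((`|C| + 1) * `|h|))//.
  by rewrite ler_wpM2r// (le_trans (ler_norm _))// lerDl.
by rewrite mulrC -ler_pdivlMr.
Unshelve. all: by end_near. Qed.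

Definition pos (t : R) : R := Num.max 0 t.

Lemma posP t : (0 <= t /\ pos t = t) \/ (t < 0 /\ pos t = 0).
Proof. by rewrite /pos; case: (lerP 0 t) => h; [left|right]. Qed.

Ltac pos_cases := repeat match goal with
  |- context [pos ?t] => let h := fresh "h" in let e := fresh "e" in
    case: (posP t) => -[h e]; rewrite e {e} end.

Lemma pos_lip (t h : R) : `|pos (t + h) - pos t| <= `|h|.
Proof.
have n1 := ler_norm h; have n2 := ler_norm (- h); rewrite normrN in n2.
by pos_cases; rewrite ler_norml; apply/andP; split; lra.
Qed.

Lemma possq_rem (t h : R) :
  `|pos (t + h) ^+ 2 - pos t ^+ 2 - h * (2 * pos t)| <= h ^+ 2.
Proof. by pos_cases; rewrite ler_norml; apply/andP; split; nra. Qed.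

Lemma is_derive_possq (t : R) : is_derive t (1 : R) (fun s => pos s ^+ 2) (2 * pos t).
Proof. by apply: (@is_derive_quadratic _ _ _ 1) => h _; rewrite mul1r possq_rem. Qed.

Lemma is_derive_poscube (t : R) : is_derive t (1 : R) (fun s => pos s ^+ 3) (3 * pos t ^+ 2).
Proof.
apply: (@is_derive_quadratic _ _ _ (3 * `|t| + 4)) => h.
rewrite ler_norml => /andP[h1 h2].
have [t0|t0] := lerP 0 t; [rewrite (ger0_norm t0)|rewrite (ltr0_norm t0)];
  pos_cases; rewrite ler_norml; apply/andP; split; nra.
Qed.

Lemma continuous_pos : continuous pos.
Proof. by move=> t; apply: continuous_max; [exact: cvg_cst|exact: cvg_id]. Qed.

(** The quadratic B-spline with knots -3, -1, 1, 3: a third difference with step 2 of [pos t ^ 2].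
    The corresponding difference of [t^3] is 48, so the division by 16 makes the integral equal to
    1. *)
Definition bspline (t : R) : R :=
  (pos (t + 3) ^+ 2 - 3 * pos (t + 1) ^+ 2 + 3 * pos (t - 1) ^+ 2 - pos (t - 3) ^+ 2) / 16.

Definition bspline' (t : R) : R :=
  (pos (t + 3) - 3 * pos (t + 1) + 3 * pos (t - 1) - pos (t - 3)) / 8.

Lemma bspline_supp t : 3 <= `|t| -> bspline t = 0 /\ bspline' t = 0.
Proof.
have pos_ge0 x : 0 <= x -> pos x = x by case: (posP x) => -[//]; lra.
have pos_le0 x : x <= 0 -> pos x = 0 by case: (posP x) => -[//]; lra.
rewrite ler_normr /bspline /bspline' => /orP[t3|t3].
  by rewrite !pos_ge0; try lra; split; field.
by rewrite !pos_le0; try lra; rewrite !(expr0n, mulr0, subr0, addr0, mul0r).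
Qed.

Lemma bspline_bound t : `|bspline t| <= 18 /\ `|bspline' t| <= 18.
Proof.
have [t3|t3] := lerP 3 `|t|.
  by have [-> ->] := bspline_supp t3; rewrite normr0.
move: t3; rewrite ltr_norml => /andP[t1 t2].
by rewrite !ler_norml /bspline /bspline'; pos_cases; (split; apply/andP; split; nra).
Qed.

Lemma bspline_rem t h : `|bspline (t + h) - bspline t - h * bspline' t| <= h ^+ 2.
Proof.
have r3 := possq_rem (t + 3) h; have r1 := possq_rem (t + 1) h.
have s1 := possq_rem (t - 1) h; have s3 := possq_rem (t - 3) h.
move: r3 r1 s1 s3; rewrite !ler_norml /bspline /bspline'.
rewrite !(addrAC t h); move: (pos _) (pos (t + 1 + h)) (pos (t - 1 + h)) (pos (t - 3 + h)).
move=> ? ? ? ? /andP[? ?] /andP[? ?] /andP[? ?] /andP[? ?].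
by apply/andP; split; lra.
Qed.

Lemma bspline'_lip t h : `|bspline' (t + h) - bspline' t| <= `|h|.
Proof.
have r3 := pos_lip (t + 3) h; have r1 := pos_lip (t + 1) h.
have s1 := pos_lip (t - 1) h; have s3 := pos_lip (t - 3) h.
move: r3 r1 s1 s3; rewrite !ler_norml /bspline'.
rewrite !(addrAC t h) => /andP[? ?] /andP[? ?] /andP[? ?] /andP[? ?].
by apply/andP; split; lra.
Qed.

Lemma is_derive_bspline t : is_derive t (1 : R) bspline (bspline' t).
Proof. by apply: (@is_derive_quadratic _ _ _ 1) => h _; rewrite mul1r bspline_rem. Qed.

End Kernel.

(** * Mollifiers at a given scale *)

Section Mollifier.
Context {R : realType}.
Notation mu := (@lebesgue_measure R).

(** [B] is to be independent of [dlt] and enters the quantitative estimates. The constant [L] may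
    depend on [dlt]: it serves only continuity and differentiability of the mollified functions. *)
Record mollifier (dlt B : R) (k k' : R -> R) : Prop := {
  moll_supp : forall t, 3 * dlt <= `|t| -> k t = 0 /\ k' t = 0;
  moll_bound : forall t, `|k t| <= B / dlt;
  moll_bound' : forall t, `|k' t| <= B / dlt ^+ 2;
  moll_lip : exists2 L, 0 <= L & forall t h, `|h| <= 1 ->
    [/\ `|k (t + h) - k t| <= L * `|h|, `|k' (t + h) - k' t| <= L * `|h| &
        `|k (t + h) - k t - h * k' t| <= L * h ^+ 2];
  moll_int : forall c N, `|c| + 3 * dlt <= N ->
    \int[mu]_(t in `[- N, N]) k (c - t) = 1 }.

Lemma bspline_primitive (t : R) : is_derive t (1 : R)
  (fun s => (pos (s + 3) ^+ 3 - 3 * pos (s + 1) ^+ 3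
             + 3 * pos (s - 1) ^+ 3 - pos (s - 3) ^+ 3) / 48) (bspline t).
Proof.
have dp (c : R) : is_derive t (1 : R) (fun s => pos (s + c) ^+ 3) (3 * pos (t + c) ^+ 2).
  have dc : is_derive t (1 : R) (fun s : R => s + c) 1.
    by apply: (is_derive_eq (is_deriveD (is_derive_id _ _) (is_derive_cst c _ _)));
      rewrite addr0.
  have dq := @is_derive_poscube R (t + c).
  apply: (is_derive_eq (@is_derive1_comp _ (fun s => pos s ^+ 3) (fun s => s + c) _ _ _ dq dc)).
  by rewrite mulr1.
have H := is_deriveZ (48^-1) (is_deriveB (is_deriveD (is_deriveB (dp 3)
  (is_deriveZ 3 (dp 1))) (is_deriveZ 3 (dp (- 1)))) (dp (- 3))).
rewrite (_ : (fun s => _) = 48^-1 \*: ((((fun s => pos (s + 3) ^+ 3)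
  - (3 \*: (fun s => pos (s + 1) ^+ 3)))
  + (3 \*: (fun s => pos (s - 1) ^+ 3))) - (fun s => pos (s - 3) ^+ 3))); last first.
  by apply/funext => s; rewrite mulrC.
apply: (is_derive_eq H); rewrite -![_ *: _]/(_ * _) /bspline.
by field.
Qed.

Lemma scaled_mollifier : exists2 B : R, 0 <= B & forall dlt, 0 < dlt ->
  exists k k', mollifier dlt B k k'.
Proof.
exists 18 => // dlt d0.
have dn0 : dlt != 0 by rewrite gt_eqF.
pose k (t : R) := bspline (t / dlt) / dlt.
pose k' (t : R) := bspline' (t / dlt) / dlt ^+ 2.
have kb' t : `|k' t| <= 18 / dlt ^+ 2.
  rewrite normrM [`|(dlt ^+ 2)^-1|]gtr0_norm ?invr_gt0 ?exprn_gt0//.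
  by rewrite ler_wpM2r ?invr_ge0 ?exprn_ge0 ?(ltW d0)// (bspline_bound _).2.
have rem t h : `|k (t + h) - k t - h * k' t| <= (dlt ^+ 3)^-1 * h ^+ 2.
  have -> : k (t + h) - k t - h * k' t = dlt^-1 * (bspline (t / dlt + h / dlt)
      - bspline (t / dlt) - (h / dlt) * bspline' (t / dlt)).
    by rewrite /k /k' mulrDl; field.
  rewrite normrM gtr0_norm ?invr_gt0//.
  have -> : (dlt ^+ 3)^-1 * h ^+ 2 = dlt^-1 * (h / dlt) ^+ 2 by field.
  by rewrite ler_wpM2l ?invr_ge0 ?(ltW d0)// bspline_rem.
have lip' t h : `|k' (t + h) - k' t| <= (dlt ^+ 3)^-1 * `|h|.
  have -> : k' (t + h) - k' t = (dlt ^+ 2)^-1 * (bspline' (t / dlt + h / dlt) - bspline' (t / dlt)).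
    by rewrite /k' mulrDl; field.
  rewrite normrM gtr0_norm ?invr_gt0 ?exprn_gt0//.
  have -> : (dlt ^+ 3)^-1 * `|h| = (dlt ^+ 2)^-1 * `|h / dlt|.
    by rewrite normrM normfV (gtr0_norm d0); field.
  by rewrite ler_wpM2l ?invr_ge0 ?exprn_ge0 ?(ltW d0)// bspline'_lip.
exists k, k'; split => //.
- move=> t td; rewrite /k /k'.
  have [|-> ->] := @bspline_supp R (t / dlt); last by rewrite !mul0r.
  by rewrite normrM normfV (gtr0_norm d0) ler_pdivlMr.
- move=> t; rewrite normrM [`|dlt^-1|]gtr0_norm ?invr_gt0//.
  by rewrite ler_wpM2r ?invr_ge0 ?(ltW d0)// (bspline_bound _).1.
- have L0 : 0 <= 18 / dlt ^+ 2 by exact: le_trans (kb' 0).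
  have L1 : 0 <= (dlt ^+ 3)^-1 by rewrite invr_ge0 exprn_ge0// ltW.
  exists (18 / dlt ^+ 2 + (dlt ^+ 3)^-1); first exact: addr_ge0.
  move=> t h h1; split.
  + rewrite -[k (t + h) - k t](subrK (h * k' t)) (le_trans (ler_normD _ _))//.
    rewrite addrC mulrDl lerD//; first by rewrite normrM mulrC ler_wpM2r.
    rewrite (le_trans (rem _ _))// ler_wpM2l// -(real_normK (num_real h)).
    by rewrite expr2 ler_piMl.
  + by rewrite (le_trans (lip' _ _))// ler_wpM2r// lerDr.
  + by rewrite (le_trans (rem _ _))// ler_wpM2r ?sqr_ge0// lerDr.
- move=> c N cN.
  pose Q (s : R) := (pos (s + 3) ^+ 3 - 3 * pos (s + 1) ^+ 3
             + 3 * pos (s - 1) ^+ 3 - pos (s - 3) ^+ 3) / 48.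
  have dQ t : is_derive t (1 : R) (fun t => - Q ((c - t) / dlt)) (k (c - t)).
    have dlin : is_derive t (1 : R) (fun t : R => (c - t) / dlt) (- dlt^-1).
      apply: (is_derive_eq (is_deriveM (is_deriveB (is_derive_cst c _ _) (is_derive_id _ _))
        (is_derive_cst (dlt^-1) t 1))).
      by rewrite scaler0 add0r sub0r -[_ *: _]/(_ * _) mulrN1.
    have dq := bspline_primitive ((c - t) / dlt).
    have dN := is_deriveN (@is_derive1_comp _ Q (fun t => (c - t) / dlt) t _ _ dq dlin).
    rewrite (_ : (fun t => - Q _) = - (Q \o (fun t => (c - t) / dlt)))//.
    by apply: (is_derive_eq dN); rewrite mulrN opprK.
  have ck : continuous (fun t => k (c - t)).
    have ck0 : continuous (@bspline R) := is_derive_continuous (@is_derive_bspline R).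
    move=> t; apply: cvgM; last exact: cvg_cst.
    apply: (@continuous_comp _ _ _ (fun t => (c - t) / dlt) bspline); last exact: ck0.
    by apply: cvgM; [apply: cvgB; [exact: cvg_cst|exact: cvg_id]|exact: cvg_cst].
  have c0 := ler_norm c; have c1 := ler_norm (- c); rewrite normrN in c1.
  have NN : - N <= N by lra.
  rewrite (Rintegral_FTC NN dQ ck).
  have s1 : (c - N) / dlt <= - 3 by rewrite ler_pdivrMr//; lra.
  have s2 : 3 <= (c - - N) / dlt by rewrite ler_pdivlMr//; lra.
  have pos_ge0 (x : R) : 0 <= x -> pos x = x by case: (posP x) => -[//]; lra.
  have pos_le0 (x : R) : x <= 0 -> pos x = 0 by case: (posP x) => -[//]; lra.
  move: ((c - N) / dlt) ((c - - N) / dlt) s1 s2 => x y x3 y3.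
  have -> : Q x = 0.
    by rewrite /Q !pos_le0; try lra; rewrite !(expr0n, mulr0, subr0, addr0, mul0r).
  by rewrite /Q !pos_ge0; try lra; field.
Qed.

End Mollifier.

(** * Convolution with product kernels *)

Section Convolution.
Context {R : realType}.
Notation mu0 := (@mu0 R).
Implicit Types (F G g : V0 R -> R) (w v : V0 R) (a b : R -> R).

Definition convol g a b w := \int[mu0]_v (g v * (a (w.1 - v.1) * b (w.2 - v.2))).

Definition kern a (r L : R) := [/\ forall t, r <= `|t| -> a t = 0,
  forall t, `|a t| <= L & forall t h, `|h| <= 1 -> `|a (t + h) - a t| <= L * `|h| ].

Lemma continuous_lip (f : R -> R) (x L : R) :
  (forall h, `|h| <= 1 -> `|f (x + h) - f x| <= L * `|h|) -> {for x, continuous f}.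
Proof.
move=> H; apply/cvgrPdist_le => e e0.
have L1 : 0 < `|L| + 1 by rewrite ltr_wpDl.
near=> y.
have : `|x - y| <= Num.min 1 (e / (`|L| + 1)).
  near: y; have : (fun y : R => y) y @[y --> x] --> x by exact: cvg_id.
  by move=> /cvgrPdist_le; apply; rewrite lt_min ltr01 divr_gt0.
rewrite le_min distrC => /andP[h1 h2]; have := H _ h1; rewrite subrKC => H1.
rewrite distrC (le_trans H1)//.
rewrite (@le_trans _ _ ((`|L| + 1) * `|y - x|))//.
  by rewrite ler_wpM2r// (le_trans (ler_norm _))// lerDl.
by rewrite mulrC -ler_pdivlMr.
Unshelve. all: by end_near. Qed.

Lemma kern_continuous a r L : kern a r L -> continuous a.
Proof. by move=> [_ _ aL] x; apply: continuous_lip => h; exact: aL. Qed.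

Lemma conv_integrand_loc_bounded g a b w : loc_bounded g -> continuous a -> continuous b ->
  loc_bounded (fun v => g v * (a (w.1 - v.1) * b (w.2 - v.2))).
Proof.
move=> bg ca cb; apply: loc_boundedM => //; apply: continuous_loc_bounded => v.
have c1 : (fun v : V0 R => w.1 - v.1) v @[v --> v] --> w.1 - v.1.
  by apply: cvgB; [exact: cvg_cst|exact: cvg_fst].
have c2 : (fun v : V0 R => w.2 - v.2) v @[v --> v] --> w.2 - v.2.
  by apply: cvgB; [exact: cvg_cst|exact: cvg_snd].
apply: cvgM.
  exact: (@continuous_comp _ _ _ (fun v : V0 R => w.1 - v.1) a v c1 (ca _)).
exact: (@continuous_comp _ _ _ (fun v : V0 R => w.2 - v.2) b v c2 (cb _)).
Qed.

Lemma conv_integrand_supp g a b w r N : (forall t, r <= `|t| -> a t = 0) ->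
  (forall t, r <= `|t| -> b t = 0) -> `|w.1| + r <= N -> `|w.2| + r <= N ->
  supported_in (fun v => g v * (a (w.1 - v.1) * b (w.2 - v.2))) N.
Proof.
move=> ra rb w1 w2 v /notin_box vN.
have sub (x y : R) : `|x| + r <= N -> N < `|y| -> r <= `|x - y|.
  move=> xr Ny; have := ler_normB (y - x) (- x); rewrite opprK subrK normrN distrC; lra.
by case: vN => [/(sub _ _ w1)/ra ->|/(sub _ _ w2)/rb ->]; rewrite ?mul0r ?mulr0.
Qed.

Lemma conv_continuous g a b r L : loc_bounded g -> 0 <= L -> 0 <= r ->
  kern a r L -> kern b r L -> continuous (convol g a b).
Proof.
move=> bg L0 r0 ka kb w.
have ca := kern_continuous ka; have cb := kern_continuous kb.
case: ka kb => [ra aL aL'] [rb bL bL'].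
pose N : R := `|w.1| + `|w.2| + 1 + r.
have n1 := normr_ge0 w.1; have n2 := normr_ge0 w.2.
have N0 : 0 <= N by rewrite /N; lra.
have [K gK] := bg.2 N.
have K0 : 0 <= K by apply: le_trans (gK (0, 0) _) => //; split; rewrite /= normr0.
pose C : R := K * (L * L) * (2 * N) ^+ 2.
have C0 : 0 <= C by rewrite mulr_ge0 ?sqr_ge0// !mulr_ge0.
have est w' : `|w'.1 - w.1| <= 1 -> `|w'.2 - w.2| <= 1 ->
    `|convol g a b w' - convol g a b w| <= C * (`|w'.1 - w.1| + `|w'.2 - w.2|).
  move=> d1 d2.
  have s1 := @conv_integrand_supp g a b w r N ra rb.
  have s2 := @conv_integrand_supp g a b w' r N ra rb.
  have {}s1 : supported_in (fun v => g v * (a (w.1 - v.1) * b (w.2 - v.2))) N.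
    by apply: s1; rewrite /N; lra.
  have {}s2 : supported_in (fun v => g v * (a (w'.1 - v.1) * b (w'.2 - v.2))) N.
    apply: s2; first by have := ler_normD w.1 (w'.1 - w.1); rewrite subrKC /N; lra.
    by have := ler_normD w.2 (w'.2 - w.2); rewrite subrKC /N; lra.
  have l1 := conv_integrand_loc_bounded w bg ca cb.
  have l2 := conv_integrand_loc_bounded w' bg ca cb.
  rewrite /convol -RintegralB//; last 2 first.
  - by apply: loc_bounded_integrable => //; exists N.
  - by apply: loc_bounded_integrable => //; exists N.
  have -> : C * (`|w'.1 - w.1| + `|w'.2 - w.2|) =
    K * (L * L * (`|w'.1 - w.1| + `|w'.2 - w.2|)) * (2 * N) ^+ 2 by rewrite /C; ring.
  apply: norm_Rintegral_box_le => //.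
  - by apply: loc_boundedD => //; exact: loc_boundedN.
  - by move=> v vN; rewrite s1// s2// subrr.
  - move=> v vN; rewrite -mulrBr normrM ler_pM// ?gK//.
    have -> : a (w'.1 - v.1) * b (w'.2 - v.2) - a (w.1 - v.1) * b (w.2 - v.2) =
      (a ((w.1 - v.1) + (w'.1 - w.1)) - a (w.1 - v.1)) * b (w'.2 - v.2) +
      a (w.1 - v.1) * (b ((w.2 - v.2) + (w'.2 - w.2)) - b (w.2 - v.2)).
      have -> : w.1 - v.1 + (w'.1 - w.1) = w'.1 - v.1 by ring.
      have -> : w.2 - v.2 + (w'.2 - w.2) = w'.2 - v.2 by ring.
      by ring.
    rewrite (le_trans (ler_normD _ _))// !normrM !mulrDr lerD//.
      rewrite (_ : L * L * _ = L * `|w'.1 - w.1| * L); last by ring.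
      by rewrite ler_pM// aL'.
    by rewrite -mulrA ler_pM// bL'.
apply/cvgrPdist_le => e e0.
have C1 : 0 < C + 1 by rewrite ltr_wpDl.
near=> w'.
have w'1 : `|w.1 - w'.1| <= Num.min 1 (e / 2 / (C + 1)).
  near: w'; have : (fun v : V0 R => v.1) v @[v --> w] --> w.1 by exact: cvg_fst.
  by move=> /cvgrPdist_le; apply; rewrite lt_min ltr01 !divr_gt0.
have w'2 : `|w.2 - w'.2| <= Num.min 1 (e / 2 / (C + 1)).
  near: w'; have : (fun v : V0 R => v.2) v @[v --> w] --> w.2 by exact: cvg_snd.
  by move=> /cvgrPdist_le; apply; rewrite lt_min ltr01 !divr_gt0.
move: w'1 w'2; rewrite !le_min distrC (distrC w.2) => /andP[d1 e1] /andP[d2 e2].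
rewrite distrC (le_trans (est _ d1 d2))//.
rewrite (@le_trans _ _ ((C + 1) * (`|w'.1 - w.1| + `|w'.2 - w.2|)))//.
  by rewrite ler_wpM2r ?addr_ge0// lerDl.
rewrite mulrC -ler_pdivlMr// [e in _ <= e / _]splitr mulrDl lerD//.
Unshelve. all: by end_near. Qed.

End Convolution.

(** * Bounds and derivatives of convolutions *)

Section ConvolutionDerivatives.
Context {R : realType}.
Notation mu := (@lebesgue_measure R).
Notation P := (measurableTypeR R * measurableTypeR R)%type.
Notation mu0 := (@mu0 R).
Implicit Types (F G g : V0 R -> R) (w v : V0 R) (a b : R -> R).

Lemma conv_integrable g a b w r L : loc_bounded g -> kern a r L -> kern b r L ->
  mu0.-integrable setT (EFin \o (fun v => g v * (a (w.1 - v.1) * b (w.2 - v.2)))).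
Proof.
move=> bg ka kb; apply: loc_bounded_integrable.
  exact: conv_integrand_loc_bounded bg (kern_continuous ka) (kern_continuous kb).
exists (`|w.1| + `|w.2| + r).
have n1 := normr_ge0 w.1; have n2 := normr_ge0 w.2.
by case: ka kb => [ra _ _] [rb _ _]; apply: (conv_integrand_supp _ ra rb); lra.
Qed.

Lemma convD F G a b w r L : loc_bounded F -> loc_bounded G -> kern a r L -> kern b r L ->
  convol (fun v => F v + G v) a b w = convol F a b w + convol G a b w.
Proof.
move=> bF bG ka kb; rewrite /convol -RintegralD//; last 2 first.
- exact: (conv_integrable w bF ka kb).
- exact: (conv_integrable w bG ka kb).
by apply: eq_Rintegral => v _; rewrite mulrDl.
Qed.

Lemma convZ F a b w (c r L : R) : loc_bounded F -> kern a r L -> kern b r L ->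
  convol (fun v => c * F v) a b w = c * convol F a b w.
Proof.
move=> bF ka kb; rewrite /convol -RintegralZl//; last exact: (conv_integrable w bF ka kb).
by apply: eq_Rintegral => v _; rewrite -mulrA.
Qed.

Lemma eq_conv F G a b w : F =1 G -> convol F a b w = convol G a b w.
Proof. by move=> FG; apply: eq_Rintegral => v _; rewrite FG. Qed.

Definition cbox (c : V0 R) (rho : R) : set (V0 R) :=
  [set v | `|v.1 - c.1| <= rho /\ `|v.2 - c.2| <= rho].

Lemma cboxE c rho :
  cbox c rho = `[c.1 - rho, c.1 + rho]%classic `*` `[c.2 - rho, c.2 + rho]%classic.
Proof.
by apply/seteqP; split => v; rewrite /cbox /setX/= !in_itv/= -!ler_distl.
Qed.

Lemma measurable_cbox c rho : measurable (cbox c rho : set P).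
Proof. by rewrite cboxE; apply: measurableX; exact: measurable_itv. Qed.

Lemma mu0_cbox c rho : 0 < rho -> mu0 (cbox c rho) = ((2 * rho) ^+ 2)%:E.
Proof.
move=> r0; rewrite cboxE.
have mI (x : R) : measurable (`[x - rho, x + rho]%classic : set (measurableTypeR R)).
  exact: measurable_itv.
rewrite [LHS](product_measure1E mu mu (mI c.1) (mI c.2)).
rewrite /= !lebesgue_measure_itv/= !lte_fin !ltrD2l !gtrN// -!EFinD -EFinM; congr EFin.
by ring.
Qed.

Lemma norm_Rintegral_cbox_le F c (rho K M : R) : loc_bounded F -> supported_in F M ->
  0 < rho -> (forall v, ~ cbox c rho v -> F v = 0) ->
  (forall v, cbox c rho v -> `|F v| <= K) -> `|\int[mu0]_v F v| <= K * (2 * rho) ^+ 2.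
Proof.
move=> bF FM r0 F0 FK.
have K0 : 0 <= K.
  by apply: le_trans (FK c _) => //; split; rewrite subrr normr0 ltW.
have iF : mu0.-integrable setT (EFin \o F) by apply: loc_bounded_integrable => //; exists M.
apply: le_trans (le_normr_Rintegral _ _) _ => //.
have -> : K * (2 * rho) ^+ 2 = \int[mu0]_(v in cbox c rho) K.
  by rewrite Rintegral_cst; [rewrite mu0_cbox|exact: measurable_cbox].
rewrite [leLHS](_ : _ = \int[mu0]_(v in cbox c rho) `|F v|); last first.
  rewrite [RHS]Rintegral_mkcond; congr Rintegral; apply/funext => v.
  by rewrite patchE; case: ifPn => // /negP vc; rewrite F0 ?normr0// => /mem_set.
apply: le_Rintegral => //.
- exact: measurable_cbox.
- apply: integrableR_norm; apply: integrableS iF => //; exact: measurable_cbox.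
- have rn := ltW r0; have iK := loc_bounded_integrable_box (`|c.1| + `|c.2| + rho) (loc_bounded_cst K).
  apply: integrableS iK.
  + exact: measurable_box.
  + exact: measurable_cbox.
  + have n1 := normr_ge0 c.1; have n2 := normr_ge0 c.2.
    move=> v [v1 v2]; split.
      by have := ler_normD (v.1 - c.1) c.1; rewrite subrK; lra.
    by have := ler_normD (v.2 - c.2) c.2; rewrite subrK; lra.
Qed.

(** Only the values of [G] on the support of the kernel count, and so does its area: with
    [r = 3 * dlt], the factor [(2 * r) ^ 2] cancels the factor [dlt ^ -2] of two mollifiers. *)
Lemma conv_bound G a b w (r L K A B : R) : loc_bounded G -> kern a r L -> kern b r L ->
  0 < r -> 0 <= K ->
  (forall t, `|a t| <= A) -> (forall t, `|b t| <= B) ->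
  (forall v, cbox w r v -> `|G v| <= K) -> `|convol G a b w| <= K * (A * B) * (2 * r) ^+ 2.
Proof.
move=> bG ka kb r0 K0 aA bB GK.
have lb := conv_integrand_loc_bounded w bG (kern_continuous ka) (kern_continuous kb).
case: ka kb => [ra _ _] [rb _ _].
have n1 := normr_ge0 w.1; have n2 := normr_ge0 w.2.
apply: (@norm_Rintegral_cbox_le _ w _ _ (`|w.1| + `|w.2| + r)) => //.
- by apply: (conv_integrand_supp _ ra rb); lra.
- move=> v /not_andP[] /negP; rewrite -ltNge distrC => /ltW.
    by move=> /ra ->; rewrite mul0r mulr0.
  by move=> /rb ->; rewrite !mulr0.
- move=> v vw; rewrite !normrM; apply: ler_pM => //.
    exact: GK.
  by apply: ler_pM.
Qed.

(** The quadratic remainder of the kernel is integrated over a box containing the supports for all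
    increments [|h| <= 1]. *)
Lemma conv_derive1 g a a' b (r L : R) : loc_bounded g -> 0 <= L -> 0 <= r ->
  kern a r L -> kern a' r L -> kern b r L ->
  (forall t h, `|h| <= 1 -> `|a (t + h) - a t - h * a' t| <= L * h ^+ 2) ->
  forall w, is_derive w.1 (1 : R) (fun t => convol g a b (t, w.2)) (convol g a' b w).
Proof.
move=> bg L0 r0 ka ka' kb rem w.
have n1 := normr_ge0 w.1; have n2 := normr_ge0 w.2.
pose N : R := `|w.1| + `|w.2| + 1 + r.
have N0 : 0 <= N by rewrite /N; lra.
have [K gK] := bg.2 N.
have K0 : 0 <= K by apply: le_trans (gK (0, 0) _) => //; split; rewrite /= normr0.
apply: (@is_derive_quadratic _ _ _ _ (K * (L * L) * (2 * N) ^+ 2)) => h h1.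
have i1 := @conv_integrable g a b (w.1 + h, w.2) r L bg ka kb.
have i2 := @conv_integrable g a b w r L bg ka kb.
have i3 := @conv_integrable g a' b w r L bg ka' kb.
have l1 := conv_integrand_loc_bounded (w.1 + h, w.2) bg (kern_continuous ka) (kern_continuous kb).
have l2 := conv_integrand_loc_bounded w bg (kern_continuous ka) (kern_continuous kb).
have l3 := conv_integrand_loc_bounded w bg (kern_continuous ka') (kern_continuous kb).
rewrite /convol -RintegralZl// -RintegralB// -RintegralB//; last 2 first.
- exact: integrableRB.
- exact: integrableRZ.
rewrite mulrAC (_ : K * (L * L) * _ = K * (L * h ^+ 2 * L)); last by ring.
case: ka ka' kb => [ra aL _] [ra' _ _] [rb bL _].
apply: norm_Rintegral_box_le => //.
- apply: loc_boundedD; first by apply: loc_boundedD => //; exact: loc_boundedN.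
  by apply: loc_boundedN; apply: loc_boundedM => //; exact: loc_bounded_cst.
- move=> v vN /=.
  have [t1 t2 t3] : [/\ `|w.1| + r <= N, `|w.2| + r <= N & `|w.1 + h| + r <= N].
    by split; [rewrite /N; lra..|have := ler_normD w.1 h; rewrite /N; lra].
  have /= -> := @conv_integrand_supp _ g a b (w.1 + h, w.2) r N ra rb t3 t2 v vN.
  have /= -> := @conv_integrand_supp _ g a b w r N ra rb t1 t2 v vN.
  have /= -> := @conv_integrand_supp _ g a' b w r N ra' rb t1 t2 v vN.
  by rewrite mulr0 !subr0.
- move=> v vN /=.
  have -> : w.1 + h - v.1 = w.1 - v.1 + h by ring.
  rewrite [X in `|X|](_ : _ = g v * ((a (w.1 - v.1 + h) - a (w.1 - v.1) - h * a' (w.1 - v.1))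
     * b (w.2 - v.2))); last by ring.
  rewrite !normrM; apply: ler_pM => //.
    exact: gK.
  by apply: ler_pM => //; exact: rem.
Qed.

Lemma conv_derive2 g a b b' (r L : R) : loc_bounded g -> 0 <= L -> 0 <= r ->
  kern a r L -> kern b r L -> kern b' r L ->
  (forall t h, `|h| <= 1 -> `|b (t + h) - b t - h * b' t| <= L * h ^+ 2) ->
  forall w, is_derive w.2 (1 : R) (fun t => convol g a b (w.1, t)) (convol g a b' w).
Proof.
move=> bg L0 r0 ka kb kb' rem w.
have n1 := normr_ge0 w.1; have n2 := normr_ge0 w.2.
pose N : R := `|w.1| + `|w.2| + 1 + r.
have N0 : 0 <= N by rewrite /N; lra.
have [K gK] := bg.2 N.
have K0 : 0 <= K by apply: le_trans (gK (0, 0) _) => //; split; rewrite /= normr0.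
apply: (@is_derive_quadratic _ _ _ _ (K * (L * L) * (2 * N) ^+ 2)) => h h1.
have i1 := @conv_integrable g a b (w.1, w.2 + h) r L bg ka kb.
have i2 := @conv_integrable g a b w r L bg ka kb.
have i3 := @conv_integrable g a b' w r L bg ka kb'.
have l1 := conv_integrand_loc_bounded (w.1, w.2 + h) bg (kern_continuous ka) (kern_continuous kb).
have l2 := conv_integrand_loc_bounded w bg (kern_continuous ka) (kern_continuous kb).
have l3 := conv_integrand_loc_bounded w bg (kern_continuous ka) (kern_continuous kb').
rewrite /convol -RintegralZl// -RintegralB// -RintegralB//; last 2 first.
- exact: integrableRB.
- exact: integrableRZ.
rewrite mulrAC (_ : K * (L * L) * _ = K * (L * (L * h ^+ 2))); last by ring.
case: ka kb kb' => [ra aL _] [rb bL _] [rb' _ _].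
apply: norm_Rintegral_box_le => //.
- apply: loc_boundedD; first by apply: loc_boundedD => //; exact: loc_boundedN.
  by apply: loc_boundedN; apply: loc_boundedM => //; exact: loc_bounded_cst.
- move=> v vN /=.
  have [t1 t2 t3] : [/\ `|w.1| + r <= N, `|w.2| + r <= N & `|w.2 + h| + r <= N].
    by split; [rewrite /N; lra..|have := ler_normD w.2 h; rewrite /N; lra].
  have /= -> := @conv_integrand_supp _ g a b (w.1, w.2 + h) r N ra rb t1 t3 v vN.
  have /= -> := @conv_integrand_supp _ g a b w r N ra rb t1 t2 v vN.
  have /= -> := @conv_integrand_supp _ g a b' w r N ra rb' t1 t2 v vN.
  by rewrite mulr0 !subr0.
- move=> v vN /=.
  have -> : w.2 + h - v.2 = w.2 - v.2 + h by ring.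
  rewrite [X in `|X|](_ : _ = g v * (a (w.1 - v.1) *
    (b (w.2 - v.2 + h) - b (w.2 - v.2) - h * b' (w.2 - v.2)))); last by ring.
  rewrite !normrM; apply: ler_pM => //.
    exact: gK.
  by apply: ler_pM => //; exact: rem.
Qed.

End ConvolutionDerivatives.

(** * Estimates for the mollified function *)

Section Mollification.
Context {R : realType}.
Notation P := (measurableTypeR R * measurableTypeR R)%type.
Notation mu0 := (@mu0 R).
Implicit Types (F G g : V0 R -> R) (w v : V0 R) (k s : R -> R).

(** An intrinsic gradient represented by a function bounded at every point, and not just almost
    everywhere, so that it is [loc_bounded]; the tests are the explicit [C1] ones. *)
Definition bounded_gradient g (h : V0 R -> R) (H : R) := [/\ measurable_fun [set: P] h,
  forall w, `|h w| <= H & forall F Fx Fz, C1 F Fx Fz -> cpt_supported F ->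
    \int[mu0]_w (h w * F w) = \int[mu0]_w (- g w * Fx w + g w ^+ 2 / 2 * Fz w)].

Lemma mollifier_kern (dlt B : R) (k k' : R -> R) : 0 < dlt -> 0 <= B -> mollifier dlt B k k' ->
  exists2 L, 0 <= L & [/\ kern k (3 * dlt) L, kern k' (3 * dlt) L &
    forall t h, `|h| <= 1 -> `|k (t + h) - k t - h * k' t| <= L * h ^+ 2].
Proof.
move=> d0 B0 [supp bnd bnd' [L L0 lip] _].
have b1 : 0 <= B / dlt by rewrite divr_ge0// ltW.
have b2 : 0 <= B / dlt ^+ 2 by rewrite divr_ge0// exprn_ge0// ltW.
exists (L + B / dlt + B / dlt ^+ 2); first by rewrite !addr_ge0.
have le (x y z : R) : 0 <= z -> x <= y * z -> y <= L + B / dlt + B / dlt ^+ 2 ->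
    x <= (L + B / dlt + B / dlt ^+ 2) * z.
  by move=> z0 xyz yL; rewrite (le_trans xyz)// ler_wpM2r.
split; first split.
- by move=> t /supp[].
- by move=> t; rewrite (le_trans (bnd t))//; lra.
- by move=> t h /(lip t)[l1 _ _]; apply: le l1 _ => //; lra.
- split; [by move=> t /supp[]|by move=> t; rewrite (le_trans (bnd' t))//; lra|].
  by move=> t h /(lip t)[_ l1 _]; apply: le l1 _ => //; lra.
- by move=> t h /(lip t)[_ _ l1]; apply: le l1 _; [exact: sqr_ge0|lra].
Qed.

Lemma mollify_C1 g (dlt B : R) (k k' : R -> R) : loc_bounded g -> 0 < dlt -> 0 <= B ->
  mollifier dlt B k k' -> C1 (convol g k k) (convol g k' k) (convol g k k').
Proof.
move=> bg d0 B0 m; have [L L0 [kk kk' rem]] := mollifier_kern d0 B0 m.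
have r0 : 0 <= 3 * dlt by rewrite mulr_ge0// ltW.
split; [exact: (conv_continuous bg L0 r0 kk kk)|exact: (conv_continuous bg L0 r0 kk' kk)
  |exact: (conv_continuous bg L0 r0 kk kk')| |] => w.
- exact: (conv_derive1 bg L0 r0 kk kk' kk rem).
- exact: (conv_derive2 bg L0 r0 kk kk kk' rem).
Qed.

Lemma mollifier_derive (dlt B : R) (k k' : R -> R) (c : R) : 0 < dlt -> 0 <= B ->
  mollifier dlt B k k' ->
  (forall t, is_derive t (1 : R) (fun t => k (c - t)) (- k' (c - t))) /\
  continuous (fun t => - k' (c - t)).
Proof.
move=> d0 B0 m; have [L L0 [_ kk' rem]] := mollifier_kern d0 B0 m.
split=> t.
  apply: (@is_derive_quadratic _ _ _ _ L) => h h1.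
  have := rem (c - t) (- h); rewrite normrN sqrrN => /(_ h1).
  have -> : c - (t + h) = c - t - h by ring.
  by rewrite mulNr mulrN.
have c1 : (fun t : R => c - t) t @[t --> t] --> c - t.
  by apply: cvgB; [exact: cvg_cst|exact: cvg_id].
apply: cvgN.
apply: (@continuous_comp _ _ _ (fun t => c - t) k' t); first exact: c1.
exact: (kern_continuous kk').
Qed.

Lemma mollifier_test (dlt B : R) (k k' : R -> R) w : 0 < dlt -> 0 <= B -> mollifier dlt B k k' ->
  C1 (fun v => k (w.1 - v.1) * k (w.2 - v.2))
     (fun v => - k' (w.1 - v.1) * k (w.2 - v.2))
     (fun v => k (w.1 - v.1) * - k' (w.2 - v.2)) /\
  cpt_supported (fun v => k (w.1 - v.1) * k (w.2 - v.2)).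
Proof.
move=> d0 B0 m; split.
  have [d1 c1] := mollifier_derive w.1 d0 B0 m; have [d2 c2] := mollifier_derive w.2 d0 B0 m.
  exact: (C1_prod d1 c1 d2 c2).
exists (`|w.1| + `|w.2| + 3 * dlt) => v vN.
have n1 := normr_ge0 w.1; have n2 := normr_ge0 w.2.
have supp t : 3 * dlt <= `|t| -> k t = 0 by move=> /(moll_supp m)[].
have t1 : `|w.1| + 3 * dlt <= `|w.1| + `|w.2| + 3 * dlt by lra.
have t2 : `|w.2| + 3 * dlt <= `|w.1| + `|w.2| + 3 * dlt by lra.
by have := @conv_integrand_supp _ (fun=> 1) k k w _ _ supp supp t1 t2 v vN; rewrite mul1r.
Qed.

(** These two moments allow constants to be subtracted under a convolution, which brings the
    oscillation of [g] into the estimates in place of its size. *)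
Lemma convol_cst1 (dlt B : R) (k k' : R -> R) w : 0 < dlt -> 0 <= B -> mollifier dlt B k k' ->
  convol (fun=> 1) k k w = 1 /\ convol (fun=> 1) k k' w = 0.
Proof.
move=> d0 B0 m; have [cT cs] := mollifier_test w d0 B0 m.
have n1 := normr_ge0 w.1; have n2 := normr_ge0 w.2.
split; last first.
  rewrite -[RHS]oppr0 -(Rintegral_C1_dz cT cs) /convol.
  have [_ _ bz] := C1_loc_bounded cT.
  rewrite -[RHS]mulN1r -RintegralZl//; last first.
    apply: loc_bounded_integrable => //; have [M sM] := cs.
    by exists M; exact: (C1_supported cT sM).2.
  by apply: eq_Rintegral => v _; rewrite mul1r mulrN mulN1r opprK.
pose N : R := `|w.1| + `|w.2| + 3 * dlt.
have cc c : continuous (fun t => k (c - t)).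
  exact: is_derive_continuous (mollifier_derive c d0 B0 m).1.
have supp c t : `|c| + 3 * dlt <= N -> N < `|t| -> k (c - t) = 0.
  move=> cN Nt; apply: (moll_supp m _).1.
  by have := ler_normB (t - c) (- c); rewrite opprK subrK normrN distrC; lra.
have t1 : `|w.1| + 3 * dlt <= N by rewrite /N; lra.
have t2 : `|w.2| + 3 * dlt <= N by rewrite /N; lra.
transitivity (\int[mu0]_v (k (w.1 - v.1) * k (w.2 - v.2))).
  by apply: eq_Rintegral => v _; rewrite mul1r.
rewrite (Rintegral_prod_fun (cc w.1) (cc w.2) (fun t => supp _ _ t1) (fun t => supp _ _ t2)).
by rewrite !(moll_int m)// mulr1.
Qed.

(** With [u = convol g k k], the first two bounds come from replacing [g] by [g - g w], of size
    [sqrt dlt] on the support of the kernel. The third is a commutator estimate. Testing the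
    definition of [h] against the kernel expresses [u_x] through the mollification of [h] and the
    [z]-derivative of the mollified [g^2 / 2]. Subtracting [u u_z] completes a square: what is left
    besides the mollified [h] is [(g - U)^2 / 2] convolved with [k k'], where [U = u(w)]. The square
    is of order [dlt] and compensates the [1 / dlt] lost to the derivative. *)
Lemma mollify_estimates g (h : V0 R -> R) (M K H B : R) : 0 <= M -> 0 <= K -> 0 <= B ->
  loc_bounded g -> half_hoelder g (M + 3) K -> bounded_gradient g h H ->
  exists2 C, 0 <= C & forall dlt k k', 0 < dlt -> dlt <= 1 -> mollifier dlt B k k' ->
    forall w, box M w ->
    [/\ `|convol g k k w - g w| <= C * Num.sqrt dlt,
        `|convol g k k' w| <= C * Num.sqrt dlt / dlt &
        `|convol g k' k w - convol g k k w * convol g k k' w| <= C].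
Proof.
move=> M0 K0 B0 bg [gK gH] [mh hH weak].
have H0 : 0 <= H by apply: le_trans (hH (0, 0)).
(* [6 ^ 2] is the area [(2 * (3 * dlt)) ^ 2] of the support divided by [dlt ^ 2]. *)
pose D := B * B * 6 ^+ 2.
have D0 : 0 <= D by rewrite !mulr_ge0.
pose C1 := K * 2 * D.
have C10 : 0 <= C1 by rewrite !mulr_ge0.
pose C2 := H * D + (2^-1 * (K * 2 + C1) ^+ 2) * D.
have C20 : 0 <= C2.
  apply: addr_ge0; apply: mulr_ge0 => //; apply: mulr_ge0; last exact: sqr_ge0.
  by rewrite invr_ge0.
exists (C1 + C2) => [|dlt k k' d0 d1 m w [w1 w2]]; first exact: addr_ge0.
have sd0 := sqrtr_ge0 dlt.
have dn0 : dlt != 0 by rewrite gt_eqF.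
have sdd : Num.sqrt dlt ^+ 2 = dlt by rewrite sqr_sqrtr// ltW.
have sdd' : Num.sqrt dlt / dlt * Num.sqrt dlt = 1.
  by rewrite mulrAC -expr2 sdd divff.
have [L L0 [kk kk' rem]] := mollifier_kern d0 B0 m.
have r0 : 0 < 3 * dlt by rewrite mulr_gt0.
have [i1 i0] := convol_cst1 w d0 B0 m.
have lc c : loc_bounded (fun _ : V0 R => c : R) := loc_bounded_cst c.
have wM : box (M + 3) w by split; lra.
have gosc v : cbox w (3 * dlt) v -> `|g v - g w| <= K * 2 * Num.sqrt dlt.
  move=> [v1 v2]; rewrite -mulrA.
  apply: (@le_trans _ _ (K * Num.sqrt (3 * dlt))).
    apply: gH => //; split.
      by have := ler_normD (v.1 - w.1) w.1; rewrite subrK; lra.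
    by have := ler_normD (v.2 - w.2) w.2; rewrite subrK; lra.
  rewrite ler_wpM2l//; apply: sqrtr_le_sqr; first by rewrite mulr_ge0.
  by rewrite exprMn sdd; lra.
have lg c : loc_bounded (fun v => g v + c) by exact: loc_boundedD.
have shift c a b : kern a (3 * dlt) L -> kern b (3 * dlt) L ->
    convol (fun v => g v + c) a b w = convol g a b w + c * convol (fun=> 1) a b w.
  move=> ka kb; rewrite (convD w bg (lc c) ka kb) -(convZ w c (lc 1) ka kb).
  by congr (_ + _); apply: eq_conv => v; rewrite mulr1.
have E1 : `|convol g k k w - g w| <= C1 * Num.sqrt dlt.
  have -> : convol g k k w - g w = convol (fun v => g v - g w) k k w.
    by rewrite (shift _ _ _ kk kk) i1 mulr1.
  have := conv_bound (lg (- g w)) kk kk r0 _ (moll_bound m) (moll_bound m) gosc.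
  move=> /(_ (mulr_ge0 (mulr_ge0 K0 (ler0n _ 2)) sd0))/le_trans; apply.
  rewrite le_eqVlt; apply/orP; left; apply/eqP; rewrite /C1 /D; by field.
have E2 : `|convol g k k' w| <= C1 * Num.sqrt dlt / dlt.
  have -> : convol g k k' w = convol (fun v => g v - g w) k k' w.
    by rewrite (shift _ _ _ kk kk') i0 mulr0 addr0.
  have := conv_bound (lg (- g w)) kk kk' r0 _ (moll_bound m) (moll_bound' m) gosc.
  move=> /(_ (mulr_ge0 (mulr_ge0 K0 (ler0n _ 2)) sd0))/le_trans; apply.
  rewrite le_eqVlt; apply/orP; left; apply/eqP; rewrite /C1 /D; by field.
split.
- by rewrite (le_trans E1)// ler_wpM2r// lerDl.
- by rewrite (le_trans E2)// ler_wpM2r ?invr_ge0 ?(ltW d0)// ler_wpM2r// lerDl.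
rewrite (@le_trans _ _ C2)//; last by rewrite lerDr.
have lg2 : loc_bounded (fun v => g v ^+ 2 / 2).
  by apply: loc_boundedM => //; exact: loc_boundedM.
have weakw : convol h k k w = convol g k' k w - convol (fun v => g v ^+ 2 / 2) k k' w.
  have [cT cs] := mollifier_test w d0 B0 m.
  rewrite /convol (weak _ _ _ cT cs) -RintegralB//; last 2 first.
  - exact: (conv_integrable w bg kk' kk).
  - exact: (conv_integrable w lg2 kk kk').
  by apply: eq_Rintegral => v _; ring.
(* Frozen at [w], the mollified function is a constant under the convolution, and [k k'] annihilates
   the term [U^2 / 2] of the square. *)
pose U := convol g k k w.
have gU v : cbox w (3 * dlt) v -> `|2^-1 * (g v - U) ^+ 2| <= 2^-1 * ((K * 2 + C1) ^+ 2 * dlt).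
  move=> vw; rewrite normrM gtr0_norm ?invr_gt0// ler_wpM2l ?invr_ge0//.
  rewrite -{1}sdd -exprMn normrX ler_sqr ?nnegrE ?mulr_ge0 ?addr_ge0 ?mulr_ge0//.
  have -> : g v - U = (g v - g w) - (U - g w) by ring.
  by rewrite (le_trans (ler_normB _ _))// mulrDl lerD// gosc.
have lgU : loc_bounded (fun v => 2^-1 * (g v - U) ^+ 2).
  by apply: loc_boundedM; [exact: loc_bounded_cst|apply: loc_boundedM; exact: lg].
have E3 : convol (fun v => 2^-1 * (g v - U) ^+ 2) k k' w =
    convol (fun v => g v ^+ 2 / 2) k k' w - U * convol g k k' w.
  rewrite (@eq_conv _ _ (fun v => g v ^+ 2 / 2 + ((- U) * g v + U ^+ 2 / 2 * 1))); last first.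
    by move=> v; field.
  have lUg : loc_bounded (fun v => - U * g v) by exact: loc_boundedM.
  have lU1 : loc_bounded (fun _ : V0 R => U ^+ 2 / 2 * 1) by exact: lc.
  rewrite (convD w lg2 (loc_boundedD lUg lU1) kk kk') (convD w lUg lU1 kk kk').
  by rewrite (convZ w _ bg kk kk') (convZ w _ (lc 1) kk kk') i0 mulr0 addr0 mulNr.
have -> : convol g k' k w - U * convol g k k' w =
    convol h k k w + convol (fun v => 2^-1 * (g v - U) ^+ 2) k k' w.
  by rewrite E3 weakw; ring.
have lh : loc_bounded h by split=> // N; exists H => v _; exact: hH.
rewrite (le_trans (ler_normD _ _))// /C2 lerD//.
  have := conv_bound lh kk kk r0 H0 (moll_bound m) (moll_bound m) 
    (fun v (_ : cbox w (3 * dlt) v) => hH v).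
  move=> /le_trans; apply.
  rewrite le_eqVlt; apply/orP; left; apply/eqP; rewrite /D; by field.
have P0 : 0 <= 2^-1 * ((K * 2 + C1) ^+ 2 * dlt).
  by apply: mulr_ge0; [rewrite invr_ge0|apply: mulr_ge0; [exact: sqr_ge0|exact: ltW]].
have := conv_bound lgU kk kk' r0 P0 (moll_bound m) (moll_bound' m) gU.
move=> /le_trans; apply.
rewrite le_eqVlt; apply/orP; left; apply/eqP; rewrite /D; by field.
Qed.

End Mollification.

(** * The chain rule in the limit of vanishing scale *)

Section ChainRule.
Context {R : realType}.
Notation mu0 := (@mu0 R).
Implicit Types (F G g : V0 R -> R) (w v : V0 R).

Lemma norm_mul_le (x y a b : R) : `|x| <= a -> `|y| <= b -> `|x * y| <= a * b.
Proof. by move=> xa yb; rewrite normrM ler_pM. Qed.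

Lemma norm_add_le (x y a b : R) : `|x| <= a -> `|y| <= b -> `|x + y| <= a + b.
Proof. by move=> xa yb; rewrite (le_trans (ler_normD _ _))// lerD. Qed.

Lemma derivative_lipschitz (f f' : R -> R) (K S : R) :
  (forall t, is_derive t (1 : R) f (f' t)) -> (forall t, `|t| <= K -> `|f' t| <= S) ->
  forall x y, `|x| <= K -> `|y| <= K -> `|f x - f y| <= S * `|x - y|.
Proof.
move=> df f'S x y.
wlog xy : x y / y <= x => [H|].
  have /orP[yx|xy] := le_total y x; first exact: H.
  by move=> xK yK; rewrite distrC (distrC x); exact: H.
move=> xK yK; have := xK; have := yK.
rewrite (ler_norml y) (ler_norml x) => /andP[y1 y2] /andP[x1 x2].
have [c] := MVT_segment xy (fun t _ => df t) (continuous_subspaceT (is_derive_continuous df)).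
rewrite in_itv/= => /andP[c1 c2] ->; rewrite normrM ler_wpM2r// f'S//.
by rewrite ler_norml; apply/andP; split; lra.
Qed.

Lemma continuous_bounded_on (f : R -> R) (K : R) : continuous f ->
  exists2 S, 0 <= S & forall t, `|t| <= K -> `|f t| <= S.
Proof.
move=> cf; have /compact_bounded[L [_ fL]] : compact (f @` `[- K, K]).
  by apply: continuous_compact (@segment_compact _ _ _); exact: continuous_subspaceT.
exists (`|L| + 1) => [|t tK]; first by rewrite addr_ge0.
apply: fL; first by rewrite ltr_pwDr// ler_norm.
by exists t => //=; rewrite in_itv/= -ler_norml.
Qed.

Lemma supported_integrable F M : loc_bounded F -> supported_in F M ->
  mu0.-integrable setT (EFin \o F).
Proof. by move=> bF FM; apply: loc_bounded_integrable => //; exists M. Qed.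

(* Test the definition of [h] against [s(u) chi], where [u] is the mollification of [g] at
   scale [dlt]. The error is controlled by the identity
     - (g - u) u_x + (g^2 - u^2) / 2 u_z = - (g - u) (u_x - u u_z) + (g - u)^2 / 2 u_z,
   since [`|g - u|], [`|u_z|] and [`|u_x - u u_z|] are bounded by multiples of
   [dlt ^ (1/2)], [dlt ^ (-1/2)] and [1]. *)
Lemma chain_rule g h H (s s' p q : R -> R) chi chix chiz :
  continuous g -> (forall M, exists2 K, 0 <= K & half_hoelder g M K) ->
  bounded_gradient g h H ->
  (forall t, is_derive t (1 : R) s (s' t)) -> continuous s' ->
  (forall t, is_derive t (1 : R) p (t * s' t)) ->
  (forall t, is_derive t (1 : R) q (t ^+ 2 / 2 * s' t)) ->
  C1 chi chix chiz -> cpt_supported chi ->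
  \int[mu0]_w (h w * (s (g w) * chi w)) =
  \int[mu0]_w ((p (g w) - g w * s (g w)) * chix w
               + (g w ^+ 2 / 2 * s (g w) - q (g w)) * chiz w).
Proof.
move=> cg gH bgr ds cs' dp dq cchi [M0 chiM0].
pose M := Num.max M0 0.
have M_ge0 : 0 <= M by rewrite le_max lexx orbT.
have chiM : supported_in chi M by apply: supported_in_le chiM0; rewrite le_max lexx.
have [chixM chizM] := C1_supported cchi chiM.
have [lchi lchix lchiz] := C1_loc_bounded cchi.
have lg := continuous_loc_bounded cg.
have [mh hH weak] := bgr.
have lh : loc_bounded h by split=> // N; exists H => v _; exact: hH.
have H0 : 0 <= H by apply: le_trans (hH (0, 0)).
have [K K0 hK] := gH (M + 3).
have [B B0 moll] := @scaled_mollifier R.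
have [C C0 est] := mollify_estimates M_ge0 K0 B0 lg hK bgr.
have cs := is_derive_continuous ds.
have cp := is_derive_continuous dp; have cq := is_derive_continuous dq.
have csq : continuous (fun t : R => t ^+ 2 / 2).
  by move=> t; apply: cvgM; [exact: exprn_continuous|exact: cvg_cst].
have cts : continuous (fun t : R => t * s t).
  by move=> t; apply: cvgM; [exact: cvg_id|exact: cs].
have cp2 : continuous (fun t : R => p t - t * s t).
  by move=> t; apply: cvgB; [exact: cp|exact: cts].
have cq2 : continuous (fun t : R => t ^+ 2 / 2 * s t - q t).
  by move=> t; apply: cvgB; [apply: cvgM; [exact: csq|exact: cs]|exact: cq].
(* The two components of the field have derivatives [- s] and [t s] in the value of [g], free of
   [s']; hence their Lipschitz constants [S1] and [S3]. *)
have dp2 t : is_derive t (1 : R) (fun t => p t - t * s t) (- s t).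
  apply: (is_derive_eq (is_deriveB (dp t) (is_deriveM (is_derive_id t 1) (ds t)))).
  by rewrite -![_ *: _]/(_ * _) /=; ring.
have dq2 t : is_derive t (1 : R) (fun t => t ^+ 2 / 2 * s t - q t) (t * s t).
  have dsq : is_derive t (1 : R) (fun t : R => t ^+ 2 / 2) t.
    apply: (is_derive_eq (is_deriveM (is_deriveX 2 (is_derive_id t (1 : R)))
      (is_derive_cst (2^-1 : R) t 1))).
    by rewrite -![_ *: _]/(_ * _) /=; field.
  apply: (is_derive_eq (is_deriveB (is_deriveM dsq (ds t)) (dq t))).
  by rewrite -![_ *: _]/(_ * _) /=; ring.
(* A common bound for [g] and for its mollification, which differ by at most [C * sqrt dlt <= C]. *)
pose K1 := K + C.
have [S1 S10 sS] := continuous_bounded_on K1 cs.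
have [S2 S20 s'S] := continuous_bounded_on K1 cs'.
have [S3 S30 tsS] := continuous_bounded_on K1 cts.
have lipS := derivative_lipschitz ds s'S.
have lipp := derivative_lipschitz (K := K1) (S := S1) dp2
  (fun t tK => eq_ind_r (fun z => z <= S1) (sS t tK) (normrN (s t))).
have lipq := derivative_lipschitz dq2 tsS.
have [X X0 chiX] : exists2 X, 0 <= X & forall w, box M w ->
    [/\ `|chi w| <= X, `|chix w| <= X & `|chiz w| <= X].
  have [X1 hX1] := lchi.2 M; have [X2 hX2] := lchix.2 M; have [X3 hX3] := lchiz.2 M.
  exists (`|X1| + `|X2| + `|X3|) => [|w wM]; first by rewrite !addr_ge0.
  have n1 := normr_ge0 X1; have n2 := normr_ge0 X2; have n3 := normr_ge0 X3.
  have m1 := ler_norm X1; have m2 := ler_norm X2; have m3 := ler_norm X3.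
  have x1 := hX1 _ wM; have x2 := hX2 _ wM; have x3 := hX3 _ wM.
  by split; lra.
pose Const := H * S2 * C * X + S1 * C * X + S3 * C * X + S2 * X * (C * C + C ^+ 3 / 2)
  + S1 * C * (X + K1 * X).
set LHS := \int[mu0]_w _; set RHS := \int[mu0]_w _.
suff main dlt : 0 < dlt -> dlt <= 1 -> `|LHS - RHS| <= Const * (2 * M) ^+ 2 * Num.sqrt dlt.
  pose c := Const * (2 * M) ^+ 2; rewrite -/c in main.
  apply/eqP; rewrite -subr_eq0 -normr_le0; apply/ler_addgt0Pl => e e0; rewrite addr0.
  have c1 : 0 < `|c| + 1 by rewrite ltr_wpDl.
  pose r := Num.min 1 (e / (`|c| + 1)).
  have r0 : 0 < r by rewrite lt_min ltr01 divr_gt0.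
  have r1 : r <= 1 by rewrite ge_min lexx.
  have r2 : r ^+ 2 <= 1 by rewrite exprn_ile1 // ltW.
  rewrite (le_trans (main _ (exprn_gt0 2 r0) r2))//.
  rewrite sqrtr_sqr gtr0_norm// (@le_trans _ _ ((`|c| + 1) * r))//.
    by rewrite ler_wpM2r ?(ltW r0)// (le_trans (ler_norm _))// lerDl.
  by rewrite mulrC -ler_pdivlMr// ge_min lexx orbT.
move=> d0 d1.
have [k [k' m]] := moll _ d0.
have cu := mollify_C1 lg d0 B0 m.
have {est} est := est _ _ _ d0 d1 m.
pose u := convol g k k; pose ux := convol g k' k; pose uz := convol g k k'.
rewrite -/u -/ux -/uz in cu est.
have cpsi := C1M (C1_comp ds cs' cu) cchi.
have cts' : continuous (fun t : R => t * s' t).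
  by move=> t; apply: cvgM; [exact: cvg_id|exact: cs'].
have csqs' : continuous (fun t : R => t ^+ 2 / 2 * s' t).
  by move=> t; apply: cvgM; [exact: csq|exact: cs'].
have cP := C1M (C1_comp dp cts' cu) cchi.
have cQ := C1M (C1_comp dq csqs' cu) cchi.
have supp (f : V0 R -> R) : supported_in (fun w => f w * chi w) M.
  by move=> w wM; rewrite chiM// mulr0.
have cptsupp (f : V0 R -> R) : cpt_supported (fun w => f w * chi w) by exists M.
have weakpsi := weak _ _ _ cpsi (cptsupp _).
have intP := Rintegral_C1_dx cP (cptsupp _).
have intQ := Rintegral_C1_dz cQ (cptsupp _).
have [lpsi lpsix lpsiz] := C1_loc_bounded cpsi.
have [psixM psizM] := C1_supported cpsi (supp _).
have [_ lPx _] := C1_loc_bounded cP; have [PxM _] := C1_supported cP (supp _).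
have [_ _ lQz] := C1_loc_bounded cQ; have [_ QzM] := C1_supported cQ (supp _).
set psix := (fun w => s' (u w) * ux w * chi w + s (u w) * chix w) in weakpsi lpsix psixM.
set psiz := (fun w => s' (u w) * uz w * chi w + s (u w) * chiz w) in weakpsi lpsiz psizM.
pose E1 w := h w * (s (g w) * chi w).
pose E2 w := (p (g w) - g w * s (g w)) * chix w + (g w ^+ 2 / 2 * s (g w) - q (g w)) * chiz w.
pose E3 w := h w * (s (u w) * chi w).
pose E4 w := - g w * psix w + g w ^+ 2 / 2 * psiz w.
set E5 := (fun w => _) in intP lPx PxM; set E6 := (fun w => _) in intQ lQz QzM.
have l1 : loc_bounded E1 by apply: loc_boundedM => //; apply: loc_boundedM => //; exact: loc_bounded_comp.
have l2 : loc_bounded E2.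
  by apply: loc_boundedD; apply: loc_boundedM => //;
    [exact: (loc_bounded_comp cp2 lg)|exact: (loc_bounded_comp cq2 lg)].
have l3 : loc_bounded E3 by apply: loc_boundedM.
have l4 : loc_bounded E4.
  apply: loc_boundedD; apply: loc_boundedM => //; first exact: loc_boundedN.
  exact: (loc_bounded_comp csq lg).
have s1 : supported_in E1 M by move=> w wM; rewrite /E1 chiM// !mulr0.
have s2 : supported_in E2 M by move=> w wM; rewrite /E2 chixM// chizM// !mulr0 addr0.
have s3 : supported_in E3 M by move=> w wM; rewrite /E3 chiM// !mulr0.
have s4 : supported_in E4 M by move=> w wM; rewrite /E4 psixM// psizM// !mulr0 addr0.
(* The added terms integrate to zero: [E3 - E4] by the definition of [h] tested on [s(u) chi], and
   [E5], [E6] as derivatives of the compactly supported [p(u) chi] and [q(u) chi]. With them the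
   integrand becomes small pointwise. *)
have -> : LHS - RHS = \int[mu0]_w (E1 w - E2 w - (E3 w - E4 w) + (E5 w - E6 w)).
  have i1 := supported_integrable l1 s1; have i2 := supported_integrable l2 s2.
  have i3 := supported_integrable l3 s3; have i4 := supported_integrable l4 s4.
  have i5 := supported_integrable lPx PxM; have i6 := supported_integrable lQz QzM.
  have i12 := integrableRB measurableT i1 i2; have i34 := integrableRB measurableT i3 i4.
  have i56 := integrableRB measurableT i5 i6.
  rewrite (RintegralD measurableT (integrableRB measurableT i12 i34) i56).
  rewrite (RintegralB measurableT i12 i34) (RintegralB measurableT i1 i2).
  rewrite (RintegralB measurableT i3 i4) (RintegralB measurableT i5 i6).
  by rewrite intP intQ -/LHS -/RHS weakpsi !subrr subr0 addr0.
rewrite mulrAC; apply: norm_Rintegral_box_le => //.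
- apply: loc_boundedD; last by apply: loc_boundedD => //; exact: loc_boundedN.
  apply: loc_boundedD; first by apply: loc_boundedD => //; exact: loc_boundedN.
  by apply: loc_boundedN; apply: loc_boundedD => //; exact: loc_boundedN.
- by move=> w wM; rewrite s1// s2// s3// s4// PxM// QzM// !subrr addr0.
move=> w wM.
have [e1 e2 e3] := est w wM; have [x1 x2 x3] := chiX w wM.
set d := Num.sqrt dlt in e1 e2 *.
have d0' : 0 < d by rewrite sqrtr_gt0.
have dd : d * d = dlt by rewrite -expr2 sqr_sqrtr// ltW.
have dle1 : d <= 1 by rewrite -[leRHS]sqrtr1 ler_wsqrtr.
have Cd : C * d <= C by rewrite ler_piMr.
have gK1 : `|g w| <= K1.
  rewrite (le_trans (hK.1 w _)) ?lerDl//; case: wM => ? ?; split; lra.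
have uK1 : `|u w| <= K1.
  have -> : u w = g w + (u w - g w) by ring.
  apply: norm_add_le; last exact: le_trans Cd.
  by apply: hK.1; case: wM => ? ?; split; lra.
have gu : `|g w - u w| <= C * d by rewrite distrC.
have lS := le_trans (lipS _ _ gK1 uK1) (ler_wpM2l S20 gu).
have lP := le_trans (lipp _ _ gK1 uK1) (ler_wpM2l S10 gu).
have lQ := le_trans (lipq _ _ gK1 uK1) (ler_wpM2l S30 gu).
(* Each of the five terms contains a difference between [g] and [u], of order [d]. The fourth
   carries the derivatives of [u]; there [(C d)^2 * (C d / dlt)] is again of order [d] because
   [d^2 = dlt]. *)
have -> : E1 w - E2 w - (E3 w - E4 w) + (E5 w - E6 w) =
  h w * (s (g w) - s (u w)) * chi w
  + - (p (g w) - g w * s (g w) - (p (u w) - u w * s (u w))) * chix w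
  + - (g w ^+ 2 / 2 * s (g w) - q (g w) - (u w ^+ 2 / 2 * s (u w) - q (u w))) * chiz w
  + s' (u w) * chi w * (- (g w - u w) * (ux w - u w * uz w)
      + (g w - u w) * (g w - u w) * uz w / 2)
  + s (u w) * (g w - u w) * (- chix w + (g w + u w) / 2 * chiz w).
  by rewrite /E1 /E2 /E3 /E4 /E5 /E6 /psix /psiz; field.
have -> : Const * d = H * (S2 * (C * d)) * X + S1 * (C * d) * X + S3 * (C * d) * X
  + S2 * X * (C * d * C + C * d * (C * d) * (C * d / dlt) / 2)
  + S1 * (C * d) * (X + (K1 + K1) / 2 * X).
  by rewrite /Const -dd; field; rewrite gt_eqF.
have n2 : `|2^-1 : R| <= 2^-1 by rewrite gtr0_norm.
apply: norm_add_le; first apply: norm_add_le; first apply: norm_add_le; first apply: norm_add_le.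
- by apply: norm_mul_le => //; apply: norm_mul_le.
- by apply: norm_mul_le => //; rewrite normrN.
- by apply: norm_mul_le => //; rewrite normrN.
- apply: norm_mul_le; first by apply: norm_mul_le => //; exact: s'S.
  apply: norm_add_le; first by apply: norm_mul_le => //; rewrite normrN.
  by apply: norm_mul_le => //; apply: norm_mul_le => //; apply: norm_mul_le.
- apply: norm_mul_le; first by apply: norm_mul_le => //; exact: sS.
  apply: norm_add_le; first by rewrite normrN.
  by apply: norm_mul_le => //; apply: norm_mul_le => //; apply: norm_add_le.
Qed.

End ChainRule.

(** * Gradients of functions that agree on an open set *)

Section SmoothApproximation.
Context {R : realType}.
Implicit Types (A B : set R).

(** Convergence holds at every point, endpoints included, so that limits of tests reach half-open
    intervals, a family stable under intersection. *)
Definition smooth_approx A (alpha : nat -> R -> R) := exists alpha' : nat -> R -> R,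
  [/\ forall n t, is_derive t (1 : R) (alpha n) (alpha' n t),
      forall n, continuous (alpha' n), forall n t, 0 <= alpha n t <= 1 &
      forall t, alpha n t @[n --> \oo] --> (\1_A t : R)].

Lemma smooth_approxT : smooth_approx setT (fun _ _ => 1).
Proof.
exists (fun _ _ => 0); split.
- by move=> n t; exact: is_derive_cst.
- by move=> n t; exact: cvg_cst.
- by move=> n t; rewrite ler01 lexx.
- by move=> t; rewrite indicT; exact: cvg_cst.
Qed.

Lemma smooth_approxI A B alpha beta : smooth_approx A alpha -> smooth_approx B beta ->
  smooth_approx (A `&` B) (fun n t => alpha n t * beta n t).
Proof.
move=> [a' [da ca a01 aA]] [b' [db cb b01 bB]].
exists (fun n t => alpha n t * b' n t + beta n t * a' n t); split.
- by move=> n t; apply: (is_derive_eq (is_deriveM (da n t) (db n t))).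
- move=> n t; apply: cvgD; apply: cvgM; rewrite ?ca ?cb//.
  + exact: (is_derive_continuous (da n)).
  + exact: cb.
  + exact: (is_derive_continuous (db n)).
  + exact: ca.
- move=> n t; have /andP[a0 a1] := a01 n t; have /andP[b0 b1] := b01 n t.
  by rewrite mulr_ge0// mulr_ile1.
- by move=> t; rewrite indicI; apply: cvgM.
Qed.

(** A rational function of [pos t ^ 2]: it is continuously differentiable, tends to 1 on the
    positive half-line and vanishes exactly on the other one, so that the products built from it
    have their support in prescribed rectangles. *)
Definition ramp (n : nat) (t : R) : R := 1 - (1 + n%:R * pos t ^+ 2)^-1.

Lemma ramp_gt0 n (t : R) : 0 < 1 + n%:R * pos t ^+ 2.
Proof. by rewrite ltr_wpDr// mulr_ge0// sqr_ge0. Qed.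

Lemma ramp_le0 n (t : R) : t <= 0 -> ramp n t = 0.
Proof.
move=> t0; rewrite /ramp (_ : pos t = 0) ?expr0n/= ?mulr0 ?addr0 ?invr1 ?subrr//.
by rewrite /pos; apply/max_idPl.
Qed.

Lemma ramp01 n (t : R) : 0 <= ramp n t <= 1.
Proof.
rewrite /ramp subr_ge0 gerBl invr_ge0 (ltW (ramp_gt0 _ _)) andbT invf_le1 ?ramp_gt0//.
by rewrite lerDl mulr_ge0// sqr_ge0.
Qed.

Definition ramp' (n : nat) (t : R) : R :=
  n%:R * (2 * pos t) / (1 + n%:R * pos t ^+ 2) ^+ 2.

Lemma is_derive_ramp n (c sg t : R) :
  is_derive t (1 : R) (fun t => ramp n (sg * t + c)) (sg * ramp' n (sg * t + c)).
Proof.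
have dr (s : R) : is_derive s (1 : R) (ramp n) (ramp' n s).
  have d1 : is_derive s (1 : R) (fun s => 1 + n%:R * pos s ^+ 2) (n%:R * (2 * pos s)).
    apply: (is_derive_eq (is_deriveD (is_derive_cst (1 : R) s 1)
      (is_deriveZ n%:R (is_derive_possq s)))).
    by rewrite add0r.
  have n0 : 1 + n%:R * pos s ^+ 2 != 0 by rewrite gt_eqF// ramp_gt0.
  apply: (is_derive_eq (is_deriveB (is_derive_cst (1 : R) s 1) (@is_deriveV _
    (fun s => 1 + n%:R * pos s ^+ 2) s _ _ n0 d1))).
  by rewrite sub0r scaleNr opprK -[_ *: _]/(_ * _) mulrC.
have dl : is_derive t (1 : R) (fun t => sg * t + c) sg.
  apply: (is_derive_eq (is_deriveD (is_deriveZ sg (is_derive_id t 1)) (is_derive_cst c t 1))).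
  by rewrite addr0 [_ *: _]mulr1.
apply: (is_derive_eq (@is_derive1_comp _ (ramp n) (fun t => sg * t + c) t _ _ (dr _) dl)).
by rewrite mulrC.
Qed.

Lemma continuous_ramp' n (c sg : R) : continuous (fun t => sg * ramp' n (sg * t + c)).
Proof.
have cr : continuous (ramp' n).
  move=> t; apply: cvgM.
    by apply: cvgM; [exact: cvg_cst|apply: cvgM; [exact: cvg_cst|exact: continuous_pos]].
  have cpos := is_derive_continuous (@is_derive_possq R).
  apply: cvgV; first by rewrite gt_eqF// exprn_gt0// ramp_gt0.
  have cb : (fun t : R => 1 + n%:R * pos t ^+ 2) s @[s --> t] --> 1 + n%:R * pos t ^+ 2.
    by apply: cvgD; [exact: cvg_cst|apply: cvgM; [exact: cvg_cst|exact: cpos]].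
  by rewrite expr2; under eq_fun do rewrite expr2; apply: cvgM.
move=> t; apply: cvgM; first exact: cvg_cst.
apply: (@continuous_comp _ _ _ (fun t => sg * t + c) (ramp' n)); last exact: cr.
by apply: cvgD; [apply: cvgM; [exact: cvg_cst|exact: cvg_id]|exact: cvg_cst].
Qed.

Lemma cvg_ramp (t : R) : ramp n t @[n --> \oo] --> ((0 < t)%R%:R : R).
Proof.
have [t0|t0] := lerP t 0.
  by under eq_fun do rewrite ramp_le0//; exact: cvg_cst.
apply/cvgrPdist_le => e e0.
have p0 : 0 < pos t ^+ 2 by rewrite exprn_gt0// /pos lt_max t0 orbT.
near=> n.
rewrite /ramp opprB addrC subrK gtr0_norm ?invr_gt0 ?ramp_gt0//.
rewrite invf_ple ?posrE ?ramp_gt0//.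
rewrite (@le_trans _ _ (n%:R * pos t ^+ 2))//; last by rewrite lerDr.
rewrite -ler_pdivrMr//.
near: n; exact: nbhs_infty_ger.
Unshelve. all: by end_near. Qed.

Lemma smooth_approx_gt (a : R) : smooth_approx `]a, +oo[ (fun n t => ramp n (1 * t + - a)).
Proof.
exists (fun n t => 1 * ramp' n (1 * t + - a)); split.
- by move=> n t; exact: is_derive_ramp.
- by move=> n; exact: continuous_ramp'.
- by move=> n t; exact: ramp01.
- move=> t; rewrite indicE mem_setE in_itv/= andbT; have := @cvg_ramp (1 * t + - a).
  by rewrite [(0 < _)%R](_ : _ = (a < t)%R)// mul1r subr_gt0.
Qed.

Lemma smooth_approx_lt (b : R) : smooth_approx `]-oo, b[ (fun n t => ramp n (-1 * t + b)).
Proof.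
exists (fun n t => -1 * ramp' n (-1 * t + b)); split.
- by move=> n t; exact: is_derive_ramp.
- by move=> n; exact: continuous_ramp'.
- by move=> n t; exact: ramp01.
- move=> t; rewrite indicE mem_setE in_itv/=; have := @cvg_ramp (-1 * t + b).
  by rewrite [(0 < _)%R](_ : _ = (t < b)%R)// mulN1r addrC subr_gt0.
Qed.

Lemma smooth_approx_le (b : R) : smooth_approx `]-oo, b] (fun n t => 1 - ramp n (1 * t + - b)).
Proof.
exists (fun n t => - (1 * ramp' n (1 * t + - b))); split.
- move=> n t; apply: (is_derive_eq (is_deriveB (is_derive_cst (1 : R) t 1) (is_derive_ramp _ _ _ _))).
  by rewrite sub0r.
- by move=> n t; apply: cvgN; exact: continuous_ramp'.
- by move=> n t; have /andP[? ?] := ramp01 n (1 * t + - b); apply/andP; split; lra.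
- move=> t; rewrite indicE mem_setE in_itv/= leNgt; have := @cvg_ramp (1 * t + - b).
  rewrite [(0 < _)%R](_ : _ = (b < t)%R); last by rewrite mul1r subr_gt0.
  rewrite [X in _ -> _ --> X](_ : _ = 1 - (b < t)%R%:R); last first.
    by case: (b < t)%R; rewrite ?subrr ?subr0.
  by move=> h; apply: cvgB => //; exact: cvg_cst.
Qed.

Lemma smooth_approx_oc (a b : R) : exists alpha, smooth_approx `]a, b] alpha.
Proof.
eexists; rewrite (_ : `]a, b]%classic = `]a, +oo[ `&` `]-oo, b]).
  exact: smooth_approxI (smooth_approx_gt a) (smooth_approx_le b).
by apply/seteqP; split => t; rewrite /setI/= !in_itv/= andbT => /andP.
Qed.

Lemma smooth_approx_oo A (a b : R) alpha : smooth_approx A alpha ->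
  exists beta, smooth_approx (A `&` `]a, b[) beta /\
    forall n t, t \notin `]a, b[ -> beta n t = 0.
Proof.
move=> aA; eexists; split.
  have := smooth_approxI aA (smooth_approxI (smooth_approx_gt a) (smooth_approx_lt b)).
  rewrite (_ : `]a, +oo[ `&` `]-oo, b[ = `]a, b[%classic); first exact.
  by apply/seteqP; split => t; rewrite /setI/= !in_itv/= andbT => /andP.
move=> n t; rewrite in_itv/= negb_and -!leNgt mul1r mulN1r => /orP[ta|bt].
  by rewrite (@ramp_le0 n (t - a)) ?subr_le0// mul0r mulr0.
by rewrite (@ramp_le0 n (- t + b)) ?mulr0// addrC subr_le0.
Qed.

End SmoothApproximation.

(** * Functions annihilated by the tests on a rectangle *)

Section Localization.
Context {R : realType}.
Notation P := (measurableTypeR R * measurableTypeR R)%type.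
Notation mu0 := (@mu0 R).
Implicit Types (F : V0 R -> R) (w : V0 R).

Definition orect (a b c e : R) : set (V0 R) := [set w | (w.1 \in `]a, b[) /\ (w.2 \in `]c, e[)].

(** The tests vanish off [Q], but their supports may reach its boundary. Being nonnegative, they
    attain a minimum at each point off [Q], so their derivatives vanish there as well. *)
Definition annihilates_tests (d : V0 R -> R) (Q : set (V0 R)) :=
  forall F Fx Fz, C1 F Fx Fz -> cpt_supported F -> (forall w, 0 <= F w) ->
    (forall w, ~ Q w -> F w = 0) -> \int[mu0]_w (d w * F w) = 0.

Lemma annihilates_rect (d : V0 R -> R) (a b c e : R) (A B : set R) alpha beta :
  loc_bounded d -> annihilates_tests d (orect a b c e) ->
  smooth_approx A alpha -> smooth_approx B beta -> measurable (A : set (measurableTypeR R)) ->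
  measurable (B : set (measurableTypeR R)) ->
  (\int[mu0]_(w in orect a b c e `&` (A `*` B)) (d w)%:E = 0)%E.
Proof.
move=> bd ann aA bB mA mB.
have [al [[al' [dal cal al01 alA]] al0]] := smooth_approx_oo a b aA.
have [be [[be' [dbe cbe be01 beB]] be0]] := smooth_approx_oo c e bB.
pose N : R := `|a| + `|b| + `|c| + `|e|.
have QN : orect a b c e `<=` box N.
  move=> w [] /=; rewrite !in_itv/= => /andP[h1 h2] /andP[h3 h4].
  have na := normr_ge0 a; have nb := normr_ge0 b; have nc := normr_ge0 c; have ne := normr_ge0 e.
  have la := ler_norm (- a); have lb := ler_norm b; have lc := ler_norm (- c); have le := ler_norm e.
  rewrite normrN in la; rewrite normrN in lc.
  by split; rewrite ler_norml; apply/andP; split; rewrite /N; lra.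
pose F n w := al n w.1 * be n w.2.
have F0 n w : ~ orect a b c e w -> F n w = 0.
  by move=> /not_andP[] /negP h; rewrite /F ?(al0 _ _ h) ?(be0 _ _ h) ?mul0r ?mulr0.
have cF n := C1_prod (dal n) (cal n) (dbe n) (cbe n).
have sF n : supported_in (F n) N by move=> w wN; apply: F0 => /QN.
have F01 n w : 0 <= F n w <= 1.
  have /andP[? ?] := al01 n w.1; have /andP[? ?] := be01 n w.2.
  by rewrite mulr_ge0// mulr_ile1.
have lF n : loc_bounded (F n) by have [] := C1_loc_bounded (cF n).
have ldF n : loc_bounded (fun w => d w * F n w) by exact: loc_boundedM.
have sdF n : supported_in (fun w => d w * F n w) N by move=> w wN; rewrite sF// mulr0.
have I0 n : (\int[mu0]_w (d w * F n w)%:E = 0)%E.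
  have := ann _ _ _ (cF n) (ex_intro _ N (sF n)) (fun w => (andP (F01 n w)).1) (F0 n).
  rewrite /Rintegral => /eqP; rewrite fine_eq0; first by move=> /eqP.
  exact: (integrable_fin_num measurableT (supported_integrable (ldF n) (sdF n))).
pose E : set P := orect a b c e `&` (A `*` B).
have mE : measurable E by apply: measurableI; [exact: measurable_rect|exact: measurableX].
have lim w : (d w * F n w)%:E @[n --> \oo] --> ((fun w => (d w)%:E) \_ E) w.
  rewrite patchE [X in _ --> X](_ : _ =
    (d w * (\1_(A `&` `]a, b[) w.1 * \1_(B `&` `]c, e[) w.2))%:E).
    by apply: cvg_EFin; [exact: nearW|apply: cvgMr; apply: cvgM].
  rewrite !indicE -natrM mulnb.
  have -> : (w.1 \in A `&` `]a, b[) && (w.2 \in B `&` `]c, e[) = (w \in E).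
    apply/andP/idP; rewrite !inE /E /setI /setX /orect /=.
      by move=> [[? ?] [? ?]].
    by move=> [[? ?] [? ?]].
  by case: (w \in E); rewrite ?mulr1 ?mulr0.
have [K dK] := bd.2 N.
have K0 : 0 <= `|K| by exact: normr_ge0.
pose G w : \bar R := (`|K| * \1_(box N) w)%:E.
have mbox := @measurable_box R N.
have iG : mu0.-integrable setT G.
  have := loc_bounded_integrable_box N (loc_bounded_cst `|K|).
  move=> /(iffLR (integrable_mkcond _ mbox)); apply: eq_integrable => // w _.
  by rewrite patchE /G indicE; case: ifP; rewrite ?mulr1 ?mulr0.
have domin n w : (`|(d w * F n w)%:E| <= G w)%E.
  rewrite /G lee_fin indicE; have [wN|wN] := boolP (w \in box N).
    rewrite mulr1 normrM; have /andP[f0 f1] := F01 n w.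
    rewrite (ger0_norm f0) (le_trans _ (ler_norm K))// -[leRHS]mulr1.
    rewrite ler_pM// dK//; exact: set_mem.
  by rewrite sdF ?normr0 ?mulr0// => /mem_set; exact/negP.
have cv := @dominated_cvg _ _ _ mu0 setT measurableT (fun n w => (d w * F n w)%:E) _ G
  (fun n => (iffRL (measurable_EFinP _ _)) (ldF n).1) (fun w _ => lim w)
  (fun w _ => isT) iG (fun n w _ => domin n w).
rewrite [LHS]integral_mkcond -/E; apply: (@cvg_unique _ (@ereal_hausdorff R)) cv _.
rewrite (_ : (fun n => _) = fun=> 0%E); first exact: cvg_cst.
by apply/funext => n; exact: I0.
Qed.

(** The sets whose preimage in [Z] has zero integral form a Dynkin system. The map [pr] is a
    parameter because the argument is run for each coordinate and for the identity. *)
Lemma integral_dynkin d0 (T : measurableType d0) (G : set (set T)) (pr : P -> T)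
    (d : V0 R -> R) (Z : set P) :
  measurable Z -> mu0.-integrable Z (EFin \o d) ->
  measurable_fun [set: P] pr -> @measurable _ T = <<s G >> -> setI_closed G ->
  (\int[mu0]_(w in Z) (d w)%:E = 0)%E ->
  (forall A, G A -> (\int[mu0]_(w in Z `&` pr @^-1` A) (d w)%:E = 0)%E) ->
  forall A, measurable A -> (\int[mu0]_(w in Z `&` pr @^-1` A) (d w)%:E = 0)%E.
Proof.
move=> mZ iZ mpr GE GI Z0 GA A; rewrite GE.
have mpre B : measurable B -> measurable (Z `&` pr @^-1` B).
  by move=> mB; apply: measurableI => //; rewrite -[_ @^-1` _]setTI; exact: mpr.
have iS (B : set P) : measurable B -> B `<=` Z -> mu0.-integrable B (EFin \o d).
  by move=> mB BZ; exact: integrableS iZ.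
apply: (@dynkin_induction _ T G
  (fun S => (\int[mu0]_(w in Z `&` pr @^-1` S) (d w)%:E = 0)%E) GE GI) => //.
- by rewrite preimage_setT setIT.
- move=> S mS S0.
  have : (\int[mu0]_(w in (Z `&` pr @^-1` S) `|` (Z `&` pr @^-1` ~` S)) (d w)%:E = 0)%E.
    by rewrite -setIUr -preimage_setU setUv preimage_setT setIT.
  rewrite integral_setU//=.
  + by rewrite S0 add0e.
  + exact: mpre.
  + by apply: mpre; exact: measurableC.
  + apply: measurable_funS (measurable_int mu0 iZ) => //.
    by move=> w [] [].
  + apply/disj_setPS => w [] [_ /= h] [_]; exact.
- move=> F mF tF F0.
  rewrite preimage_bigcup setI_bigcupr integral_bigcup//.
  + by rewrite eseries0// => i _ _; exact: F0.
  + apply/trivIsetP => i j _ _ ij; rewrite -subset0 => w [[_ /= wi] [_ /= wj]].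
    by move/trivIsetP : tF => /(_ i j I I ij); rewrite -subset0; apply; split; [exact: wi|exact: wj].
  + by move=> k; exact: mpre.
  + apply: iS; first by apply: bigcupT_measurable => k; exact: mpre.
    by move=> w [k _ []].
Qed.

(** Tests give zero integrals over products of half-open intervals. One coordinate at a time, these
    are enlarged to products of Borel sets, and then to all measurable subsets of the rectangle; a
    function with zero integral over all of them vanishes almost everywhere. *)
Lemma annihilates_ae0 (d : V0 R -> R) (a b c e : R) :
  loc_bounded d -> annihilates_tests d (orect a b c e) ->
  ae_eq mu0 (orect a b c e : set P) (EFin \o d) (cst 0%E).
Proof.
move=> bd ann; set Q := orect a b c e.
have mQ : measurable (Q : set P) by exact: measurable_rect.
have iQ : mu0.-integrable Q (EFin \o d).
  apply: (@integrableS _ _ _ _ (box (`|a| + `|b| + `|c| + `|e|) : set P)) => //.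
  - exact: measurable_box.
  - move=> w [] /=; rewrite !in_itv/= => /andP[h1 h2] /andP[h3 h4].
    have na := normr_ge0 a; have nb := normr_ge0 b; have nc := normr_ge0 c; have ne := normr_ge0 e.
    have la := ler_norm (- a); have lb := ler_norm b; have lc := ler_norm (- c); have le := ler_norm e.
    rewrite normrN in la; rewrite normrN in lc.
    by split; rewrite ler_norml; apply/andP; split; lra.
  - exact: loc_bounded_integrable_box.
have TT : measurable ([set: R] : set (measurableTypeR R)) := measurableT.
have oc (x y : R) : measurable (`]x, y]%classic : set (measurableTypeR R)) by exact: measurable_itv.
have QTT : (\int[mu0]_(w in Q) (d w)%:E = 0)%E.
  by have := annihilates_rect bd ann smooth_approxT smooth_approxT TT TT; rewrite setXTT setIT.
have mR : @measurable _ (measurableTypeR R) = <<s @ocitv R >> by [].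
have mfst A : measurable A -> measurable (Q `&` fst @^-1` A : set P).
  by move=> mA; apply: measurableI => //; rewrite -[_ @^-1` _]setTI; exact: measurable_fst.
have msnd A : measurable A -> measurable (Q `&` snd @^-1` A : set P).
  by move=> mA; apply: measurableI => //; rewrite -[_ @^-1` _]setTI; exact: measurable_snd.
have QA A : measurable A -> (\int[mu0]_(w in Q `&` fst @^-1` A) (d w)%:E = 0)%E.
  apply: (integral_dynkin (T := measurableTypeR R) mQ iQ (@measurable_fst _ _ _ _) mR (@ocitvI R) QTT).
  move=> _ [[x y] _ <-]; have [al alA] := smooth_approx_oc x y.
  by have := annihilates_rect bd ann alA smooth_approxT (oc x y) TT; rewrite setXT.
have QAJ A x y : measurable A ->
    (\int[mu0]_(w in Q `&` snd @^-1` `]x, y] `&` fst @^-1` A) (d w)%:E = 0)%E.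
  have [be beJ] := smooth_approx_oc x y.
  have iJ : mu0.-integrable (Q `&` snd @^-1` `]x, y]) (EFin \o d).
    by apply: integrableS iQ => //; exact: (msnd _ (oc x y)).
  apply: (integral_dynkin (T := measurableTypeR R) (msnd _ (oc x y)) iJ (@measurable_fst _ _ _ _) mR (@ocitvI R)).
    by have := annihilates_rect bd ann smooth_approxT beJ TT (oc x y); rewrite setTX.
  move=> _ [[x' y'] _ <-]; have [al alA] := smooth_approx_oc x' y'.
  have := annihilates_rect bd ann alA beJ (oc x' y') (oc x y).
  rewrite (_ : Q `&` (_ `*` _) = Q `&` snd @^-1` `]x, y] `&` fst @^-1` `]x', y'])//.
  by rewrite -setIA; congr (_ `&` _); apply/seteqP; split => w [].
have QAB A B : measurable A -> measurable B ->
    (\int[mu0]_(w in Q `&` (A `*` B)) (d w)%:E = 0)%E.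
  move=> mA mB.
  have iA : mu0.-integrable (Q `&` fst @^-1` A) (EFin \o d).
    by apply: integrableS iQ => //; exact: mfst.
  rewrite -[A `*` B]/(fst @^-1` A `&` snd @^-1` B) setIA.
  apply: (integral_dynkin (T := measurableTypeR R) (mfst _ mA) iA (@measurable_snd _ _ _ _) mR (@ocitvI R)) mB.
    exact: QA.
  by move=> _ [[x y] _ <-]; rewrite setIAC; exact: QAJ.
have QE (E : set P) : measurable E -> (\int[mu0]_(w in Q `&` E) (d w)%:E = 0)%E.
  apply: (@integral_dynkin _ P _ id d Q mQ iQ (@measurable_id _ _ _)
    (@measurable_prod_measurableType _ _ _ _) _ QTT).
    move=> _ _ [A mA [B mB <-]] [A' mA' [B' mB' <-]].
    by exists (A `&` A'); [exact: measurableI|exists (B `&` B'); [exact: measurableI|rewrite setXI]].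
  by move=> _ [A mA [B mB <-]]; exact: QAB.
apply: integral_ae_eq => //.
move=> E EQ mE; rewrite integral0.
by have := QE E mE; rewrite setIidr.
Qed.

End Localization.

(** * Locality of the gradient, and cutoff functions *)

Section Comparison.
Context {R : realType}.
Notation P := (measurableTypeR R * measurableTypeR R)%type.
Notation mu0 := (@mu0 R).
Implicit Types (F f g h : V0 R -> R) (w : V0 R).

Lemma derive_at_min0 (F F' : R -> R) (x : R) : (forall t, F x <= F t) ->
  (forall t, is_derive t (1 : R) F (F' t)) -> F' x = 0.
Proof.
move=> Fx dF.
have xx : x \in `]x - 1, x + 1[ by rewrite in_itv/=; apply/andP; split; lra.
have xle : x - 1 <= x + 1 by lra.
have d0 := derive1_at_min xle (fun t _ => @ex_derive _ _ _ _ _ _ _ (dF t)) xx (fun t _ => Fx t).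
by rewrite -(@derive_val _ _ _ _ _ _ _ (dF x)) (@derive_val _ _ _ _ _ _ _ d0).
Qed.

Lemma C1_at_min F Fx Fz w : C1 F Fx Fz -> (forall v, F w <= F v) -> Fx w = 0 /\ Fz w = 0.
Proof.
case: w => x z cF Fw; split.
- exact: (@derive_at_min0 (fun t => F (t, z)) (fun t => Fx (t, z)) x (fun t => Fw _) (fun t => C1_dx cF (t, z))).
- exact: (@derive_at_min0 (fun t => F (x, t)) (fun t => Fz (x, t)) z (fun t => Fw _) (fun t => C1_dz cF (x, t))).
Qed.

Lemma bounded_gradient_loc_bounded g h H : bounded_gradient g h H -> loc_bounded h.
Proof. by case=> mh hH _; split=> // N; exists H => v _; exact: hH. Qed.

(* At a zero of a nonnegative test function its derivatives vanish, so a test supported in a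
   rectangle off [Z] does not distinguish [f] from [g]. *)
Lemma bounded_gradients_agree f g h0 h H0 H (Z : set (V0 R)) : continuous f -> continuous g ->
  bounded_gradient f h0 H0 -> bounded_gradient g h H -> closed Z ->
  (forall w, ~ Z w -> f w = g w) -> ae_eq mu0 (~` Z : set P) (EFin \o h) (EFin \o h0).
Proof.
move=> cf cg gf gg cZ fgZ.
have lh := bounded_gradient_loc_bounded gg.
have lh0 := bounded_gradient_loc_bounded gf.
have [a [b [c [e cov]]]] := open_rational_cover (closed_openC cZ).
have agree n : ae_eq mu0 (orect (a n) (b n) (c n) (e n) : set P)
    (EFin \o (fun w => h w + - h0 w)) (cst 0%E).
  apply: annihilates_ae0; first by apply: loc_boundedD => //; exact: loc_boundedN.
  move=> F Fx Fz cF sF F0 Foff.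
  have [lF _ _] := C1_loc_bounded cF.
  have si k : loc_bounded k -> mu0.-integrable setT (EFin \o (fun w => k w * F w)).
    move=> lk; apply: loc_bounded_integrable; first exact: loc_boundedM.
    by have [M FM] := sF; exists M => w wM; rewrite FM// mulr0.
  under eq_Rintegral do rewrite mulrDl mulNr.
  rewrite RintegralB//; [|exact: si..].
  have [_ _ /(_ _ _ _ cF sF) ->] := gg; have [_ _ /(_ _ _ _ cF sF) ->] := gf.
  apply/eqP; rewrite subr_eq0; apply/eqP; apply: eq_Rintegral => w _.
  have [wQ|wQ] := pselect (orect (a n) (b n) (c n) (e n) w).
    by rewrite fgZ// => Zw; have : (~` Z) w by rewrite cov; exists n.
  have [-> ->] : Fx w = 0 /\ Fz w = 0.
    by apply: C1_at_min cF _ => v; rewrite Foff.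
  by rewrite !mulr0.
have /ae_foralln : forall n, {ae mu0, forall w : P, orect (a n) (b n) (c n) (e n) w ->
    (EFin \o (fun w => h w + - h0 w)) w = cst 0%E w} := agree.
rewrite /ae_eq; apply: filterS => w Hw; rewrite cov => -[n _ wn].
by have [] := Hw n wn; move=> /eqP; rewrite subr_eq0 => /eqP /= ->.
Qed.

(** The inner squares bring the plateau down beyond [M] on either side; the outer [pos _ ^ 2]
    truncates at zero while keeping a continuous derivative. *)
Definition cutoff1 (M t : R) : R := pos (1 - pos (t - M) ^+ 2 - pos (- t - M) ^+ 2) ^+ 2.

Definition cutoff1' (M t : R) : R := 2 * pos (1 - pos (t - M) ^+ 2 - pos (- t - M) ^+ 2) *
  (- (2 * pos (t - M)) + 2 * pos (- t - M)).

Lemma is_derive_cutoff1 (M t : R) : is_derive t (1 : R) (cutoff1 M) (cutoff1' M t).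
Proof.
have dpos (sg : R) : is_derive t (1 : R) (fun t => pos (sg * t - M) ^+ 2) (sg * (2 * pos (sg * t - M))).
  have dl : is_derive t (1 : R) (fun t => sg * t - M) sg.
    apply: (is_derive_eq (is_deriveB (is_deriveZ sg (is_derive_id t 1)) (is_derive_cst M t 1))).
    by rewrite subr0 [_ *: _]mulr1.
  apply: (is_derive_eq (@is_derive1_comp _ (fun s => pos s ^+ 2) (fun t => sg * t - M) t _ _
    (is_derive_possq _) dl)).
  by rewrite mulrC.
have d1 := dpos 1; have d2 := dpos (-1).
have dI : is_derive t (1 : R) (fun t => 1 - pos (t - M) ^+ 2 - pos (- t - M) ^+ 2)
    (- (2 * pos (t - M)) + 2 * pos (- t - M)).
  move: d1 d2; under eq_fun do rewrite mul1r; under [X in _ -> is_derive _ _ X _ -> _]eq_fun do rewrite mulN1r.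
  move=> d1 d2; apply: (is_derive_eq (is_deriveB (is_deriveB (is_derive_cst (1 : R) t 1) d1) d2)).
  by rewrite !mul1r !mulN1r sub0r opprK.
apply: (is_derive_eq (@is_derive1_comp _ (fun s => pos s ^+ 2)
  (fun t => 1 - pos (t - M) ^+ 2 - pos (- t - M) ^+ 2) t _ _ (is_derive_possq _) dI)).
by rewrite /cutoff1' mulrC.
Qed.

Lemma continuous_cutoff1' (M : R) : continuous (cutoff1' M).
Proof.
have cl (sg : R) : continuous (fun t : R => pos (sg * t - M)).
  move=> t; apply: (@continuous_comp _ _ _ (fun t => sg * t - M) pos); last exact: continuous_pos.
  by apply: cvgB; [apply: cvgM; [exact: cvg_cst|exact: cvg_id]|exact: cvg_cst].
have c1 : continuous (fun t : R => pos (t - M)).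
  by have := cl 1; under [X in continuous X -> _]eq_fun do rewrite mul1r.
have c2 : continuous (fun t : R => pos (- t - M)).
  by have := cl (-1); under [X in continuous X -> _]eq_fun do rewrite mulN1r.
have sq (k : R -> R) : continuous k -> continuous (fun t => k t ^+ 2).
  by move=> ck t; exact: (cvgM (ck t) (ck t)).
have c4 : continuous (fun t : R => 1 - pos (t - M) ^+ 2 - pos (- t - M) ^+ 2).
  move=> t; apply: cvgB; last exact: (sq _ c2).
  by apply: cvgB; [exact: cvg_cst|exact: (sq _ c1)].
have c3 : continuous (fun t : R => pos (1 - pos (t - M) ^+ 2 - pos (- t - M) ^+ 2)).
  by move=> t; apply: (@continuous_comp _ _ _ (fun t => 1 - pos (t - M) ^+ 2 - pos (- t - M) ^+ 2) pos); [exact: c4|exact: continuous_pos].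
move=> t; apply: cvgM.
  by apply: cvgM; [exact: cvg_cst|exact: c3].
apply: cvgD; last by apply: cvgM; [exact: cvg_cst|exact: c2].
by apply: cvgN; apply: cvgM; [exact: cvg_cst|exact: c1].
Qed.

Lemma cutoff1_in (M t : R) : `|t| <= M -> cutoff1 M t = 1 /\ cutoff1' M t = 0.
Proof.
rewrite ler_norml => /andP[t1 t2].
have p0 (s : R) : s <= 0 -> pos s = 0 by move=> s0; rewrite /pos; apply/max_idPl.
rewrite /cutoff1 /cutoff1' !(p0 (t - M)) ?(p0 (- t - M)); [|lra..].
rewrite !expr0n/= !subr0 (_ : pos 1 = 1) ?expr1n; last by rewrite /pos; apply/max_idPr.
by split=> //; ring.
Qed.

Lemma cutoff1_out (M t : R) : M + 1 < `|t| -> cutoff1 M t = 0.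
Proof.
move=> tM; suff : pos (1 - pos (t - M) ^+ 2 - pos (- t - M) ^+ 2) = 0.
  by rewrite /cutoff1 => ->; rewrite expr0n.
rewrite {1}/pos; apply/max_idPl.
have := sqr_ge0 (pos (t - M)); have := sqr_ge0 (pos (- t - M)).
by move: tM; rewrite ltr_normr => /orP[tM|tM];
  [case: (posP (t - M)) => -[? ->]|case: (posP (- t - M)) => -[? ->]]; nra.
Qed.

Lemma exists_cutoff (M : R) : exists chi chix chiz : V0 R -> R,
  [/\ C1 chi chix chiz, cpt_supported chi &
      forall w, box M w -> [/\ chi w = 1, chix w = 0 & chiz w = 0]].
Proof.
have dc := @is_derive_cutoff1 M; have cc := @continuous_cutoff1' M.
exists (fun w => cutoff1 M w.1 * cutoff1 M w.2), (fun w => cutoff1' M w.1 * cutoff1 M w.2),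
  (fun w => cutoff1 M w.1 * cutoff1' M w.2); split.
- exact: (C1_prod dc cc dc cc).
- by exists (M + 1) => w /notin_box[]/cutoff1_out ->; rewrite ?mul0r ?mulr0.
- move=> w [/cutoff1_in[-> ->] /cutoff1_in[-> ->]].
  by rewrite !(mul1r, mulr0, mul0r).
Qed.

End Comparison.

(** * The calibration inequality *)

Section TotalMass.
Context {R : realType}.
Notation P := (measurableTypeR R * measurableTypeR R)%type.
Notation mu0 := (@mu0 R).
Implicit Types (F f g h : V0 R -> R) (w : V0 R).

Lemma Rintegral_agree_off F G (T : set (V0 R)) : measurable (T : set P) ->
  loc_bounded F -> cpt_supported F -> loc_bounded G -> cpt_supported G ->
  ae_eq mu0 (~` T : set P) (EFin \o F) (EFin \o G) -> \int[mu0]_w F w = \int[mu0]_w G w ->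
  \int[mu0]_(w in T) F w = \int[mu0]_(w in T) G w.
Proof.
move=> mT lF sF lG sG FG.
have split_int F' : loc_bounded F' -> cpt_supported F' ->
    \int[mu0]_w F' w = \int[mu0]_(w in T) F' w + \int[mu0]_(w in ~` T) F' w.
  move=> lF' sF'; rewrite -Rintegral_setU ?setUv//; first exact: measurableC.
  - exact: loc_bounded_integrable.
  - by apply/disj_setPS; rewrite setICr.
rewrite !split_int// (_ : \int[mu0]_(w in ~` T) F w = \int[mu0]_(w in ~` T) G w) => [/addIr//|].
congr fine; apply: ae_eq_integral => //; first exact: measurableC.
  by apply/measurable_EFinP; apply: measurable_funTS; case: lF.
by apply/measurable_EFinP; apply: measurable_funTS; case: lG.
Qed.

Lemma chain_rule_agree f g h0 H0 h H (s s' p q : R -> R) (T : set (V0 R)) (M : R) :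
  continuous f -> continuous g ->
  (forall M, exists2 K, 0 <= K & half_hoelder f M K) ->
  (forall M, exists2 K, 0 <= K & half_hoelder g M K) ->
  bounded_gradient f h0 H0 -> bounded_gradient g h H ->
  (forall t, is_derive t (1 : R) s (s' t)) -> continuous s' ->
  (forall t, is_derive t (1 : R) p (t * s' t)) ->
  (forall t, is_derive t (1 : R) q (t ^+ 2 / 2 * s' t)) ->
  closed T -> T `<=` box M -> (forall w, ~ T w -> f w = g w) ->
  \int[mu0]_(w in T) (h w * s (g w)) = \int[mu0]_(w in T) (h0 w * s (f w)).
Proof.
move=> cf cg hf hg gf gg ds cs' dp dq cT TM fgT.
have [chi [chix [chiz [cchi schi chiM]]]] := exists_cutoff M.
have mT := closed_measurable2 cT.
have cs := is_derive_continuous ds.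
have [lchi _ _] := C1_loc_bounded cchi.
have E (k k' : V0 R -> R) : continuous k -> loc_bounded k' -> loc_bounded (fun w => k' w * (s (k w) * chi w)) /\
    cpt_supported (fun w => k' w * (s (k w) * chi w)).
  move=> ck lk'; split; last by have [N chiN] := schi; exists N => w wN; rewrite chiN// !mulr0.
  apply: loc_boundedM => //; apply: loc_boundedM => //; apply: loc_bounded_comp => //.
  exact: continuous_loc_bounded.
have [E1 E2] := E _ _ cg (bounded_gradient_loc_bounded gg).
have [E3 E4] := E _ _ cf (bounded_gradient_loc_bounded gf).
have rm k k' : \int[mu0]_(w in T) (k' w * s (k w)) = \int[mu0]_(w in T) (k' w * (s (k w) * chi w)).
  apply: eq_Rintegral => w wT.
  by have [|-> _ _] := chiM w; [exact/TM/set_mem|rewrite mulr1].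
rewrite !rm; apply: Rintegral_agree_off => //.
  apply: filterS (bounded_gradients_agree cf cg gf gg cT fgT) => w hh wT.
  by have /= [->] := hh wT; rewrite fgT.
rewrite (chain_rule cg hg gg ds cs' dp dq cchi schi) (chain_rule cf hf gf ds cs' dp dq cchi schi).
apply: eq_Rintegral => w _; have [wT|wT] := pselect (T w); last by rewrite fgT.
by have [_ -> ->] := chiM w (TM w wT); rewrite !mulr0.
Qed.

Lemma cvg_atan_mul (t : R) : atan (n.+1%:R * t) @[n --> \oo] --> (pi / 2 * Num.sg t : R).
Proof.
have pos_case (u : R) : 0 < u -> atan (n.+1%:R * u) @[n --> \oo] --> (pi / 2 : R).
  move=> u0.
  have : n.+1%:R * u @[n --> \oo] --> +oo.
    apply/cvgryPge => A; near=> n; rewrite -ler_pdivrMr//.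
    rewrite (@le_trans _ _ n%:R)//; last by rewrite ler_nat.
    by near: n; exact: nbhs_infty_ger.
  by move=> /cvg_comp; apply; exact: cvgy_atan.
have [t0|t0|->] := ltrgt0P t.
- by rewrite gtr0_sg// mulr1; exact: pos_case.
- rewrite ltr0_sg// mulrN1 -[t]opprK; under eq_fun do rewrite mulrN atanN.
  by apply: cvgN; apply: pos_case; rewrite oppr_gt0.
- by rewrite sgr0 mulr0; under eq_fun do rewrite mulr0 atan0; exact: cvg_cst.
Unshelve. all: by end_near. Qed.

Section AtanFamily.
Variable N : R.
Hypothesis N0 : 0 < N.

Definition atan_scaled' (t : R) : R := N / (1 + (N * t) ^+ 2).

Let den (t : R) : 0 < 1 + (N * t) ^+ 2.
Proof. by rewrite ltr_wpDr ?sqr_ge0. Qed.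

Let dmul (t : R) : is_derive t (1 : R) (fun t => N * t) N.
Proof. by apply: (is_derive_eq (is_deriveZ N (is_derive_id t 1))); rewrite [_ *: _]mulr1. Qed.

Lemma is_derive_atan_scaled (t : R) : is_derive t (1 : R) (fun t => atan (N * t)) (atan_scaled' t).
Proof.
apply: (is_derive_eq (@is_derive1_comp _ atan (fun t => N * t) t _ _ (is_derive1_atan _) (dmul t))).
by rewrite mulrC.
Qed.

Let dden (t : R) : is_derive t (1 : R) (fun t => 1 + (N * t) ^+ 2) (2 * N ^+ 2 * t).
Proof.
apply: (is_derive_eq (is_deriveD (is_derive_cst (1 : R) t 1) (is_deriveM (dmul t) (dmul t)))).
by rewrite add0r -![_ *: _]/(_ * _); ring.
Qed.

Lemma continuous_atan_scaled' : continuous atan_scaled'.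
Proof.
have cd := is_derive_continuous dden.
move=> t; apply: cvgM; first exact: cvg_cst.
by apply: cvgV; [rewrite gt_eqF|exact: cd].
Qed.

(** For [s = atan (N t)] both auxiliary primitives of the chain rule are elementary: a logarithm
    here, and a linear term minus an arctangent in [is_derive_atan_q]. *)
Lemma is_derive_atan_p (t : R) : is_derive t (1 : R)
  (fun t => (2 * N)^-1 * ln (1 + (N * t) ^+ 2)) (t * atan_scaled' t).
Proof.
apply: (is_derive_eq (is_deriveZ (2 * N)^-1 (@is_derive1_comp _ (@ln R) (fun t => 1 + (N * t) ^+ 2) t _ _
  (is_derive1_ln (den t)) (dden t)))).
rewrite -[_ *: _]/(_ * _) /atan_scaled'.
by field; rewrite !gt_eqF//=.
Qed.

Lemma is_derive_atan_q (t : R) : is_derive t (1 : R)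
  (fun t => (2 * N)^-1 * (t - N^-1 * atan (N * t))) (t ^+ 2 / 2 * atan_scaled' t).
Proof.
apply: (is_derive_eq (is_deriveZ (2 * N)^-1 (is_deriveB (is_derive_id t (1 : R))
  (is_deriveZ N^-1 (is_derive_atan_scaled t))))).
rewrite -![_ *: _]/(_ * _) /atan_scaled'.
by field; rewrite !gt_eqF//=.
Qed.

End AtanFamily.

Lemma loc_bounded_sg f : continuous f -> loc_bounded (fun w => Num.sg (f w)).
Proof.
move=> cf; split=> [|N]; last by exists 1 => w _; rewrite normr_sg lern1; case: eqP.
apply: measurableT_comp; last exact: continuous_measurable_fun2.
apply: nondecreasing_measurable => // x y xy.
have [x0|x0|x0] := ltrgt0P x; last by rewrite x0 sgr0 sgr_ge0 -x0.
- by rewrite !gtr0_sg// (lt_le_trans x0).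
- by rewrite ltr0_sg//; have [] := ltrgt0P y => [/gtr0_sg|/ltr0_sg|] ->; rewrite ?sgr0//; lra.
Qed.

(** The limit in [n] is taken only on the side of [f], by dominated convergence. On the side of [g]
    the bound [|atan| <= pi / 2] is applied for each [n], and the factor [pi / 2] cancels at the
    end. *)
Lemma sign_mass_le f g h0 H0 h H (T : set (V0 R)) (M : R) : continuous f -> continuous g ->
  (forall M, exists2 K, 0 <= K & half_hoelder f M K) ->
  (forall M, exists2 K, 0 <= K & half_hoelder g M K) ->
  bounded_gradient f h0 H0 -> bounded_gradient g h H ->
  closed T -> T `<=` box M -> (forall w, ~ T w -> f w = g w) ->
  `|\int[mu0]_(w in T) (h0 w * Num.sg (f w))| <= \int[mu0]_(w in T) `|h w|.
Proof.
move=> cf cg hf hg gf gg cT TM fgT.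
have mT := closed_measurable2 cT.
have iT k : loc_bounded k -> mu0.-integrable (T : set P) (EFin \o k).
  move=> lk; apply: (@integrableS _ _ _ _ (box M : set P)) => //; first exact: measurable_box.
  exact: loc_bounded_integrable_box.
have lh := bounded_gradient_loc_bounded gg.
have lh0 := bounded_gradient_loc_bounded gf.
have lnh : loc_bounded (fun w => `|h w|).
  by apply: (loc_bounded_comp (s := Num.norm) _ lh); exact: norm_continuous.
have latan (k : V0 R -> R) n : continuous k -> loc_bounded (fun w => atan (n.+1%:R * k w)).
  move=> ck; apply: (loc_bounded_comp (s := atan)); first exact: continuous_atan.
  by apply: loc_boundedM; [exact: loc_bounded_cst|exact: continuous_loc_bounded].
have pi2 : 0 < pi / 2 :> R by rewrite divr_gt0// pi_gt0.
have bnd n : `|\int[mu0]_(w in T) (h0 w * atan (n.+1%:R * f w))| <= pi / 2 * \int[mu0]_(w in T) `|h w|.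
  have n0 : 0 < n.+1%:R :> R by [].
  rewrite -(chain_rule_agree cf cg hf hg gf gg (@is_derive_atan_scaled n.+1%:R)
    (@continuous_atan_scaled' n.+1%:R) (is_derive_atan_p n0) (is_derive_atan_q n0) cT TM fgT).
  apply: le_trans (le_normr_Rintegral mT _) _; first by apply: iT; apply: loc_boundedM lh (latan _ _ cg).
  rewrite -RintegralZl//; last exact: iT.
  apply: le_Rintegral => //.
  - apply: iT; apply: (loc_bounded_comp (s := Num.norm)); first exact: norm_continuous.
    by apply: loc_boundedM lh (latan _ _ cg).
  - by apply: iT; apply: loc_boundedM => //; exact: loc_bounded_cst.
  - move=> w _; rewrite normrM mulrC ler_wpM2r// ler_norml.
    by rewrite (ltW (atan_gtNpi2 _)) (ltW (atan_ltpi2 _)).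
have cv : (\int[mu0]_(w in T) (h0 w * atan (n.+1%:R * f w))%:E)%E @[n --> \oo] -->
    (\int[mu0]_(w in T) (pi / 2 * (h0 w * Num.sg (f w)))%:E)%E.
  apply: (@dominated_cvg _ _ _ mu0 T mT (fun n w => (h0 w * atan (n.+1%:R * f w))%:E)
    (fun w => (pi / 2 * (h0 w * Num.sg (f w)))%:E) (fun w => (pi / 2 * `|h0 w|)%:E)) => //.
  - by move=> n; apply/measurable_EFinP; apply: measurable_funTS; case: (loc_boundedM lh0 (latan _ n cf)).
  - move=> w _; apply: cvg_EFin; first by apply: nearW.
    rewrite mulrCA; apply: cvgM; [exact: cvg_cst|exact: cvg_atan_mul].
  - apply: iT; apply: loc_boundedM; first exact: loc_bounded_cst.
    by apply: (loc_bounded_comp (s := Num.norm)) => //; exact: norm_continuous.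
  - move=> n w _; rewrite lee_fin normrM mulrC ler_wpM2r// ler_norml.
    by rewrite (ltW (atan_gtNpi2 _)) (ltW (atan_ltpi2 _)).
have lsg := loc_boundedM lh0 (loc_bounded_sg cf).
have isg := iT _ lsg.
have cvR : \int[mu0]_(w in T) (h0 w * atan (n.+1%:R * f w)) @[n --> \oo] -->
    (pi / 2 * \int[mu0]_(w in T) (h0 w * Num.sg (f w)) : R).
  rewrite -RintegralZl//; apply: fine_cvg; rewrite fineK//.
  apply: integrable_fin_num => //.
  by apply: iT; apply: loc_boundedM => //; exact: loc_bounded_cst.
rewrite -(ler_pM2l pi2) -{1}(gtr0_norm pi2) -normrM.
rewrite -(cvg_lim _ (cvg_norm cvR))//; apply: limr_le; first by apply: cvgP; exact: cvg_norm cvR.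
by apply: nearW => n; exact: bnd.
Qed.

End TotalMass.

(** * Bounded representatives, and the gradient of [f_a] *)

Section Representatives.
Context {R : realType}.
Notation mu := (@lebesgue_measure R).
Notation P := (measurableTypeR R * measurableTypeR R)%type.
Notation mu0 := (@mu0 R).
Implicit Types (F f g h : V0 R -> R) (w : V0 R).

Lemma mu0T_gt0 : (0 < mu0 [set: P])%E.
Proof.
rewrite (@lt_le_trans _ _ (mu0 (box 1)))//; first by rewrite mu0_box// lte_fin exprn_gt0// mulr_gt0.
by apply: le_measure => //; rewrite inE; [exact: measurable_box|exact: measurableT].
Qed.

Lemma bounded_Lfun h (H : R) : measurable_fun [set: P] h -> (forall w, `|h w| <= H) ->
  (h : P -> R) \in Lfun mu0 +oo%E.
Proof.
move=> mh hH; apply/andP; split; first by rewrite inE.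
rewrite inE /= /finite_norm unlock /Lnorm mu0T_gt0 (@le_lt_trans _ _ H%:E)// ?ltry//.
by apply/ess_supP; apply: nearW => w /=; rewrite lee_fin.
Qed.

Lemma Lfun_bounded h : (h : P -> R) \in Lfun mu0 +oo%E -> exists H h',
  [/\ measurable_fun [set: P] h, measurable_fun [set: P] h', forall w, `|h' w| <= H &
      {ae mu0, forall w : P, h' w = h w}].
Proof.
move=> /andP[]; rewrite inE => mh.
rewrite inE /= /finite_norm unlock /Lnorm mu0T_gt0 => sh.
have sh0 : (0 <= ess_sup mu0 (abse \o (EFin \o h)))%E.
  by apply: ess_sup_gee; [exact: mu0T_gt0|apply: nearW => w; exact: abse_ge0].
have sfin : ess_sup mu0 (abse \o (EFin \o h)) \is a fin_num by rewrite ge0_fin_numE.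
exists (fine (ess_sup mu0 (abse \o (EFin \o h)))).
exists (fun w => if `|h w| <= fine (ess_sup mu0 (abse \o (EFin \o h))) then h w else 0).
have mT : measurable_fun [set: P] h := mh.
split => //.
- apply: measurable_fun_ifT => //.
  apply: measurable_fun_ler; last exact: measurable_cst.
  by apply: measurableT_comp mT.
- by move=> w; case: ifP => //; rewrite normr0 fine_ge0.
- apply: filterS (ess_sup_ge mu0 (abse \o (EFin \o h))) => w.
  by rewrite -{1}(fineK sfin) /= lee_fin => ->.
Qed.

Lemma intrinsic_gradient_bounded g h : is_intrinsic_gradient g h -> exists H h',
  bounded_gradient g h' H /\ {ae mu0, forall w : P, h' w = h w} /\ measurable_fun [set: P] h.
Proof.
move=> [/Lfun_bounded[H [h' [mh mh' hH hh']]] weak]; exists H, h'; split=> //; split=> //.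
move=> F Fx Fz cF sF; have [C1F dxF dzF] := C1_C1c cF sF.
have [lF _ _] := C1_loc_bounded cF.
have := weak _ C1F; rewrite dxF dzF => <-.
congr fine; apply: ae_eq_integral => //.
- by apply/measurable_EFinP; apply: measurable_funM => //; case: lF.
- by apply/measurable_EFinP; apply: measurable_funM => //; case: lF.
- by apply: filterS hh' => w + _ => ->.
Qed.

Lemma bounded_gradient_intrinsic g h H : bounded_gradient g h H -> is_intrinsic_gradient g h.
Proof.
move=> [mh hH weak]; split; first exact: bounded_Lfun hH.
by move=> psi /C1c_C1[C1psi spsi]; exact: weak.
Qed.

(** On the line [z = 0] the value is [a ^ 2 / 2] and not 0, so that the square is constant
    everywhere and not only almost everywhere. *)
Definition grad_f_a (a : R) w : R := if 0 < w.2 then - (a ^+ 2 / 2) else a ^+ 2 / 2.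

Lemma grad_f_a_sqr a w : grad_f_a a w ^+ 2 = (a ^+ 2 / 2) ^+ 2.
Proof. by rewrite /grad_f_a; case: ifP; rewrite ?sqrrN. Qed.

Lemma f_a_sqr a w : f_a a w ^+ 2 = a ^+ 2 * `|w.2|.
Proof.
rewrite -(real_normK (num_real (f_a a w))) /f_a !normrM normrN (ger0_norm (sqrtr_ge0 _)) normr_sg.
rewrite !exprMn real_normK ?num_real// sqr_sqrtr// -mulrA; congr (_ * _).
by have [->|w0] := eqVneq w.2 0; rewrite ?normr0 ?mul0r// expr1n mulr1.
Qed.

(** [f_a] is constant along [x], so the term in [F_x] integrates to zero on horizontal slices. On a
    vertical slice [f_a ^ 2 / 2] is [a ^ 2 / 2 * |z|], and the difference of the two integrands is a
    constant times [(z F)_z] on each half-line; [z F] vanishes at 0 and at both ends. *)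
Lemma bounded_gradient_f_a (a : R) : a != 0 ->
  bounded_gradient (f_a a) (grad_f_a a) (a ^+ 2 / 2).
Proof.
move=> a0; have cfa := intrinsic_lipschitz_continuous (f_a_intrinsic_lipschitz a0).
have lfa := continuous_loc_bounded cfa.
have a2 : 0 <= a ^+ 2 / 2 by rewrite divr_ge0// sqr_ge0.
have mh : measurable_fun [set: P] (grad_f_a a).
  apply: measurable_fun_ifT; [|exact: measurable_cst..].
  by apply: measurable_fun_ltr; [exact: measurable_cst|exact: measurable_snd].
have hH w : `|grad_f_a a w| <= a ^+ 2 / 2.
  by rewrite /grad_f_a; case: ifP => _; rewrite ?normrN ger0_norm.
have lh : loc_bounded (grad_f_a a) by split => // N; exists (a ^+ 2 / 2).
split => // F Fx Fz cF [M0 FM0].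
pose M := `|M0| + 1.
have M1 : 0 <= M by rewrite addr_ge0.
have NN : - M <= M by lra.
have M0M : M0 < M by rewrite ltr_pwDr// ler_norm.
have FM := supported_in_le (ltW M0M) FM0.
have [FxM FzM] := C1_supported cF FM.
have [lF lFx lFz] := C1_loc_bounded cF.
have int0 F1 : loc_bounded F1 -> supported_in F1 M -> mu0.-integrable setT (EFin \o F1).
  by move=> l1 s1; apply: loc_bounded_integrable => //; exists M.
have lx : loc_bounded (fun w => - f_a a w * Fx w) by apply: loc_boundedM => //; exact: loc_boundedN.
have lz : loc_bounded (fun w => f_a a w ^+ 2 / 2 * Fz w).
  apply: loc_boundedM => //; rewrite /=; apply: loc_boundedM; last exact: loc_bounded_cst.
  by under eq_fun do rewrite expr2; exact: loc_boundedM.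
have sx : supported_in (fun w => - f_a a w * Fx w) M by move=> w wM; rewrite FxM// mulr0.
have sz : supported_in (fun w => f_a a w ^+ 2 / 2 * Fz w) M by move=> w wM; rewrite FzM// mulr0.
rewrite RintegralD//; [|exact: (int0 _ lx sx)|exact: (int0 _ lz sz)].
have -> : \int[mu0]_w (- f_a a w * Fx w) = 0.
  apply: (Rintegral_slices1_eq0 lx sx) => z.
  have dF x : is_derive x (1 : R) (fun x => F (x, z)) (Fx (x, z)) := C1_dx cF (x, z).
  have dfF x : is_derive x (1 : R) (fun x => - f_a a (0, z) * F (x, z)) (- f_a a (0, z) * Fx (x, z)).
    by apply: is_deriveZ; exact: dF.
  have cs : continuous (fun x => - f_a a (0, z) * Fx (x, z)).
    by move=> x; apply: cvgM; [exact: cvg_cst|exact: (continuous_slice1 (C1_contx cF))].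
  rewrite -[LHS]/(\int[mu]_(x in `[- M, M]) (- f_a a (0, z) * Fx (x, z))) (Rintegral_FTC NN dfF cs).
  by rewrite !FM0 ?mulr0 ?subrr// => -[/= + _]; rewrite ?normrN ger0_norm// leNgt M0M.
have lhF : loc_bounded (fun w => grad_f_a a w * F w) by exact: loc_boundedM.
have shF : supported_in (fun w => grad_f_a a w * F w) M by move=> w wM; rewrite FM// mulr0.
rewrite add0r; apply/eqP; rewrite -subr_eq0 -RintegralB//; [|exact: (int0 _ lhF shF)|exact: (int0 _ lz sz)].
apply/eqP/(Rintegral_slices2_eq0 (M := M)) => [||x].
- by apply: loc_boundedD => //; exact: loc_boundedN.
- by move=> w wM; rewrite shF// sz// subrr.
pose k : R := a ^+ 2 / 2.
have dF z : is_derive z (1 : R) (fun z => F (x, z)) (Fz (x, z)) := C1_dz cF (x, z).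
have cF2 := continuous_slice2 (x := x) (C1_cont cF).
have cFz2 := continuous_slice2 (x := x) (C1_contz cF).
have dG (c z : R) : is_derive z (1 : R) (fun z => c * (z * F (x, z))) (c * (F (x, z) + z * Fz (x, z))).
  apply: is_deriveZ; apply: (is_derive_eq (is_deriveM (is_derive_id z (1 : R)) (dF z))).
  by rewrite -![_ *: _]/(_ * _) mulr1 addrC.
have cG (c : R) : continuous (fun z : R => c * (F (x, z) + z * Fz (x, z))).
  move=> z; apply: cvgM; first exact: cvg_cst.
  by apply: cvgD; [exact: cF2|apply: cvgM; [exact: cvg_id|exact: cFz2]].
have F0 z : `|z| = M -> F (x, z) = 0.
  by move=> zM; apply: FM0 => -[_ /=]; rewrite zM leNgt M0M.
have nM : M = `|M| by rewrite ger0_norm.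
have intG (c b e : R) : b <= e -> \int[mu]_(z in `[b, e]) (c * (F (x, z) + z * Fz (x, z))) =
    c * (e * F (x, e)) - c * (b * F (x, b)).
  by move=> be; exact: (Rintegral_FTC be (dG c) (cG c)).
have iG (c b e : R) : mu.-integrable `[b, e] (EFin \o (fun z => c * (F (x, z) + z * Fz (x, z)))).
  exact: continuous_itv_integrable.
pose sgk (z : R) : R := if 0 < z then - k else k.
have DE z : grad_f_a a (x, z) * F (x, z) - f_a a (x, z) ^+ 2 / 2 * Fz (x, z) =
    sgk z * (F (x, z) + z * Fz (x, z)).
  rewrite f_a_sqr /grad_f_a /sgk /k /=; case: ltrP => z0.
    by rewrite gtr0_norm//; ring.
  by rewrite ler0_norm//; ring.
rewrite /=; under eq_Rintegral do rewrite DE.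
have msg : measurable_fun `[- M, M] sgk.
  apply: measurable_funTS; apply: measurable_fun_ifT; [|exact: measurable_cst..].
  by apply: measurable_fun_ltr; [exact: measurable_cst|exact: measurable_id].
have iD : mu.-integrable `[- M, M] (EFin \o (fun z => sgk z * (1 * (F (x, z) + z * Fz (x, z))))).
  apply: (@integrable_bddM _ _ _ _ _ _ k) => //.
  by move=> z _; rewrite /sgk; case: ifP => _; rewrite ?normrN ger0_norm.
under eq_Rintegral do rewrite -(mul1r (F (x, _) + _)).
have IL : \int[mu]_(z in `[- M, 0]) (sgk z * (1 * (F (x, z) + z * Fz (x, z)))) = 0.
  transitivity (\int[mu]_(z in `[- M, 0]) (k * (F (x, z) + z * Fz (x, z)))).
    apply: eq_Rintegral => z; rewrite inE/= in_itv/= /sgk mul1r => /andP[_ z0].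
    by rewrite ltNge z0.
  by rewrite intG ?oppr_le0// mul0r F0 ?normrN// !mulr0 subrr.
have IR : \int[mu]_(z in `]0, M]) (sgk z * (1 * (F (x, z) + z * Fz (x, z)))) = 0.
  transitivity (\int[mu]_(z in `]0, M]) (- k * (F (x, z) + z * Fz (x, z)))).
    by apply: eq_Rintegral => z; rewrite inE/= in_itv/= /sgk mul1r => /andP[-> _].
  rewrite Rintegral_itv_obnd_cbnd; first by rewrite intG// mul0r F0// !mulr0 subrr.
  by apply: integrableS (iG _ 0 M) => //; exact: subset_itv_oc_cc.
have N0 : (BLeft (- M) <= BRight (0 : R))%O by rewrite bnd_simp oppr_le0.
have N1 : (BRight (0 : R) <= BRight M)%O by rewrite bnd_simp.
by have := Rintegral_itvB iD N0 N1; rewrite IL IR subr0.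
Qed.

End Representatives.

(** * The energy lower bound *)

Section MassBound.
Context {R : realType}.
Notation mu := (@lebesgue_measure R).
Notation P := (measurableTypeR R * measurableTypeR R)%type.
Notation mu0 := (@mu0 R).
Import HBNNSimple.
Implicit Types (F f g h : V0 R -> R) (w : V0 R).

Lemma measurable_axis : measurable [set w : P | w.2 = 0].
Proof.
rewrite (_ : [set w : P | w.2 = 0] = setT `*` [set 0]); last first.
  by apply/seteqP; split => [w|w []].
by apply: measurableX => //; exact: measurable_set1.
Qed.

Lemma mu0_axis : mu0 [set w : P | w.2 = 0] = 0.
Proof.
rewrite (_ : [set w : P | w.2 = 0] = setT `*` [set 0]); last first.
  by apply/seteqP; split => [w|w []].
have m1 : measurable ([set 0] : set (measurableTypeR R)) by exact: measurable_set1.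
rewrite [LHS](product_measure1E mu mu measurableT m1).
by rewrite [X in (_ * X)%E](lebesgue_measure_set1 0) mule0.
Qed.

Lemma grad_f_a_sg (a : R) w : w.2 != 0 ->
  grad_f_a a w * Num.sg (f_a a w) = a ^+ 2 / 2 * Num.sg a.
Proof.
move=> w0; have s0 : Num.sg (Num.sqrt `|w.2|) = 1 by rewrite gtr0_sg// sqrtr_gt0 normr_gt0.
rewrite /f_a !sgrM sgrN sgr_id s0 /grad_f_a.
by case: ltrgtP w0 => // w0 _; [rewrite (gtr0_sg w0)|rewrite (ltr0_sg w0)]; ring.
Qed.

Lemma gradient_mass_ge (a : R) g h H (T : set (V0 R)) (M : R) : a != 0 ->
  entire_intrinsic_lipschitz g -> bounded_gradient g h H ->
  closed T -> T `<=` box M -> (forall w, ~ T w -> f_a a w = g w) ->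
  (((a ^+ 2 / 2) ^+ 2)%:E * mu0 T <= \int[mu0]_(w in T) (h w ^+ 2)%:E)%E.
Proof.
move=> a0 lipg gg cT TM fgT.
have lipf := f_a_intrinsic_lipschitz a0.
have gf := bounded_gradient_f_a a0.
have cf := intrinsic_lipschitz_continuous lipf.
have := sign_mass_le cf (intrinsic_lipschitz_continuous lipg)
  (intrinsic_lipschitz_hoelder lipf) (intrinsic_lipschitz_hoelder lipg) gf gg cT TM fgT.
have mT := closed_measurable2 cT.
have iT k : loc_bounded k -> mu0.-integrable (T : set P) (EFin \o k).
  move=> lk; apply: (@integrableS _ _ _ _ (box M : set P)) => //; first exact: measurable_box.
  exact: loc_bounded_integrable_box.
have lh := bounded_gradient_loc_bounded gg.
have lh2 : loc_bounded (fun w => h w ^+ 2).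
  by under eq_fun do rewrite expr2; exact: loc_boundedM.
have lnh : loc_bounded (fun w => `|h w|).
  by apply: (loc_bounded_comp (s := Num.norm) _ lh); exact: norm_continuous.
pose c : R := a ^+ 2 / 2; rewrite -/c.
have c0 : 0 <= c by rewrite divr_ge0// sqr_ge0.
have i1 := iT _ (loc_bounded_cst 1).
have Tfin : mu0 T \is a fin_num.
  have := integrable_fin_num mT i1.
  by rewrite integral_cst// mul1e.
(* The integrand is the constant [c * Num.sg a] off the axis [z = 0], which is null and on which
   [f_a] vanishes. The absolute value then removes the sign of [a]. *)
have -> : \int[mu0]_(w in T) (grad_f_a a w * Num.sg (f_a a w)) = c * Num.sg a * fine (mu0 T).
  rewrite -Rintegral_cst//; congr fine; apply: ae_eq_integral => //.
  - apply/measurable_EFinP/measurable_funTS.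
    by have [] := loc_boundedM (bounded_gradient_loc_bounded gf) (loc_bounded_sg cf).
  - have [N [mN N0 Nsub]] : mu0.-negligible [set w : P | w.2 = 0].
      by exists [set w : P | w.2 = 0]; split => //; [exact: measurable_axis|exact: mu0_axis].
    exists N; split => // w Hw; apply: Nsub; apply: contrapT => /eqP w0; apply: Hw => _.
    by rewrite /= grad_f_a_sg.
rewrite normrM (normrM c) (ger0_norm c0) normr_sg a0 mulr1 (ger0_norm (fine_ge0 _))//.
move=> key.
have fin2 := integrable_fin_num mT (iT _ lh2).
rewrite -(fineK Tfin) -(fineK fin2) -EFinM lee_fin.
rewrite -[leRHS]/(\int[mu0]_(w in T) (h w ^+ 2)).
have le2 : \int[mu0]_(w in T) (2 * c * `|h w| - c ^+ 2 * 1) <= \int[mu0]_(w in T) (h w ^+ 2).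
  apply: le_Rintegral => //; [|exact: iT|].
  - apply: iT; apply: loc_boundedD; first by apply: loc_boundedM => //; exact: loc_bounded_cst.
    exact: loc_bounded_cst.
  - move=> w _; rewrite -(real_normK (num_real (h w))).
    have := sqr_ge0 (`|h w| - c); lra.
apply: le_trans le2; rewrite RintegralB//; last 2 first.
- by apply: iT; apply: loc_boundedM => //; exact: loc_bounded_cst.
- by apply: iT; exact: loc_bounded_cst.
rewrite RintegralZl//; last exact: iT.
rewrite RintegralZl//.
by rewrite Rintegral_cst// mul1r; nra.
Qed.

(* The projection of [W `&` intrinsic_graph f] need not be measurable, so the next two lemmas
   compare integrals on arbitrary sets through the simple functions below the integrand. *)
Lemma ge0_subset_integral_nonmeasurable d0 (T : measurableType d0)
    (m : {measure set T -> \bar R}) (E U : set T) (f : T -> \bar R) :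
  (forall x, 0 <= f x)%E -> E `<=` U ->
  (\int[m]_(x in E) f x <= \int[m]_(x in U) f x)%E.
Proof.
move=> f0 EU.
have fE (A : set T) x : (0 <= (f \_ A) x)%E by rewrite patchE; case: ifP.
rewrite integral_mkcond [leRHS]integral_mkcond !ge0_integralTE//.
apply: le_ereal_sup => _ [k /= kf <-]; exists k => //= x.
apply: le_trans (kf x) _; rewrite !patchE.
case: ifPn => xE; last by case: ifP.
by rewrite mem_set//; exact/EU/set_mem.
Qed.

Lemma integral_cst_le_nonmeasurable d0 (T : measurableType d0)
    (m : {measure set T -> \bar R}) (U : set T) (c : R) (B : \bar R) : 0 <= c -> (0 <= B)%E ->
  (forall E, measurable E -> E `<=` U -> (c%:E * m E <= B)%E) ->
  (\int[m]_(x in U) c%:E <= B)%E.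
Proof.
move=> c0 B0 H.
have fE x : (0 <= (cst c%:E \_ U) x)%E by rewrite patchE; case: ifP => //; rewrite lee_fin.
rewrite integral_mkcond ge0_integralTE//.
apply: ub_ereal_sup => _ [k /= kU <-].
pose E := k @^-1` `]0, +oo[.
have mE : measurable E by rewrite /E -[_ @^-1` _]setTI; apply: measurable_funP => //; exact: measurable_itv.
have EU : E `<=` U.
  move=> x; rewrite /E /= in_itv/= andbT => kx; apply: contrapT => xU.
  by have := kU x; rewrite patchE memNset// lee_fin leNgt kx.
rewrite -integralT_nnsfun (le_trans _ (H E mE EU))//.
rewrite -integral_cst// [leRHS]integral_mkcond; apply: ge0_le_integral => //.
- by move=> x _; rewrite lee_fin.
- exact/measurable_EFinP.
- by apply/(measurable_restrictT _ mE); exact: measurable_cst.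
- move=> x _; rewrite patchE; have [xE|xE] := boolP (x \in E).
    by have := kU x; rewrite patchE mem_set//; exact/EU/set_mem.
  rewrite lee_fin leNgt; apply: contra xE => kx.
  by rewrite inE /E /= in_itv/= kx.
Qed.

(** On [T] only the integrals compare, by [gradient_mass_ge]; off [T] the squared gradients agree
    almost everywhere. The constant integrand on [U] is tested on measurable subsets of [U]. *)
Lemma gradient_energy_ge (a : R) g h (T U : set (V0 R)) (M : R) : a != 0 ->
  entire_intrinsic_lipschitz g -> is_intrinsic_gradient g h ->
  closed T -> T `<=` box M -> T `<=` U -> (forall w, ~ T w -> f_a a w = g w) ->
  (\int[mu0]_(w in U) (grad_f_a a w ^+ 2)%:E <= \int[mu0]_(w in U) (h w ^+ 2)%:E)%E.
Proof.
move=> a0 lipg gh cT TM TU fgT.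
have [H [h' [gg [hh' mh]]]] := intrinsic_gradient_bounded gh.
have cf := intrinsic_lipschitz_continuous (f_a_intrinsic_lipschitz a0).
have agree := bounded_gradients_agree cf (intrinsic_lipschitz_continuous lipg)
  (bounded_gradient_f_a a0) gg cT fgT.
have mass := gradient_mass_ge a0 lipg gg cT TM fgT.
have mT := closed_measurable2 cT.
have mh' : measurable_fun [set: P] h' by case: gg.
have msq (k : V0 R -> R) : measurable_fun [set: P] k -> measurable_fun [set: P] (fun w => (k w ^+ 2)%:E).
  by move=> mk; apply/measurable_EFinP; exact: measurable_funX.
under eq_integral do rewrite grad_f_a_sqr.
apply: integral_cst_le_nonmeasurable.
- exact: sqr_ge0.
- by apply: integral_ge0 => w _; rewrite lee_fin sqr_ge0.
(* The inequality is available for the whole of [T] and not for its subsets, so [T] is adjoined to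
   [E0]; the union stays inside [U]. *)
move=> E0 mE0 E0U; pose E : set P := T `|` (E0 `\` T).
have mD : measurable (E0 `\` T : set P) by exact: measurableD.
have mE : measurable E by exact: measurableU.
have E0E : E0 `<=` E by move=> w wE; have [wT|wT] := pselect (T w); [left|right].
have EU : E `<=` U by move=> w [/TU//|[/E0U]].
apply: le_trans (ge0_subset_integral_nonmeasurable _ _ EU); last first.
  by move=> w; rewrite lee_fin sqr_ge0.
have -> : (\int[mu0]_(w in E) (h w ^+ 2)%:E = \int[mu0]_(w in E) (h' w ^+ 2)%:E)%E.
  apply: ae_eq_integral => //; [by apply: measurable_funTS; exact: msq..|].
  by apply: filterS hh' => w -> .
rewrite ge0_integral_setU//; last 3 first.
- by apply: measurable_funTS; exact: msq.
- by move=> w _; rewrite lee_fin sqr_ge0.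
- by apply/disj_setPS => w [wT [_]].
have -> : (\int[mu0]_(w in E0 `\` T) (h' w ^+ 2)%:E = ((a ^+ 2 / 2) ^+ 2)%:E * mu0 (E0 `\` T))%E.
  rewrite -integral_cst//; apply: ae_eq_integral => //; first by apply: measurable_funTS; exact: msq.
  apply: filterS agree => w hw [_ wT].
  by have /= [->] := hw wT; rewrite grad_f_a_sqr.
apply: le_trans (leeD mass (lexx _)).
rewrite -ge0_muleDr ?measure_ge0// -measureU//; last first.
  by rewrite -subset0 => w [wT [_]].
by rewrite lee_wpmul2l ?lee_fin ?sqr_ge0// le_measure// inE.
Qed.

End MassBound.

(** * Epigraphs and the minimality of [f_a] *)

Section Graphs.
Context {R : realType}.
Implicit Types (f g : V0 R -> R) (w : V0 R).

(** The point [w Y^t] in coordinates: the fibre of [heis_proj] over [w], parametrised by its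
    [y]-coordinate. *)
Definition vertical_line w (t : R) : heis R := (w.1, t, w.2 + w.1 * t / 2).

Lemma heis_proj_vertical_line w t : heis_proj (vertical_line w t) = w.
Proof. by case: w => x z; rewrite /heis_proj /vertical_line /xc /yc /zc /=; congr (_, _); ring. Qed.

Lemma vertical_line_graph f w : intrinsic_graph f (vertical_line w (f w)).
Proof. by exists w => //; exact: graph_pointE. Qed.

Lemma intrinsic_graph_vertical_line f p : intrinsic_graph f p ->
  exists w, p = vertical_line w (f w).
Proof. by move=> [w _ <-]; exists w; exact: graph_pointE. Qed.

Lemma epigraph_vertical_line f w t :
  epigraph (intrinsic_graph f) (vertical_line w t) <-> f w <= t.
Proof.
have mulY v (s r : R) : heis_mul (vertical_line v s) (Ypow r) = vertical_line v (s + r).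
  by rewrite /heis_mul /Ypow /vertical_line /xc /yc /zc /=; congr (_, _, _); ring.
split=> [[q [s [/intrinsic_graph_vertical_line[v ->] s0]]]|fwt].
  rewrite mulY => E; have := congr1 heis_proj E; rewrite !heis_proj_vertical_line => wv.
  by have := congr1 (@yc R) E; rewrite /vertical_line /yc /= wv => ->; rewrite lerDl.
exists (vertical_line w (f w)), (t - f w); split; [exact: vertical_line_graph|by rewrite subr_ge0|].
by rewrite mulY subrKC.
Qed.

Lemma continuous_heis_proj : continuous (@heis_proj R).
Proof.
have c1 : continuous (@xc R) by move=> p; apply: (@continuous_comp _ _ _ fst fst); exact: cvg_fst.
have c2 : continuous (@yc R).
  by move=> p; apply: (@continuous_comp _ _ _ fst snd); [exact: cvg_fst|exact: cvg_snd].
have c3 : continuous (@zc R) by move=> p; exact: cvg_snd.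
have c4 : continuous (fun p : heis R => zc p - xc p * yc p / 2).
  move=> p; apply: cvgB; first exact: c3.
  by apply: cvgM; [apply: cvgM; [exact: c1|exact: c2]|exact: cvg_cst].
by move=> p; exact: (cvg_pair (c1 p) (c4 p)).
Qed.

Lemma continuous_vertical_line (k : V0 R -> R) : continuous k ->
  continuous (fun w => vertical_line w (k w)).
Proof.
have c1 : continuous (fst : V0 R -> R) by move=> w; exact: cvg_fst.
move=> ck; have c2 : continuous (fun w : V0 R => w.2 + w.1 * k w / 2).
  move=> w; apply: cvgD; first exact: cvg_snd.
  by apply: cvgM; [apply: cvgM; [exact: c1|exact: ck]|exact: cvg_cst].
by move=> w; exact: (cvg_pair (cvg_pair (c1 w) (ck w)) (c2 w)).
Qed.

(** The difference of two epigraphs meets a fibre in a half-open segment: the lower endpoint belongs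
    to it and the upper one is a limit from below. *)
Lemma closure_vertical_line (A : set (heis R)) w (s t : R) : s < t ->
  (forall r, s <= r < t -> A (vertical_line w r)) ->
  closure A (vertical_line w s) /\ closure A (vertical_line w t).
Proof.
move=> st HA; split; first by apply: subset_closure; apply: HA; rewrite lexx.
have c1 : continuous (fun r : R => w.2 + w.1 * r / 2).
  move=> r; apply: cvgD; first exact: cvg_cst.
  by apply: cvgM; [apply: cvgM; [exact: cvg_cst|exact: cvg_id]|exact: cvg_cst].
have cv : continuous (fun r : R => vertical_line w r).
  by move=> r; exact: (cvg_pair (cvg_pair (@cvg_cst _ w.1 _ _ _) (@cvg_id _ _)) (c1 r)).
move=> B nB; have HB : \forall r \near (t : R)^'-, B (vertical_line w r).
  by apply: cvg_within; exact: cv nB.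
have [r [rB rst]] : exists r, B (vertical_line w r) /\ s <= r < t.
  near (t : R)^'- => r; exists r; split; first by near: r.
  by apply/andP; split; near: r; [exact: nbhs_left_ge|exact: nbhs_left_lt].
by exists (vertical_line w r); split => //; exact: HA.
Unshelve. all: by end_near. Qed.

Lemma epigraph_diff_closure f g w : f w != g w ->
  closure (epigraph (intrinsic_graph f) `+` epigraph (intrinsic_graph g)) (vertical_line w (f w)) /\
  closure (epigraph (intrinsic_graph f) `+` epigraph (intrinsic_graph g)) (vertical_line w (g w)).
Proof.
rewrite neq_lt => /orP[fg|fg].
- apply: closure_vertical_line fg _ => r /andP[fr rg]; left; split.
    exact/epigraph_vertical_line.
  by move=> /epigraph_vertical_line; rewrite leNgt rg.
- apply/and_comm; apply: closure_vertical_line fg _ => r /andP[fr rg]; right; split.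
    exact/epigraph_vertical_line.
  by move=> /epigraph_vertical_line; rewrite leNgt rg.
Qed.

End Graphs.

Theorem lemma3p5 (R : realType) (a : R) (ha : a != 0)
    (W : set (heis R)) (hW : open W) (bW : bounded_set W) :
  graph_minimizes_energy W (f_a a).
Proof.
have lipf := f_a_intrinsic_lipschitz ha; split => // p r g r0 lipg [].
set E := _ `+` _; set V := W `&` _ => cE EV.
set f := f_a a in lipf E cE EV *.
have cf := intrinsic_lipschitz_continuous lipf.
pose S := [set w | f w != g w]; pose T := closure S.
have SE w : S w -> closure E (vertical_line w (f w)) /\ closure E (vertical_line w (g w)).
  exact: epigraph_diff_closure.
have fgT w : ~ T w -> f w = g w.
  by move=> wT; apply/eqP; apply: contrapT => /negP wS; apply: wT; exact: subset_closure.
(* Over a point where [f] and [g] differ, both graph points lie in [closure E], hence in [V];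
   elsewhere the graph points coincide. Both energies are thus integrals over the same set. *)
have UE : heis_proj @` (V `&` intrinsic_graph f) = heis_proj @` (V `&` intrinsic_graph g).
  apply/seteqP; split=> _ [q [Vq /intrinsic_graph_vertical_line[w qw]] <-];
    rewrite qw heis_proj_vertical_line.
  - exists (vertical_line w (g w)); last exact: heis_proj_vertical_line.
    split; last exact: vertical_line_graph.
    have [fg|fg] := eqVneq (f w) (g w); first by rewrite -fg -qw.
    by apply: EV; have [] := SE _ fg.
  - exists (vertical_line w (f w)); last exact: heis_proj_vertical_line.
    split; last exact: vertical_line_graph.
    have [fg|fg] := eqVneq (f w) (g w); first by rewrite fg -qw.
    by apply: EV; have [] := SE _ fg.
(* The inclusion known over [S] extends to its closure because the parametrisation of the graph of
   [f] is continuous. *)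
have TE w : T w -> closure E (vertical_line w (f w)).
  move=> Tw; rewrite (closure_id (closure E)).1; last exact: closed_closure.
  move=> B nB; have [v [Sv Bv]] := Tw _ (continuous_vertical_line cf nB).
  by exists (vertical_line v (f v)); split => //; have [] := SE v Sv.
have TU : T `<=` heis_proj @` (V `&` intrinsic_graph f).
  move=> w Tw; exists (vertical_line w (f w)); last exact: heis_proj_vertical_line.
  by split; [exact/EV/TE|exact: vertical_line_graph].
(* [T] is contained in the projection of the compact set [closure E]. *)
have [M TM] : exists M, T `<=` box M.
  have /compact_bounded[K [_ HK]] : compact (@heis_proj R @` closure E).
    by apply: continuous_compact cE; apply: continuous_subspaceT; exact: continuous_heis_proj.
  exists (`|K| + 1) => w Tw.
  have : `|w| <= `|K| + 1.
    apply: HK; first by rewrite ltr_pwDr// ler_norm.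
    by exists (vertical_line w (f w)); [exact: TE|exact: heis_proj_vertical_line].
  by rewrite prod_normE ge_max => /andP[].
rewrite /graph_energy -UE.
apply: le_ereal_inf_tmp => _ [h gh <-].
(* The energy of [f_a] is an infimum, so its value at the single representative [grad_f_a] bounds it
   above; for [g] every representative [h] has to be treated. *)
apply: (@le_trans _ _ ((2^-1)%:E * \int[mu0]_(w in heis_proj @` (V `&` intrinsic_graph f)) (grad_f_a a w ^+ 2)%:E)%E).
  apply: ereal_inf_lbound; exists (grad_f_a a) => //.
  exact: bounded_gradient_intrinsic (bounded_gradient_f_a ha).
rewrite lee_pmul2l//.
exact: (gradient_energy_ge ha lipg gh (@closed_closure _ S) TM TU fgT).
Qed.
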